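(* Let $V$ be an $\mathbb{F}((t))$-module, $\mathbf{1}$ a vector of $V$, $U$ an $\mathbb{F}((t))$-submodule of $V$, and $$Y_0(\cdot,x):U\to\mathcal{E}(V)=\mathrm{Hom}_{\mathbb{F}((t))}(V,V((x))),\quad u\mapsto Y_0(u,x)=u(x)=\sum_{n\in\mathbb{Z}}u_nx^{-n-1},$$ an $\mathbb{F}$-linear map, such that for $u\in U$, $f(t)\in\mathbb{F}((t))$, $$Y_0(u,x)\mathbf{1}\in V[[x]]\ \text{ and }\ \lim_{x\to0}Y_0(u,x)\mathbf{1}=u,\qquad Y_0(f(t)u,x)=f(t+x)Y_0(u,x);$$ the set $U(x)=\{Y_0(u,x)\mid u\in U\}$ is compatible; and $V$ is linearly spanned over $\mathbb{F}((t))$ by the vectors $u^{(1)}_{m_1}\cdots u^{(r)}_{m_r}\mathbf{1}$ for $r\ge0$, $u^{(i)}\in U$, $m_i\in\mathbb{Z}$. Suppose that there exists an $\mathbb{F}$-linear map $\psi_x$ from $V$ to $\mathbb{F}((t))((x))\langle U(x)\rangle$ such that $$\psi_x(f(t)v)=f(t+x)\psi_x(v)\quad\text{for }f(t)\in\mathbb{F}((t)),\ v\in V,$$ $$\psi_x(\mathbf{1})=1_V,\qquad\psi_x(u_nv)=u(x)_n\psi_x(v)\quad\text{for }u\in U,\ n\in\mathbb{Z},\ v\in V.$$ In addition, assume that $U(x)$ is $\mathcal{S}_t$-local. Set $Y(v,x)=\psi_x(v)\in\mathcal{E}(V)$ for $v\in V$. Then $Y(\cdot,x)$ extends the map $Y_0(\cdot,x)$,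 and $(V,Y,\mathbf{1})$ carries the structure of a weak quantum vertex $\mathbb{F}((t))$-algebra.
   Context: $\mathbb{F}$ is a field of characteristic $0$; $t,x,x_0,x_1,\dots$ are commuting formal variables. $V((x))$ is the space of lower truncated Laurent series; $V((x_1,\dots,x_r))$ consists of series globally truncated from below in all variables. $\mathbb{F}_*(x_1,\dots,x_r)$ is the localization of $\mathbb{F}[[x_1,\dots,x_r]]$ at the nonzero polynomials; $\iota_{x_{i_1},\dots,x_{i_r}}:\mathbb{F}_*(x_1,\dots,x_r)\to\mathbb{F}((x_{i_1}))\cdots((x_{i_r}))$ is the unique algebra embedding extending the identity of $\mathbb{F}[[x_1,\dots,x_r]]$. Powers of $x_0+x_2$ are expanded in nonnegative powers of the second variable; $\delta(x)=\sum_{n\in\mathbb{Z}}x^n$; $f(t+x)=e^{x\,d/dt}f(t)\in\mathbb{F}((t))[[x]]$; for $f\in\mathbb{F}_*(x_1,x_2)$, $f(t+x_1,t+x_2)=e^{t(\partial_{x_1}+\partial_{x_2})}f\in\mathbb{F}_*(t,x_1,x_2)$. Nonlocal vertex algebra over $\mathbb{F}$: a vector space $V$ with a linear map $Y(\cdot,x):V\to\mathrm{Hom}(V,V((x)))$ and $\mathbf{1}\in V$ with $Y(\mathbf{1},x)v=v$, $Y(v,x)\mathbf{1}\in V[[x]]$, $\lim_{x\to0}Y(v,x)\mathbf{1}=v$, and for all $u,v,w\in V$ there is $l\in\mathbb{N}$ with $(x_0+x_2)^lY(u,x_0+x_2)Y(v,x_2)w=(x_0+x_2)^lY(Y(u,x_0)v,x_2)w$.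 Nonlocal vertex $\mathbb{F}((t))$-algebra: a nonlocal vertex algebra over $\mathbb{F}$ which is also an $\mathbb{F}((t))$-module with $Y(f(t)u,x)(g(t)v)=f(t+x)g(t)Y(u,x)v$. It is a weak quantum vertex $\mathbb{F}((t))$-algebra if for any $u,v\in V$ there exist finitely many $u^{(i)},v^{(i)}\in V$, $f_i\in\mathbb{F}_*(x_1,x_2)$ with $$x_0^{-1}\delta\left(\tfrac{x_1-x_2}{x_0}\right)Y(u,x_1)Y(v,x_2)-x_0^{-1}\delta\left(\tfrac{x_2-x_1}{-x_0}\right)\sum_i\iota_{t,x_2,x_1}(f_i(t+x_1,t+x_2))Y(v^{(i)},x_2)Y(u^{(i)},x_1)=x_2^{-1}\delta\left(\tfrac{x_1-x_0}{x_2}\right)Y(Y(u,x_0)v,x_2).$$ For an $\mathbb{F}((t))$-module $V$, $\mathcal{E}(V)=\mathrm{Hom}_{\mathbb{F}((t))}(V,V((x)))$, which is an $\mathbb{F}((t))((x))$-module. A subset of $\mathcal{E}(V)$ is compatible if for every finite sequence $a_1(x),\dots,a_r(x)$ in it there is $k\in\mathbb{N}$ with $\left(\prod_{i<j}(x_i-x_j)^k\right)a_1(x_1)\cdots a_r(x_r)\in\mathrm{Hom}(V,V((x_1,\dots,x_r)))$. For a pair $(a(x),b(x))$ with $(x_1-x_2)^ka(x_1)b(x_2)\in\mathrm{Hom}(V,V((x_1,x_2)))$, define $a(x)_nb(x)\in\mathcal{E}(V)$ by $$Y_{\mathcal{E}}(a(x),x_0)b(x)=\sum_{n\in\mathbb{Z}}a(x)_nb(x)x_0^{-n-1}=x_0^{-k}\left((x_1-x)^ka(x_1)b(x)\right)|_{x_1=x+x_0}.$$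 $\langle U(x)\rangle$ is the smallest compatible $\mathbb{F}((t))$-subspace of $\mathcal{E}(V)$ containing $U(x)$ and $1_V$ and closed under all $(a(x),b(x))\mapsto a(x)_nb(x)$; $\mathbb{F}((t))((x))\langle U(x)\rangle$ is its $\mathbb{F}((t))((x))$-span (which is again compatible and closed). A subset $U$ of $\mathcal{E}(V)$ is $\mathcal{S}_t$-local if for any $a(x),b(x)\in U$ there exist finitely many $u^{(i)}(x),v^{(i)}(x)\in U$, $f_i\in\mathbb{F}_*(x_1,x_2)$ and $k\in\mathbb{N}$ with $$(x_1-x_2)^ka(x_1)b(x_2)=(x_1-x_2)^k\sum_i\iota_{t,x_2,x_1}(f_i(t+x_1,t+x_2))u^{(i)}(x_2)v^{(i)}(x_1).$$ *)

(* Defs.v *)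
From HB Require Import structures.
From mathcomp Require Import all_boot all_order all_algebra.
From mathcomp Require Import all_classical.
From mathcomp Require Import zify.

Set Implicit Arguments.
Unset Strict Implicit.
Unset Printing Implicit Defensive.

Import Order.TTheory GRing.Theory Num.Theory.

Local Open Scope classical_set_scope.
Local Open Scope ring_scope.

Definition lower_truncated (V : zmodType) : {pred int -> V} :=
  fun f => `[< exists N : int, forall n, n < N -> f n = 0 >].

Fact lower_truncated_zmod (V : zmodType) : zmod_closed (@lower_truncated V).
Proof.
split=> [|f g /asboolP[M hM] /asboolP[N hN]]; apply/asboolP; first by exists 0.
exists (Num.min M N) => n; rewrite lt_min => /andP[nM nN].
by rewrite -[(f - g) n]/(f n - g n) hM // hN // subr0.
Qed.

HB.instance Definition _ (V : zmodType) :=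
  GRing.isZmodClosed.Build (int -> V) (@lower_truncated V)
    (@lower_truncated_zmod V).

(* V((x)): a series is the function giving its coefficients *)
Record lser (V : zmodType) := Lser {
  lcoef :> int -> V;
  _ : lower_truncated lcoef }.

HB.instance Definition _ (V : zmodType) := [isSub for @lcoef V].
HB.instance Definition _ (V : zmodType) := [Choice of lser V by <:].
HB.instance Definition _ (V : zmodType) :=
  [SubChoice_isSubZmodule of lser V by <:].

Section LserTheory.
Variable V : zmodType.
Implicit Types (a b : lser V) (f : int -> V).

Lemma lserP a b : (forall n, a n = b n) -> a = b.
Proof. by move=> ab; apply: val_inj; apply/funext. Qed.

Lemma lser_trunc a : exists N : int, forall n, n < N -> a n = 0.
Proof. by case: a => f hf; apply/asboolP. Qed.

Lemma lcoef0 n : (0 : lser V) n = 0. Proof. by []. Qed.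
Lemma lcoefD a b n : (a + b) n = a n + b n. Proof. by []. Qed.
Lemma lcoefN a n : (- a) n = - a n. Proof. by []. Qed.

(* The series with coefficients f, or 0 if f is not lower truncated *)
Definition mkL f : lser V := insubd 0 f.

Lemma mkLE f : (exists N : int, forall n, n < N -> f n = 0) -> mkL f = f :> (int -> V).
Proof. by move=> hf; rewrite /mkL [LHS]insubdK//; apply/asboolP. Qed.

End LserTheory.

Lemma fsum_over (V : zmodType) (I : choiceType) (s : seq I) (F : I -> V) :
  uniq s -> (forall i, F i != 0 -> i \in s) ->
  \sum_(i \in [set: I]) F i = \sum_(i <- s) F i.
Proof.
move=> us hs; rewrite [RHS]fsbig_seq// [RHS](fsbig_widen [set` s] setT)// => i /= [_ nis].
by apply/eqP; apply: contra_notT nis => /hs.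
Qed.

Definition irange (a : int) (n : nat) : seq int := [seq a + i%:Z | i <- iota 0 n].

Lemma irange_uniq a n : uniq (irange a n).
Proof. by rewrite map_inj_uniq ?iota_uniq// => i j /addrI[]. Qed.

Lemma mem_irange a n i : (i \in irange a n) = (a <= i < a + n%:Z).
Proof.
apply/mapP/idP => [[j]|h]; first by rewrite mem_iota => /= + ->; lia.
by exists (absz (i - a)%R); rewrite ?mem_iota; lia.
Qed.

Section Conv.
Variables (R : comNzRingType) (M : lmodType R).
Implicit Types (f : lser R) (v : lser M).

Definition lscale f v : lser M :=
  mkL (fun n : int => \sum_(i \in [set: int]) f i *: v (n - i)).

Lemma lscale_trunc f v : exists N : int, forall n, n < N ->
  \sum_(i \in [set: int]) f i *: v (n - i) = 0.
Proof.
have [A hA] := lser_trunc f; have [B hB] := lser_trunc v.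
exists (A + B) => n nAB; apply: fsbig1 => i _.
have [iA|iA] := ltP i A; first by rewrite hA// scale0r.
by rewrite hB ?scaler0//; lia.
Qed.

Lemma lscaleE f v n :
  lscale f v n = \sum_(i \in [set: int]) f i *: v (n - i).
Proof. by rewrite /lscale mkLE//; exact: lscale_trunc. Qed.

Lemma lscale_range f v n (s : seq int) : uniq s ->
  (forall i, f i != 0 -> v (n - i) != 0 -> i \in s) ->
  lscale f v n = \sum_(i <- s) f i *: v (n - i).
Proof.
move=> us hs; rewrite lscaleE; apply: fsum_over => // i.
have [->|f0] := eqVneq (f i) 0; first by rewrite scale0r eqxx.
have [->|v0 _] := eqVneq (v (n - i)) 0; first by rewrite scaler0 eqxx.
exact: hs.
Qed.

Lemma lscale_bound f v (A B : int) n (k : nat) :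
  (forall i, i < A -> f i = 0) -> (forall i, i < B -> v i = 0) ->
  n - B - A < k%:Z ->
  lscale f v n = \sum_(i <- irange A k) f i *: v (n - i).
Proof.
move=> hA hB hk; apply: lscale_range (irange_uniq _ _) _ => i f0 v0.
rewrite mem_irange; apply/andP; split.
  by rewrite leNgt; apply: contra_neqN f0 => /hA.
have : B <= n - i by rewrite leNgt; apply: contra_neqN v0 => /hB.
by lia.
Qed.
End Conv.

Section Const.
Variable V : zmodType.
Implicit Types v : V.

Definition lconst v : lser V := mkL (fun n : int => if n == 0 then v else 0).

Lemma lconstE v n : lconst v n = if n == 0 then v else 0.
Proof. by rewrite /lconst mkLE//; exists 0 => m; case: eqP => // ->; rewrite ltxx. Qed.

Lemma lconst_is_zmod_morphism : zmod_morphism lconst.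
Proof.
by move=> u v; apply: lserP => n; rewrite lcoefD lcoefN !lconstE; case: eqP; rewrite ?subrr.
Qed.
HB.instance Definition _ :=
  GRing.isZmodMorphism.Build V (lser V) lconst lconst_is_zmod_morphism.
End Const.

Section ConvTheory.
Variables (R : comNzRingType) (M : lmodType R).
Implicit Types (f g : lser R) (v w : lser M).

Definition lmul f g : lser R := lscale (M := R^o) f g.

Lemma lmulE f g n : lmul f g n = \sum_(i \in [set: int]) f i * g (n - i).
Proof. exact: (@lscaleE R R^o f g n). Qed.

Lemma lscaleA f g v : lscale f (lscale g v) = lscale (lmul f g) v.
Proof.
apply: lserP => n.
have [A hA] := lser_trunc f; have [B hB] := lser_trunc g.
have [C hC] := lser_trunc v.
pose k := (absz (n - A - B - C)%R).+1.
have hgv i : i < B + C -> lscale g v i = 0.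
  move=> iBC; rewrite lscaleE; apply: fsbig1 => j _.
  have [jB|jB] := ltP j B; first by rewrite hB// scale0r.
  by rewrite hC ?scaler0//; lia.
have hfg i : i < A + B -> lmul f g i = 0.
  move=> iBC; rewrite lmulE; apply: fsbig1 => j _.
  have [jB|jB] := ltP j A; first by rewrite hA// mul0r.
  by rewrite hB ?mulr0//; lia.
rewrite (lscale_bound (A := A) (B := B + C) (k := k))//; last by rewrite /k; lia.
rewrite (lscale_bound (A := A + B) (B := C) (k := k))//; last by rewrite /k; lia.
have E m : m \in irange (A + B) k ->
    lmul f g m *: v (n - m) = \sum_(i <- irange A k) (f i * g (m - i)) *: v (n - m).
  rewrite mem_irange => hm.
  rewrite /lmul (lscale_bound (A := A) (B := B) (k := k))//; last first.
    by move: hm; rewrite /k; lia.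
  by rewrite scaler_suml.
rewrite [RHS](eq_big_seq _ E) [RHS]exchange_big/=; apply: eq_big_seq => i; rewrite mem_irange => hi.
rewrite (@lscale_range _ _ _ _ _ [seq m - i | m <- irange (A + B) k]); first last.
- move=> j g0 v0; apply/mapP; exists (j + i); last by rewrite addrK.
  have jB : B <= j by rewrite leNgt; apply: contra_neqN g0 => /hB.
  have jC : C <= n - i - j by rewrite leNgt; apply: contra_neqN v0 => /hC.
  by rewrite mem_irange /k; lia.
- by rewrite map_inj_uniq ?irange_uniq// => x y /addIr.
rewrite big_map scaler_sumr; apply: eq_bigr => m _.
by rewrite scalerA; congr (_ *: v _); lia.
Qed.

Lemma lscale1 v : lscale (lconst 1) v = v.
Proof.
apply: lserP => n; rewrite (@lscale_range _ _ _ _ _ [:: 0])//.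
  by rewrite big_seq1 lconstE eqxx scale1r subr0.
by move=> i; rewrite lconstE inE; case: (i == 0); rewrite ?eqxx.
Qed.

Lemma lscaleDr f : {morph @lscale R M f : v w / v + w}.
Proof.
move=> v w; apply: lserP => n; rewrite lcoefD.
have [A hA] := lser_trunc f; have [B hB] := lser_trunc v.
have [C hC] := lser_trunc w.
have [D DB DC] : exists2 D : int, D <= B & D <= C.
  by exists (Num.min B C); rewrite ge_min lexx ?orbT.
have hD1 i : i < D -> v i = 0 by move=> ?; apply: hB; lia.
have hD2 i : i < D -> w i = 0 by move=> ?; apply: hC; lia.
have hD3 i : i < D -> (v + w) i = 0 by move=> ?; rewrite lcoefD hD1// hD2// addr0.
pose k := (absz (n - D - A)%R).+1.
have hk : n - D - A < k%:Z by rewrite /k; lia.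
rewrite !(lscale_bound hA _ hk)//.
by rewrite -big_split; apply: eq_bigr => i _; rewrite lcoefD scalerDr.
Qed.

Lemma lscaleDl v : {morph (@lscale R M)^~ v : f g / f + g}.
Proof.
move=> f g; apply: lserP => n; rewrite lcoefD.
have [A hA] := lser_trunc v; have [B hB] := lser_trunc f.
have [C hC] := lser_trunc g.
have [D DB DC] : exists2 D : int, D <= B & D <= C.
  by exists (Num.min B C); rewrite ge_min lexx ?orbT.
have hD1 i : i < D -> f i = 0 by move=> ?; apply: hB; lia.
have hD2 i : i < D -> g i = 0 by move=> ?; apply: hC; lia.
have hD3 i : i < D -> (f + g) i = 0 by move=> ?; rewrite lcoefD hD1// hD2// addr0.
pose k := (absz (n - A - D)%R).+1.
have hk : n - A - D < k%:Z by rewrite /k; lia.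
rewrite !(lscale_bound _ hA hk)//.
by rewrite -big_split; apply: eq_bigr => i _; rewrite lcoefD scalerDl.
Qed.
End ConvTheory.

Section LaurentRing.
Variable R : comNzRingType.
Implicit Types f g h : lser R.

Lemma lmulC : commutative (@lmul R).
Proof.
move=> f g; apply: lserP => n; rewrite !lmulE.
rewrite (reindex_fsbigT (fun i : int => n - i)).
  by apply: eq_fsbigr => i _; rewrite mulrC; congr (g _ * _); lia.
by exists (fun i : int => n - i) => i; lia.
Qed.

Lemma lmulA : associative (@lmul R).
Proof. by move=> f g h; rewrite /lmul lscaleA. Qed.

Lemma lmul1 : left_id (lconst 1) (@lmul R).
Proof. by move=> f; rewrite /lmul lscale1. Qed.

Lemma lmulDl : left_distributive (@lmul R) +%R.
Proof. by move=> f g h; rewrite /lmul (@lscaleDl R R^o). Qed.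

Lemma lconst1_neq0 : lconst 1 != 0 :> lser R.
Proof.
apply/eqP => /(congr1 (fun f : lser R => f 0)).
by rewrite lconstE eqxx => /eqP; rewrite oner_eq0.
Qed.

HB.instance Definition _ := GRing.Zmodule_isComNzRing.Build (lser R)
  lmulA lmulC lmul1 lmulDl lconst1_neq0.

Lemma lcoefM f g n : (f * g) n = \sum_(i \in [set: int]) f i * g (n - i).
Proof. exact: lmulE. Qed.

Lemma lcoef1 n : (1 : lser R) n = (n == 0)%:R.
Proof. by rewrite [LHS]lconstE; case: eqP. Qed.

Lemma lmul_bound f g (A B : int) n (k : nat) :
  (forall i, i < A -> f i = 0) -> (forall i, i < B -> g i = 0) ->
  n - B - A < k%:Z ->
  (f * g) n = \sum_(i <- irange A k) f i * g (n - i).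
Proof. exact: (@lscale_bound R R^o). Qed.

Lemma lconst_is_monoid_morphism : monoid_morphism (@lconst R).
Proof.
split=> // a b; apply: lserP => n; rewrite (@lmul_bound _ _ 0 0 _ (absz (n)%R).+1).
- rewrite big_cons big1_seq => [|i].
    by rewrite addr0 (_ : 0 + 0%:Z = 0 :> int)// subr0 !lconstE eqxx; case: ifP; rewrite ?mulr0.
  by case/mapP => j; rewrite mem_iota lconstE => /= hj ->; case: eqP; rewrite ?mul0r//; lia.
- by move=> i; rewrite lconstE; case: eqP => // ->; rewrite ltxx.
- by move=> i; rewrite lconstE; case: eqP => // ->; rewrite ltxx.
- by lia.
Qed.
HB.instance Definition _ :=
  GRing.isMonoidMorphism.Build R (lser R) (@lconst R) lconst_is_monoid_morphism.

Lemma lser_lead f : f != 0 ->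
  exists A : int, f A != 0 /\ forall i, i < A -> f i = 0.
Proof.
move=> f0; have [N hN] := lser_trunc f.
have [m fm] : exists m : nat, f (N + m%:Z) != 0.
  apply: contrapT => /forallNP h; move/eqP: f0; apply; apply: lserP => n.
  have [/hN//|nN] := ltP n N; apply/eqP/negPn/negP.
  by have := h (absz (n - N)%R); rewrite (_ : N + _ = n) //; lia.
have [k fk kmin] := ex_minnP (ex_intro (fun m : nat => f (N + m%:Z) != 0) _ fm).
exists (N + k%:Z); split=> // i ik; have [/hN//|iN] := ltP i N.
apply/eqP; apply: contraTT ik => fi; rewrite -leNgt.
have := kmin (absz (i - N)%R); rewrite (_ : N + _ = i); last by lia.
by move=> /(_ fi); lia.
Qed.

Lemma lmul_lead f g (A B : int) :
  (forall i, i < A -> f i = 0) -> (forall i, i < B -> g i = 0) ->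
  (f * g) (A + B) = f A * g B.
Proof.
move=> hA hB; rewrite (@lmul_bound _ _ A B _ 1)//; last by lia.
by rewrite big_seq1 addr0; congr (_ * g _); lia.
Qed.
End LaurentRing.

HB.instance Definition _ (R : comNzRingType) (M : lmodType R) :=
  GRing.Zmodule_isLmodule.Build (lser R) (lser M)
    (@lscaleA R M) (@lscale1 R M) (@lscaleDr R M) (@lscaleDl R M).

Lemma lser_mulf_eq0 (R : idomainType) (f g : lser R) :
  f * g = 0 -> (f == 0) || (g == 0).
Proof.
have [//|f0] := eqVneq f 0; have [//|g0] := eqVneq g 0.
have [A [fA hA]] := lser_lead f0; have [B [gB hB]] := lser_lead g0.
move=> /(congr1 (fun h : lser R => h (A + B))); rewrite lmul_lead// => /eqP.
by rewrite mulf_eq0 (negPf fA) (negPf gB).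
Qed.

Section LaurentField.
Variable K : fieldType.
Implicit Types f : lser K.

Lemma power_series_inv (c : nat -> K) : c 0%N != 0 ->
  exists h : nat -> K, forall n, \sum_(j < n.+1) c j * h (n - j)%N = (n == 0%N)%:R.
Proof.
move=> c0.
pose step (s : seq K) :=
  (c 0%N)^-1 * ((size s == 0%N)%:R - \sum_(j < size s) c j.+1 * s`_(size s - j.+1)).
pose H := fix H n := if n is m.+1 then rcons (H m) (step (H m)) else [::].
have sH n : size (H n) = n by elim: n => //= n IH; rewrite size_rcons IH.
have Hnth m i : (i < m)%N -> (H m)`_i = step (H i).
  elim: m => // m IH; rewrite ltnS leq_eqVlt => /predU1P[->|im] /=.
    by rewrite nth_rcons sH ltnn eqxx.
  by rewrite nth_rcons sH im IH.
exists (fun i => step (H i)) => n; rewrite big_ord_recl subn0.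
rewrite [step]lock /= -lock {1}/step sH mulrA mulfV// mul1r.
rewrite -[RHS](subrK (\sum_(j < n) c j.+1 * (H n)`_(n - j.+1))).
congr (_ + _); apply: eq_bigr => j _; rewrite Hnth//.
by case: n j => [[]|n j]//; rewrite ltn_subrL.
Qed.

Lemma lser_inv f : f != 0 -> exists g, g * f = 1.
Proof.
move=> /lser_lead[A [fA hA]].
have [|h hh] := @power_series_inv (fun i => f (A + i%:Z)); first by rewrite addr0.
pose g0 (n : int) := if 0 <= n + A then h (absz (n + A)%R) else 0.
have hg0 : exists N : int, forall n, n < N -> g0 n = 0.
  by exists (- A) => n nA; rewrite /g0 ifF//; lia.
exists (mkL g0); rewrite mulrC; apply: lserP => n; rewrite lcoef1.
have hB i : i < - A -> mkL g0 i = 0.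
  by move=> iA; rewrite mkLE// /g0 ifF//; lia.
case: n => n; last first.
  rewrite (@lmul_bound _ _ _ A (- A) _ 0)//; last by lia.
  by rewrite big_nil.
rewrite (@lmul_bound _ _ _ A (- A) _ n.+1)//; last by lia.
rewrite -(hh n) big_map -[X in iota 0 X]subn0 -/(index_iota 0 n.+1) big_mkord.
apply: eq_bigr => j _; congr (_ * _); rewrite mkLE// /g0 ifT; last first.
  by have := ltn_ord j; lia.
by congr h; have := ltn_ord j; lia.
Qed.

Definition linv f : lser K := if f == 0 then 0 else xget 0 [set g | g * f = 1].

Lemma lmulVf f : f != 0 -> linv f * f = 1.
Proof.
move=> f0; rewrite /linv (negPf f0).
by case: xgetP => [g _ //|h]; have [g gf] := lser_inv f0; case: (h g).
Qed.

Lemma linv0 : linv 0 = 0. Proof. by rewrite /linv eqxx. Qed.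

HB.instance Definition _ := GRing.ComNzRing_isField.Build (lser K) lmulVf linv0.
End LaurentField.

Definition power_series (R : zmodType) : {pred lser R} :=
  fun f => `[< forall n : int, n < 0 -> f n = 0 >].

Fact power_series_subring (R : comNzRingType) : subring_closed (@power_series R).
Proof.
split=> [|f g /asboolP hf /asboolP hg|f g /asboolP hf /asboolP hg]; apply/asboolP => n n0.
- by rewrite lcoef1; case: eqP => // n0'; move: n0; rewrite n0'.
- by rewrite lcoefD lcoefN hf// hg// subr0.
- by rewrite (@lmul_bound _ _ _ 0 0 _ 0) ?big_nil//; lia.
Qed.

HB.instance Definition _ (R : comNzRingType) :=
  GRing.isSubringClosed.Build (lser R) (@power_series R)
    (@power_series_subring R).

(* R[[x]], as a subring of R((x)) *)
Record pser (R : comNzRingType) := Pser {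
  lser_of_pser : lser R;
  _ : lser_of_pser \in @power_series R }.

HB.instance Definition _ (R : comNzRingType) := [isSub for @lser_of_pser R].
HB.instance Definition _ (R : comNzRingType) := [Choice of pser R by <:].
HB.instance Definition _ (R : comNzRingType) :=
  [SubChoice_isSubComNzRing of pser R by <:].

Section PserDomain.
Variable R : idomainType.
Implicit Types f g : pser R.

Definition pser_unit : {pred pser R} := fun f => `[< exists g, g * f = 1 >].
Definition pser_inv f := if f \in pser_unit then xget 0 [set g | g * f = 1] else f.

Fact pser_mulVr : {in pser_unit, left_inverse 1 pser_inv *%R}.
Proof.
move=> f fu; rewrite /pser_inv fu; move: fu => /asboolP[g gf].
by case: xgetP => [h _ //|h]; case: (h g).
Qed.

Fact pser_unitP f g : g * f = 1 -> f \in pser_unit.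
Proof. by move=> gf; apply/asboolP; exists g. Qed.

Fact pser_inv_out : {in [predC pser_unit], pser_inv =1 id}.
Proof. by move=> f; rewrite inE /pser_inv => /negPf->. Qed.

HB.instance Definition _ := GRing.ComNzRing_hasMulInverse.Build (pser R)
  pser_mulVr pser_unitP pser_inv_out.

Fact pser_mulf_eq0 f g : f * g = 0 -> (f == 0) || (g == 0).
Proof. by move=> /(congr1 val) /lser_mulf_eq0. Qed.

HB.instance Definition _ :=
  GRing.ComUnitRing_isIntegral.Build (pser R) pser_mulf_eq0.
End PserDomain.


(* F((t)), F((t))((x2))((x1)), V((x2))((x1)), etc. are iterated lser; the
   outermost series is in the variable listed last, so that (s m n) is the
   coefficient of x1^m x2^n in s : lser (lser V) = V((x2))((x1)). Likewise
   pser (pser F) is F[[x2]][[x1]] = F[[x1, x2]] and pser (pser (pser F)) is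
   F[[t]][[x2]][[x1]] = F[[t, x1, x2]], with outermost variable x1. *)

Definition mkP (R : comNzRingType) (f : nat -> R) : pser R :=
  insubd 0 (mkL (fun n : int => if n is Posz m then f m else 0)).

Definition pcoef (R : comNzRingType) (f : pser R) (n : nat) : R :=
  val f n%:Z.

Lemma pcoef_mkP (R : comNzRingType) (f : nat -> R) n : pcoef (mkP f) n = f n.
Proof.
have E : mkL (fun m : int => if m is Posz k then f k else 0) =
    (fun m : int => if m is Posz k then f k else 0) :> (int -> R).
  by apply: mkLE; exists 0 => -[].
rewrite /pcoef /mkP insubdK ?E//; apply/asboolP => m m0; rewrite E.
by case: m m0.
Qed.

Section Substitution.
Variable F : fieldType.

Definition lderiv (f : lser F) : lser F :=
  mkL (fun n : int => (n + 1)%:~R * f (n + 1)).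

(* f(t + x) = exp(x d/dt) f(t), in F((t))[[x]] *)
Definition shift_x (f : lser F) : lser (lser F) :=
  mkL (fun n : int => if n is Posz k
                      then lconst (k`!%:R^-1) * iter k lderiv f else 0).

Local Notation Fx12 := (pser (pser F)).
Local Notation Ftx12 := (pser (pser (pser F))).
Local Notation "x %:F" := (@FracField.tofrac _ x).

Definition polynomial2 (p : Fx12) : Prop :=
  exists N : nat, forall i j : nat,
    (N <= i)%N || (N <= j)%N -> pcoef (pcoef p i) j = 0.

(* F_*(x1, x2), inside the field of fractions of the domain F[[x1, x2]] *)
Definition Fstar12 : set {fraction Fx12} :=
  [set f | exists g p : Fx12, [/\ polynomial2 p, p != 0 & f = g%:F / p%:F]].

Definition deriv12 (c : nat -> nat -> F) (i j : nat) : F :=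
  i.+1%:R * c i.+1 j + j.+1%:R * c i j.+1.

(* g(t + x1, t + x2) = exp(t (d/dx1 + d/dx2)) g(x1, x2) *)
Definition shift_t_pser (g : Fx12) : Ftx12 :=
  mkP (fun i => mkP (fun j => mkP (fun k =>
    k`!%:R^-1 * iter k deriv12 (fun i j => pcoef (pcoef g i) j) i j))).

(* exp(t (d/dx1 + d/dx2)) is multiplicative, being the exponential of a
   derivation, so it acts on a fraction through any numerator and
   denominator. *)
Definition shift_t (f : {fraction Fx12}) : {fraction Ftx12} :=
  (shift_t_pser \n_(repr f))%:F / (shift_t_pser \d_(repr f))%:F.

Definition pser_embed (R : comNzRingType) (S : zmodType) (phi : R -> S)
    (f : pser R) : lser S :=
  mkL (fun n : int => phi (val f n)).

Definition iota_pser : Ftx12 -> lser (lser (lser F)) :=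
  pser_embed (pser_embed (@lser_of_pser F)).

(* iota_{t,x2,x1}, with values in F((t))((x2))((x1)) *)
Definition iota_t21 (f : {fraction Ftx12}) : lser (lser (lser F)) :=
  iota_pser \n_(repr f) / iota_pser \d_(repr f).

End Substitution.

(* The binomial coefficient n (n - 1) ... (n - k + 1) / k! for n in Z. *)
Definition binz (n : int) (k : nat) : int :=
  match n with
  | Posz m => 'C(m, k)%:Z
  | Negz m => (-1) ^+ k * 'C(m + k, k)%:Z
  end.

(* The coefficient of x^i y^j in (x + e y)^p, expanded in nonnegative powers
   of y. *)
Definition binpow (e p i j : int) : int :=
  if j is Posz k then if i + j == p then e ^+ k * binz p k else 0 else 0.

(* Formal distributions are functions of the exponents of their variables. *)
Section Distributions.
Variable V : zmodType.
Implicit Types A : int -> int -> V.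

(* multiplication by x1 - x2 *)
Definition mul_sub A (m n : int) : V := A (m - 1) n - A m (n - 1).

(* multiplication by x0 + x2 *)
Definition mul_add A (m n : int) : V := A (m - 1) n + A m (n - 1).

Definition trunc2 A : Prop :=
  exists N : int, forall m n, (m < N) || (n < N) -> A m n = 0.

(* The coefficient of x0^i x2^m in A(x0 + x2, x2) *)
Definition subst_x0_plus_x2 A (i m : int) : V :=
  \sum_(pq \in [set: int * int])
    A pq.1 pq.2 *~ binpow 1 pq.1 i (m - pq.2).

(* The coefficient of x0^j x^m in A(x + x0, x) *)
Definition subst_x_plus_x0 A (j m : int) : V :=
  \sum_(pq \in [set: int * int])
    A pq.1 pq.2 *~ binpow 1 pq.1 (m - pq.2) j.

Definition mul3 (D : int -> int -> int -> int) (A : int -> int -> int -> V)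
    (n0 n1 n2 : int) : V :=
  \sum_(m \in [set: int * int * int])
    A (n0 - m.1.1) (n1 - m.1.2) (n2 - m.2) *~ D m.1.1 m.1.2 m.2.

Variable r : nat.
Implicit Types B : ('I_r -> int) -> V.

Definition lower (i : 'I_r) (m : 'I_r -> int) : 'I_r -> int :=
  fun l => m l - (l == i)%:Z.

(* multiplication by x_i - x_j *)
Definition mul_subr (i j : 'I_r) B : ('I_r -> int) -> V :=
  fun m => B (lower i m) - B (lower j m).

(* multiplication by the product of the (x_i - x_j)^k for i < j *)
Definition mul_vandermonde (k : nat) B : ('I_r -> int) -> V :=
  foldr (fun ij : 'I_r * 'I_r => iter k (mul_subr ij.1 ij.2)) B
    [seq ij : 'I_r * 'I_r <- enum {: 'I_r * 'I_r} | (ij.1 < ij.2)%N].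

Definition truncr B : Prop :=
  exists N : int, forall m, (exists i, m i < N) -> B m = 0.

End Distributions.

(* x0^-1 delta((x1 - x2) / x0) *)
Definition delta_12_0 (n0 n1 n2 : int) : int := binpow (-1) (- n0 - 1) n1 n2.

(* x0^-1 delta((x2 - x1) / (- x0)) *)
Definition delta_21_0 (n0 n1 n2 : int) : int :=
  (-1) ^ (- n0 - 1) * binpow (-1) (- n0 - 1) n2 n1.

(* x2^-1 delta((x1 - x0) / x2) *)
Definition delta_10_2 (n0 n1 n2 : int) : int := binpow (-1) (- n2 - 1) n1 n0.

Definition lspan (R : pzRingType) (M : lmodType R) (S : set M) : set M :=
  [set v | exists (n : nat) (c : 'I_n -> R) (b : 'I_n -> M),
     (forall i, S (b i)) /\ v = \sum_(i < n) c i *: b i].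

(* a_n, for a(x) = \sum_n a_n x^(-n-1) *)
Definition mode (V : zmodType) (a : V -> lser V) (n : int) (v : V) : V :=
  a v (- n - 1).

Section CalE.
Variables (K : comNzRingType) (V : lmodType K).
Implicit Types (a b : V -> lser V) (S : set (V -> lser V)).

(* Hom_K(V, V((x))) *)
Definition calE : set (V -> lser V) :=
  [set a | forall (c : K) (u v : V), a (c *: u + v) = lconst c *: a u + a v].

(* a(x1) b(x2) w *)
Definition prod2 a b (w : V) (m n : int) : V := a (b w n) m.

(* a_1(x_1) ... a_r(x_r) w *)
Definition prodr r (a : 'I_r -> V -> lser V) (w : V) (m : 'I_r -> int) : V :=
  foldr (fun i v => a i v (m i)) w (enum 'I_r).

Definition compatible S : Prop :=
  forall (r : nat) (a : 'I_r -> V -> lser V), (forall i, S (a i)) ->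
  exists k : nat, forall w, truncr (mul_vandermonde k (prodr a w)).

Definition compatible_pair (k : nat) a b : Prop :=
  forall w, trunc2 (iter k (@mul_sub V) (prod2 a b w)).

(* a(x)_n b(x), the coefficient of x0^(-n-1) in Y_E(a(x), x0) b(x); it does
   not depend on the choice of k, and is a junk value if (a, b) is not
   compatible. *)
Definition nprod a (n : int) b : V -> lser V :=
  let k := xget 0%N [set k | compatible_pair k a b] in
  fun w => mkL (fun m : int =>
    subst_x_plus_x0 (iter k (@mul_sub V) (prod2 a b w)) (k%:Z - n - 1) m).

Definition nprod_closed S : Prop :=
  forall a b n, S a -> S b -> S (nprod a n b).

Definition calE_subspace S : Prop :=
  [/\ S `<=` calE, S 0 &
      forall (c : K) a b, S a -> S b -> S (lconst c *: a + b)].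

(* <U(x)>; 1_V is the map lconst : V -> V((x)) *)
Definition generated (U : set (V -> lser V)) : set (V -> lser V) :=
  smallest (fun S => [/\ calE_subspace S, compatible S & nprod_closed S])
    (U `|` [set @lconst V]).

(* a(x2) s, for s in V((x1)) *)
Definition lmap a (s : lser V) : lser (lser V) := mkL (fun n => a (s n)).

End CalE.

Section VertexAlgebra.
Variables (F : fieldType) (V : lmodType F).

Record nonlocal_vertex_algebra (Y : V -> V -> lser V) (vac : V) : Prop := {
  Y_linear : forall (c : F) u v, Y (c *: u + v) = lconst c *: Y u + Y v;
  Y_hom : forall u, calE (Y u);
  Y_vac : forall v, Y vac v = lconst v;
  Y_creation : forall v, (forall n, n < 0 -> Y v vac n = 0) /\ Y v vac 0 = v;
  Y_assoc : forall u v w, exists l : nat,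
    iter l (@mul_add V) (subst_x0_plus_x2 (prod2 (Y u) (Y v) w)) =
    iter l (@mul_add V) (fun i m : int => Y (Y u v i) w m) }.

End VertexAlgebra.

(* An F((t))-module regarded as a vector space over F *)
Definition restr (F : fieldType) (V : lmodType (lser F)) : Type := V.

Section Restriction.
Variables (F : fieldType) (V : lmodType (lser F)).

HB.instance Definition _ := GRing.Zmodule.on (restr V).

Definition restr_scale (c : F) (v : restr V) : restr V := lconst c *: (v : V).

Fact restr_scaleA a b v : restr_scale a (restr_scale b v) = restr_scale (a * b) v.
Proof. by rewrite /restr_scale scalerA rmorphM. Qed.
Fact restr_scale1 : left_id 1 restr_scale.
Proof. by move=> v; rewrite /restr_scale rmorph1 scale1r. Qed.
Fact restr_scaleDr : right_distributive restr_scale +%R.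
Proof. by move=> c u v; rewrite /restr_scale scalerDr. Qed.
Fact restr_scaleDl v : {morph restr_scale^~ v : a b / a + b}.
Proof. by move=> a b; rewrite /restr_scale rmorphD scalerDl. Qed.

HB.instance Definition _ := GRing.Zmodule_isLmodule.Build F (restr V)
  restr_scaleA restr_scale1 restr_scaleDr restr_scaleDl.

End Restriction.

Section VertexFtAlgebra.
Variables (F : fieldType) (V : lmodType (lser F)).

Record nonlocal_vertex_Ft_algebra (Y : V -> V -> lser V) (vac : V) : Prop := {
  Ft_nonlocal : @nonlocal_vertex_algebra F (restr V) Y vac;
  Ft_scale : forall (f g : lser F) u v,
    Y (f *: u) (g *: v) = (shift_x f * lconst g) *: Y u v }.

(* \sum_i iota_{t,x2,x1}(f_i(t + x1, t + x2)) a_i(x2) b_i(x1) w *)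
Definition opposite_sum (n : nat) (f : 'I_n -> {fraction pser (pser F)})
    (a b : 'I_n -> V -> lser V) (w : V) : lser (lser V) :=
  \sum_(i < n) iota_t21 (shift_t (f i)) *: lmap (a i) (b i w).

Record weak_quantum_vertex_Ft_algebra (Y : V -> V -> lser V) (vac : V) :
    Prop := {
  wq_nonlocal : nonlocal_vertex_Ft_algebra Y vac;
  wq_jacobi : forall u v, exists (n : nat) (u' v' : 'I_n -> V)
      (f : 'I_n -> {fraction pser (pser F)}),
    (forall i, Fstar12 (f i)) /\
    forall (w : V) (n0 n1 n2 : int),
      mul3 delta_12_0
        (fun m0 m1 m2 => if m0 == 0 then prod2 (Y u) (Y v) w m1 m2 else 0)
        n0 n1 n2
      - mul3 delta_21_0
        (fun m0 m1 m2 =>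
           if m0 == 0 then
             opposite_sum f (fun i => Y (v' i)) (fun i => Y (u' i)) w m1 m2
           else 0)
        n0 n1 n2
      = mul3 delta_10_2
        (fun m0 m1 m2 => if m1 == 0 then Y (Y u v m0) w m2 else 0)
        n0 n1 n2 }.

Definition St_local (S : set (V -> lser V)) : Prop :=
  forall a b, S a -> S b ->
  exists (n : nat) (u v : 'I_n -> V -> lser V)
      (f : 'I_n -> {fraction pser (pser F)}) (k : nat),
    [/\ forall i, S (u i), forall i, S (v i), forall i, Fstar12 (f i) &
      forall w : V,
        iter k (@mul_sub V) (prod2 a b w) =
        iter k (@mul_sub V) (fun m1 m2 => opposite_sum f u v w m1 m2)].

End VertexFtAlgebra.

(* Main.v *)
(* The proof works with the coefficient ring of the power series in
   F((t))[[x1, x2]] that expand some f(t + x1, t + x2). Since f(t + x1, t + x2)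
   has at worst a pole at x1 = x2, a locality relation multiplied by a large
   power of x1 - x2 has coefficients in this ring. The ring is stable under
   d/dx1 and d/dx2, so a Dong-type lemma holds: locality passes from U(x) to
   a(x)_n b(x). Since V is generated by U, all the psi(v) are F((t))-linear and
   pairwise S_t-local, hence pairwise compatible.

   The iterated Taylor formula gives the associativity of the products
   a(x)_n b(x), so that psi(a_n v) = psi(a)_n psi(v) for all a in V by induction
   on a. Hence Y(Y(u, x0)v, x) is Y_E(Y(u, x), x0)Y(v, x), which is weak
   associativity, and together with S_t-locality this is the Jacobi identity. *)

From HB Require Import structures.
Require Import Defs.
From mathcomp Require Import all_boot all_order all_algebra all_classical.
From mathcomp Require Import zify ring.

Set Implicit Arguments.
Unset Strict Implicit.
Unset Printing Implicit Defensive.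

Import Order.TTheory GRing.Theory Num.Theory.

Local Open Scope classical_set_scope.
Local Open Scope ring_scope.

(** The two sides of a locality relation are truncated in opposite orders of the variables. They are
    therefore compared as functions of the exponents, and x1 = x + x0 is substituted only after
    poles have been cleared. For f = g/p no other pole occurs because p(t + x1, t + x2) equals p(t,
    t) at x1 = x2 = 0: if this is nonzero it is a unit of F((t)), and otherwise x1 - x2 divides p
    and the quotient is treated in turn. Regular coefficients can be Taylor expanded at x1 = x2,
    which the n-th product of a locality relation requires. They are kept as quotients of shifted
    series by shifted polynomials, so that elements of F_* can be recovered for the Jacobi identity.
    Linearity and locality cannot be separated: a product is known to be linear once the pair is
    compatible, and compatibility is read off from locality. Hence an induction on word length that
    records which operators appear after an exchange. Characteristic 0 serves to compare Taylor
    coefficients by differentiating and dividing by j + 1. *)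

Lemma funext2 (A B C : Type) (f g : A -> B -> C) : (forall x y, f x y = g x y) -> f = g.
Proof. by move=> e; apply/funext => x; apply/funext. Qed.

Lemma funext3 (A B C D : Type) (f g : A -> B -> C -> D) :
  (forall x y z, f x y z = g x y z) -> f = g.
Proof. by move=> e; apply/funext => x; apply: funext2. Qed.

(** * Finitely supported sums over the integers *)

Notation isum f := (\sum_(i \in [set: int]) f i) (only parsing).

Section IntegerSums.
Variable M : zmodType.
Implicit Types f g : int -> M.

Definition supp_in f (a b : int) : Prop :=
  forall i, (i < a) || (b <= i) -> f i = 0.

(** [isum] takes the default value 0 on an infinite support, so additivity needs this bound. *)
Definition fin_supp f : Prop := exists a b, supp_in f a b.

Lemma isum_box f a b : supp_in f a b ->
  isum f = \sum_(i <- irange a (absz (b - a)%R)) f i.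
Proof.
move=> hf; apply: fsum_over; first exact: irange_uniq.
move=> i; apply: contraR; rewrite mem_irange => hi; apply/eqP/hf.
by move: hi; lia.
Qed.

Lemma supp_inW f a b a' b' : supp_in f a b -> a' <= a -> b <= b' -> supp_in f a' b'.
Proof. by move=> hf aa bb i hi; apply: hf; lia. Qed.

Lemma fin_supp2 f g : fin_supp f -> fin_supp g ->
  exists a b, supp_in f a b /\ supp_in g a b.
Proof.
move=> [a [b hf]] [a' [b' hg]]; exists (Num.min a a'), (Num.max b b').
by split; [apply: supp_inW hf _ _|apply: supp_inW hg _ _]; lia.
Qed.

Lemma eq_isum f g : f =1 g -> isum f = isum g.
Proof. by move=> fg; apply: eq_fsbigr => i _. Qed.

Lemma isum0 f : (forall i, f i = 0) -> isum f = 0.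
Proof. by move=> f0; apply: fsbig1. Qed.

Lemma isum1 f j : (forall i, i != j -> f i = 0) -> isum f = f j.
Proof.
move=> fj; rewrite (@fsum_over _ _ [:: j]) ?big_seq1// => i.
by rewrite inE; apply: contraNT => /fj->.
Qed.

Lemma isumD f g : fin_supp f -> fin_supp g ->
  isum (fun i => f i + g i) = isum f + isum g.
Proof.
move=> hf hg; have [a [b [fab gab]]] := fin_supp2 hf hg.
rewrite (isum_box fab) (isum_box gab) -big_split/=; apply: isum_box => i hi.
by rewrite fab// gab// addr0.
Qed.

Lemma isumB f g : fin_supp f -> fin_supp g ->
  isum (fun i => f i - g i) = isum f - isum g.
Proof.
move=> hf hg; have [a [b [fab gab]]] := fin_supp2 hf hg.
rewrite (isum_box fab) (isum_box gab) -sumrB; apply: isum_box => i hi.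
by rewrite fab// gab// subr0.
Qed.

Lemma isum_shift c f : isum (fun i => f (i + c)) = isum f.
Proof.
rewrite [RHS](reindex_fsbigT (fun i : int => i + c))//.
by exists (fun i : int => i - c) => i; rewrite ?addrK ?subrK.
Qed.

Lemma fin_supp_shift c f : fin_supp f -> fin_supp (fun i => f (i + c)).
Proof. by move=> [a [b fab]]; exists (a - c), (b - c) => i hi; apply: fab; lia. Qed.

Lemma isum_rev c f : isum (fun i => f (c - i)) = isum f.
Proof.
rewrite [RHS](reindex_fsbigT (fun i : int => c - i))//.
by exists (fun i : int => c - i) => i; lia.
Qed.

Lemma isum_exchange (F : int -> int -> M) a b c d :
  (forall i j, [|| i < a, b <= i, j < c | d <= j] -> F i j = 0) ->
  isum (fun i => isum (F i)) = isum (fun j => isum (fun i => F i j)).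
Proof.
move=> hF.
rewrite (@isum_box _ a b); last first.
  by move=> i hi; apply: isum0 => j; apply: hF; move: hi => /orP[]->; rewrite ?orbT.
rewrite [RHS](@isum_box _ c d); last first.
  by move=> j hj; apply: isum0 => i; apply: hF; move: hj => /orP[]->; rewrite ?orbT.
rewrite (eq_bigr (fun i => \sum_(j <- irange c (absz (d - c)%R)) F i j)); last first.
  by move=> i _; apply: isum_box => j hj; apply: hF; move: hj => /orP[]->; rewrite ?orbT.
rewrite exchange_big; apply: eq_bigr => j _; apply/esym/isum_box => i hi.
by apply: hF; move: hi => /orP[]->; rewrite ?orbT.
Qed.

(** The binomial kernels are supported on a line of exponents. This reduces the sums over pairs and
    triples in the substitutions and in [mul3] to one integer index. *)
Lemma fsum_inj (T : choiceType) (g : int -> T) (F : T -> M) : injective g ->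
  (forall t, F t != 0 -> exists i, t = g i) ->
  \sum_(t \in [set: T]) F t = isum (fun i => F (g i)).
Proof.
move=> ginj hg; rewrite -(reindex_fsbig g [set: int] (range g)); last first.
  by apply: inj_bij => i j _ _; apply: ginj.
apply/esym/fsbig_widen => // t [_ /= nt].
by apply/eqP; apply: contra_notT nt => /hg[i ->]; exists i.
Qed.

End IntegerSums.

Lemma isum_raddf (M N : zmodType) (h : M -> N) (f : int -> M) :
  zmod_morphism h -> fin_supp f -> h (isum f) = isum (fun i => h (f i)).
Proof.
move=> hB [a [b fab]].
pose h' : {additive M -> N} := HB.pack h (GRing.isZmodMorphism.Build M N h hB).
rewrite (isum_box fab) -[h _]/(h' _) raddf_sum; apply/esym/isum_box => i hi.
by rewrite -[h _]/(h' _) fab// raddf0.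
Qed.

(** * Coefficientwise maps of series *)

Section CoefficientMap.
Variables (M N : zmodType) (h : M -> N).
Hypothesis hB : zmod_morphism h.

Lemma zmod_morph0 : h 0 = 0.
Proof. by rewrite -(subrr 0) hB subrr. Qed.

Lemma zmod_morphD x y : h (x + y) = h x + h y.
Proof. by rewrite -[y in LHS]opprK -[- y]sub0r !hB zmod_morph0 sub0r opprK. Qed.

Lemma zmod_morphMz x (n : int) : h (x *~ n) = h x *~ n.
Proof.
pose h' : {additive M -> N} := HB.pack h (GRing.isZmodMorphism.Build M N h hB).
by rewrite -[h]/(h' : M -> N) raddfMz.
Qed.

Lemma lmap_subproof (s : lser M) :
  exists n0 : int, forall n, n < n0 -> h (s n) = 0.
Proof.
have [n0 hn0] := lser_trunc s; exists n0 => n nn0.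
by rewrite hn0// zmod_morph0.
Qed.

End CoefficientMap.

Definition lm (M N : zmodType) (h : M -> N) (s : lser M) : lser N :=
  mkL (fun n => h (s n)).

Lemma lmE (M N : zmodType) (h : M -> N) (s : lser M) n : zmod_morphism h ->
  lm h s n = h (s n).
Proof. by move=> hB; rewrite mkLE//; exact: lmap_subproof. Qed.

Lemma lm_is_zmod_morphism (M N : zmodType) (h : M -> N) :
  zmod_morphism h -> zmod_morphism (lm h).
Proof.
by move=> hB s t; apply: lserP => n; rewrite !lcoefD !lcoefN !lmE// lcoefD lcoefN hB.
Qed.

Definition coef (M : zmodType) (n : int) (s : lser M) : M := s n.

Lemma coefB (M : zmodType) n : zmod_morphism (@coef M n).
Proof. by []. Qed.

Lemma lscaleE_isum (R : comNzRingType) (M : lmodType R) (f : lser R) (v : lser M) n :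
  (f *: v) n = isum (fun i => f i *: v (n - i)).
Proof. exact: lscaleE. Qed.

Lemma lscale_fin_supp (R : comNzRingType) (M : lmodType R) (f : lser R)
  (v : lser M) n : fin_supp (fun i => f i *: v (n - i)).
Proof.
have [a ha] := lser_trunc f; have [b hb] := lser_trunc v.
exists a, (n - b + 1) => i /orP[ia|ib]; first by rewrite ha// scale0r.
by rewrite hb ?scaler0//; lia.
Qed.

Lemma lm_scale (R S : comNzRingType) (M : lmodType R) (N : lmodType S)
  (A : {pred R}) (T : M -> Prop) (th : R -> S) (h : M -> N) (f : lser R) (s : lser M) :
  zmod_morphism th -> zmod_morphism h ->
  (forall n, f n \in A) -> (forall n, T (s n)) ->
  (forall r x, r \in A -> T x -> h (r *: x) = th r *: h x) ->
  lm h (f *: s) = lm th f *: lm h s.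
Proof.
move=> thB hB fA sT hs; apply: lserP => n.
rewrite lmE// !lscaleE_isum (isum_raddf hB); last exact: lscale_fin_supp.
by apply: eq_isum => i; rewrite !lmE// hs.
Qed.

Lemma lm_scaleT (R S : comNzRingType) (M : lmodType R) (N : lmodType S)
  (th : R -> S) (h : M -> N) (f : lser R) (s : lser M) :
  zmod_morphism th -> zmod_morphism h ->
  (forall r x, h (r *: x) = th r *: h x) ->
  lm h (f *: s) = lm th f *: lm h s.
Proof.
move=> thB hB hs.
by apply: (@lm_scale R S M N predT (fun=> True)) => // r x _ _; apply: hs.
Qed.

Section Monomials.
Variable R : comNzRingType.

(** With x1 outermost, x1 is [lX (lser K)] and x2 is [lconst (lX K)]. *)
Definition lX : lser R := mkL (fun n : int => (n == 1)%:R).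

Lemma lXE n : lX n = (n == 1)%:R.
Proof. by rewrite mkLE//; exists 0 => m m0; case: eqP => // m1; move: m0; rewrite m1. Qed.

Lemma lX_scale (M : lmodType R) (s : lser M) n : (lX *: s) n = s (n - 1).
Proof.
rewrite lscaleE_isum (@isum1 _ _ 1).
  by rewrite lXE eqxx scale1r.
by move=> i i1; rewrite lXE (negPf i1) scale0r.
Qed.

Lemma lconst_scale (M : lmodType R) c (s : lser M) n : (lconst c *: s) n = c *: s n.
Proof.
rewrite lscaleE_isum (@isum1 _ _ 0).
  by rewrite lconstE eqxx subr0.
by move=> i i1; rewrite lconstE (negPf i1) scale0r.
Qed.

End Monomials.

Lemma lconstB (M : zmodType) : zmod_morphism (@lconst M).
Proof. exact: lconst_is_zmod_morphism. Qed.

(** * Formal derivatives of series *)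

Section Derivative.

Definition lD (M : zmodType) (s : lser M) : lser M :=
  mkL (fun n : int => s (n + 1) *~ (n + 1)).

Lemma lDE (M : zmodType) (s : lser M) n : lD s n = s (n + 1) *~ (n + 1).
Proof.
rewrite mkLE//; have [a ha] := lser_trunc s; exists (a - 1) => m ma.
by rewrite ha ?mul0rz//; lia.
Qed.

Lemma lDB (M : zmodType) : zmod_morphism (@lD M).
Proof.
by move=> s t; apply: lserP => n; rewrite lcoefD lcoefN !lDE lcoefD lcoefN mulrzBl.
Qed.

Lemma lD_scale (R : comNzRingType) (M : lmodType R) (f : lser R) (v : lser M) :
  lD (f *: v) = lD f *: v + f *: lD v.
Proof.
apply: lserP => n; rewrite lcoefD lDE !lscaleE_isum.
rewrite -[X in _ = X + _](isum_shift (-1)).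
rewrite -isumD; [|exact: (fin_supp_shift (-1) (lscale_fin_supp (lD f) v n))|exact: lscale_fin_supp].
rewrite (isum_raddf (h := fun x => x *~ (n + 1))); last exact: lscale_fin_supp.
  apply: eq_isum => i /=; rewrite !lDE addrNK (_ : n - (i - 1) = n + 1 - i); last by lia.
  rewrite (_ : n - i + 1 = n + 1 - i); last by lia.
  rewrite -scalerMzl -scalerMzr -mulrzDr; congr (_ *~ _); lia.
by move=> x y; rewrite mulrzBl.
Qed.

Lemma lm_deriv (R : comNzRingType) (M : lmodType R) (d : R -> R) (e : M -> M)
    (f : lser R) (v : lser M) :
  zmod_morphism d -> zmod_morphism e ->
  (forall r x, e (r *: x) = d r *: x + r *: e x) ->
  lm e (f *: v) = lm d f *: v + f *: lm e v.
Proof.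
move=> dB eB der; apply: lserP => n; rewrite lcoefD lmE//.
rewrite !lscaleE_isum (isum_raddf eB); last exact: lscale_fin_supp.
rewrite -isumD; [|exact: lscale_fin_supp|exact: lscale_fin_supp].
by apply: eq_isum => i; rewrite der !lmE.
Qed.

End Derivative.

(** * Binomial coefficients with an integer upper argument *)

Definition bz (p j : int) : int := if j is Posz k then binz p k else 0.

Lemma binz0 p : binz p 0 = 1.
Proof. by case: p => m /=; rewrite ?bin0// addn0 bin0 mulr1. Qed.

Lemma binz_pascal p k : binz (p + 1) k.+1 = binz p k.+1 + binz p k.
Proof.
case: p => [m|[|m]].
- by rewrite -PoszD addn1 /= binS PoszD.
- rewrite (_ : Negz 0 + 1 = 0)// (_ : binz 0 _ = 0)// /binz !add0n !binn exprS.
  by rewrite !mulN1r !mulr1 addNr.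
- rewrite (_ : Negz m.+1 + 1 = Negz m); last by lia.
  rewrite /binz exprS mulN1r [in X in _ = X + _]addSn binS PoszD addSnnS.
  by rewrite mulrDr [in RHS]mulNr [X in _ = _ + X + _]mulNr addrNK mulNr.
Qed.

Lemma bz0 p : bz p 0 = 1. Proof. exact: binz0. Qed.

Lemma bz_neg p j : j < 0 -> bz p j = 0. Proof. by case: j. Qed.

Lemma bz_pascal p j : bz (p + 1) j = bz p j + bz p (j - 1).
Proof.
case: j => [[|k]|k]; first by rewrite !bz0 bz_neg ?addr0.
  by rewrite /bz (_ : k.+1%:Z - 1 = k%:Z) ?binz_pascal//; lia.
by rewrite !bz_neg ?addr0//; lia.
Qed.

Lemma bz_small p j : 0 <= p -> p < j -> bz p j = 0.
Proof. by case: p j => // p [] //= k _; rewrite ltz_nat => pk; rewrite bin_small. Qed.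

Lemma binz_step p k : binz p k.+1 * k.+1%:Z = binz p k * (p - k%:Z).
Proof.
case: p => m /=.
  have [mk|km] := ltnP m k; first by rewrite !bin_small ?mul0r// ltnS ltnW.
  rewrite subzn// -!PoszM; congr Posz.
  by rewrite mulnC mul_bin_left mulnC.
rewrite exprS -!mulrA mulN1r -mulrN; congr (_ * _).
have -> : Negz m - k%:Z = - (m + k).+1%:Z by lia.
rewrite mulrN; congr (- _); rewrite -!PoszM; congr Posz.
by rewrite mulnC addnS -mul_bin_diag mulnC.
Qed.

Lemma bz_step p j : bz p (j + 1) * (j + 1) = bz p j * (p - j).
Proof.
case: j => [k|[|k]]; first by rewrite -PoszD addn1 /= binz_step.
  by rewrite (@bz_neg p (Negz 0))// mul0r mulr0.
by rewrite !bz_neg ?mul0r//; lia.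
Qed.

Lemma bz_absorb p j : bz p (j + 1) * (j + 1) = bz (p - 1) j * p.
Proof.
have := bz_pascal (p - 1) (j + 1); rewrite subrK addrK => ->.
by rewrite mulrDl bz_step; ring.
Qed.

(** * Distributions in two variables *)

Section TwoVariables.
Variable M : zmodType.
Implicit Types A B : int -> int -> M.

Definition sX A (m n : int) : M := A (m - 1) n.
Definition sY A (m n : int) : M := A m (n - 1).
Definition dx A (m n : int) : M := A (m + 1) n *~ (m + 1).
Definition dy A (m n : int) : M := A m (n + 1) *~ (n + 1).
Definition add2 A B (m n : int) : M := A m n + B m n.
Definition opp2 A (m n : int) : M := - A m n.

Lemma trunc2D A B : trunc2 A -> trunc2 B -> trunc2 (add2 A B).
Proof.
move=> [a ha] [b hb]; exists (Num.min a b) => m n mn.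
by rewrite /add2 ha ?hb ?addr0//; lia.
Qed.

Lemma trunc2N A : trunc2 A -> trunc2 (opp2 A).
Proof. by move=> [a ha]; exists a => m n mn; rewrite /opp2 ha ?oppr0. Qed.

Lemma trunc2X A : trunc2 A -> trunc2 (sX A).
Proof. by move=> [a ha]; exists a => m n mn; rewrite /sX ha//; lia. Qed.

Lemma trunc2Y A : trunc2 A -> trunc2 (sY A).
Proof. by move=> [a ha]; exists a => m n mn; rewrite /sY ha//; lia. Qed.

Lemma trunc2dx A : trunc2 A -> trunc2 (dx A).
Proof. by move=> [a ha]; exists (a - 1) => m n mn; rewrite /dx ha ?mul0rz//; lia. Qed.

Lemma trunc2dy A : trunc2 A -> trunc2 (dy A).
Proof. by move=> [a ha]; exists (a - 1) => m n mn; rewrite /dy ha ?mul0rz//; lia. Qed.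

Lemma mul_subE A : mul_sub A = add2 (sX A) (opp2 (sY A)).
Proof. by []. Qed.

Lemma trunc2_mul_sub A : trunc2 A -> trunc2 (mul_sub A).
Proof. by move=> hA; apply/trunc2D/trunc2N/trunc2Y/hA/trunc2X. Qed.

Lemma trunc2_iter_sub k A : trunc2 A -> trunc2 (iter k (@mul_sub M) A).
Proof. by move=> hA; elim: k => //= k; exact: trunc2_mul_sub. Qed.

Definition sb A (j m : int) : M := subst_x_plus_x0 A j m.

Lemma sbE A j m : sb A j m = isum (fun p => A p (m + j - p) *~ bz p j).
Proof.
rewrite /sb /subst_x_plus_x0 (@fsum_inj _ _ (fun p => (p, m + j - p)))/=.
- apply: eq_isum => p; congr (_ *~ _); rewrite /binpow /bz.
  case: j => // k; rewrite expr1n mul1r ifT//; apply/eqP; lia.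
- by move=> p q [].
- move=> [p q] /=; rewrite /binpow; case: j => [k|k]; last by rewrite mulr0z eqxx.
  case: (m - q + k%:Z =P p) => [e _|_]; last by rewrite mulr0z eqxx.
  by exists p; congr pair; lia.
Qed.

Lemma sb_fin_supp A j m : trunc2 A -> fin_supp (fun p => A p (m + j - p) *~ bz p j).
Proof.
move=> [a ha]; exists a, (m + j - a + 1) => p hp.
by rewrite ha ?mul0rz//; lia.
Qed.

Lemma sb_neg A j m : j < 0 -> sb A j m = 0.
Proof. by move=> j0; rewrite sbE isum0// => p; rewrite bz_neg. Qed.

Lemma sb_trunc A j : trunc2 A -> exists N, forall m, m < N -> sb A j m = 0.
Proof.
move=> [a ha]; exists (a + a - j) => m hm; rewrite sbE isum0// => p.
by rewrite ha ?mul0rz//; lia.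
Qed.

Lemma sbD A B j m : trunc2 A -> trunc2 B -> sb (add2 A B) j m = sb A j m + sb B j m.
Proof.
move=> hA hB; rewrite !sbE -isumD; [|exact: sb_fin_supp|exact: sb_fin_supp].
by apply: eq_isum => p; rewrite mulrzDl.
Qed.

Lemma sbN A j m : trunc2 A -> sb (opp2 A) j m = - sb A j m.
Proof.
move=> hA; rewrite !sbE (isum_raddf (h := -%R)); last exact: sb_fin_supp.
  by apply: eq_isum => p; rewrite mulNrz.
by move=> x y; rewrite opprB opprK addrC.
Qed.

Lemma sb_X A j m : trunc2 A -> sb (sX A) j m = sb A j (m - 1) + sb A (j - 1) m.
Proof.
move=> hA; rewrite !sbE -isumD; [|exact: sb_fin_supp|exact: sb_fin_supp].
rewrite -[LHS](isum_shift 1); apply: eq_isum => p.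
rewrite /sX /= addrK bz_pascal mulrzDr.
by congr (A _ _ *~ _ + A _ _ *~ _); lia.
Qed.

Lemma sb_Y A j m : sb (sY A) j m = sb A j (m - 1).
Proof. by rewrite !sbE; apply: eq_isum => p; rewrite /sY; congr (A _ _ *~ _); lia. Qed.

(** The factor x1 - x2 becomes (x + x0) - x = x0, so clearing a pole at x1 = x2 only shifts the
    exponent of x0. *)
Lemma sb_mul_sub A j m : trunc2 A -> sb (mul_sub A) j m = sb A (j - 1) m.
Proof.
move=> hA; rewrite mul_subE sbD; [|exact: trunc2X|exact/trunc2N/trunc2Y].
by rewrite sbN ?sb_X ?sb_Y ?[sb A j _ + _]addrC ?addrK//; apply: trunc2Y.
Qed.

Lemma isumMz (f : int -> M) (n : int) : fin_supp f ->
  isum f *~ n = isum (fun i => f i *~ n).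
Proof. by apply: (isum_raddf (h := fun x : M => x *~ n)) => x y; rewrite mulrzBl. Qed.

Lemma sb_dx A j m : trunc2 A -> sb (dx A) j m = sb A (j + 1) m *~ (j + 1).
Proof.
move=> hA; rewrite !sbE isumMz; last exact: sb_fin_supp.
rewrite -[LHS](isum_shift (-1)); apply: eq_isum => p.
rewrite /dx -!mulrzA bz_absorb subrK mulrC.
by congr (A _ _ *~ _); lia.
Qed.

(** Chain rule: d/dx acts on A(x + x0, x) through both arguments, and through the first one it
    agrees with d/dx0. *)
Lemma sb_deriv A j m : trunc2 A ->
  sb A j (m + 1) *~ (m + 1) = sb (dy A) j m + sb A (j + 1) m *~ (j + 1).
Proof.
move=> hA; rewrite !sbE !isumMz; [|exact: sb_fin_supp|exact: sb_fin_supp].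
rewrite -isumD; first last.
- have [a [b h]] := sb_fin_supp (j + 1) m hA; exists a, b => i hi.
  by rewrite h// mul0rz.
- exact/sb_fin_supp/trunc2dy.
apply: eq_isum => p; rewrite /dy -!mulrzA bz_step.
rewrite (_ : m + (j + 1) - p = m + 1 + j - p); last by lia.
rewrite (_ : m + j - p + 1 = m + 1 + j - p); last by lia.
by rewrite -mulrzDr; congr (_ *~ _); ring.
Qed.

End TwoVariables.

(** * The iterated Taylor formula *)

Definition torsion_free (M : zmodType) : Prop :=
  forall (x : M) (n : nat), x *+ n.+1 = 0 -> x = 0.

Lemma tf_mulrz (M : zmodType) (x y : M) (n : nat) : torsion_free M ->
  x *~ (n%:Z + 1) = y *~ (n%:Z + 1) -> x = y.
Proof.
move=> tf /eqP; rewrite -subr_eq0 -mulrzBl -PoszD addn1 => /eqP /tf /eqP.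
by rewrite subr_eq0 => /eqP.
Qed.

Section Taylor.
Variable M : zmodType.
Hypothesis tf : torsion_free M.
Implicit Types P : int -> int -> int -> M.

Definition trunc3 P : Prop :=
  exists N : int, forall p q r, [|| p < N, q < N | r < N] -> P p q r = 0.

Definition sb23 P (b : int) (p r : int) : M := sb (P p) b r.
Definition sb12 P (i : int) (q r : int) : M := sb (fun p q' => P p q' r) i q.

Lemma trunc3_fix1 P p : trunc3 P -> trunc2 (P p).
Proof. by move=> [N hN]; exists N => q r h; apply: hN; rewrite h orbT. Qed.

Lemma trunc3_fix3 P r : trunc3 P -> trunc2 (fun p q => P p q r).
Proof. by move=> [N hN]; exists N => p q h; apply: hN; rewrite orbA h. Qed.

Lemma trunc2_sb23 P b : trunc3 P -> trunc2 (sb23 P b).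
Proof.
move=> [N hN]; exists (Num.min N (N + N - b)) => p r pr; rewrite /sb23 sbE isum0// => q.
by rewrite hN ?mul0rz//; lia.
Qed.

Lemma trunc2_sb12 P i : trunc3 P -> trunc2 (sb12 P i).
Proof.
move=> [N hN]; exists (Num.min N (N + N - i)) => q r qr; rewrite /sb12 sbE isum0// => p.
by rewrite hN ?mul0rz//; lia.
Qed.

Lemma trunc2_sbsb P m : trunc2 (fun a b => sb (sb23 P b) a m).
Proof.
exists 0 => a b /orP[a0|b0]; first by rewrite sb_neg.
rewrite sbE isum0// => p.
by rewrite /sb23 [sb (P p) _ _]sb_neg ?mul0rz.
Qed.

(* Substituting first x1 = x2 + y, then x2 = x3 + z, amounts to substituting
   x1 = x3 + (z + y) and x2 = x3 + z. *)
Lemma taylor P i j m : trunc3 P ->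
  sb (fun a b => sb (sb23 P b) a m) i j = sb (sb12 P i) j m.
Proof.
case: i => [i|i]; last first.
  move=> _; rewrite sb_neg// [RHS]sbE isum0// => q.
  by rewrite /sb12 [sb (fun _ _ => _) _ _]sb_neg ?mul0rz.
case: j => [j|j]; last first.
  move=> _; rewrite [RHS]sb_neg// sbE isum0// => p.
  have [p0|p0] := ltP p 0; first by rewrite sb_neg ?mul0rz.
  have [pi|pi] := ltP p i%:Z; first by rewrite bz_small ?mulr0z.
  rewrite sbE isum0 ?mul0rz// => q.
  by rewrite /sb23 [sb (P q) _ _]sb_neg ?mul0rz//; lia.
(* For j = 0 both sides are a coefficient of P(x3 + y, x3, x3). The derivative in z used for the
   next j brings in dP/dx2 and the index i + 1, so i and P are generalized. *)
elim: j i P => [|j IH] i P hP.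
  rewrite sbE (@isum1 _ _ i%:Z); last first.
    move=> p pi; have [p0|p0] := ltP p 0; first by rewrite sb_neg ?mul0rz.
    have [ip|ip] := ltP p i%:Z; first by rewrite bz_small ?mulr0z.
    rewrite sbE isum0 ?mul0rz// => q.
    rewrite /sb23 [sb (P q) _ _]sb_neg ?mul0rz//.
    by move: pi ip; rewrite neq_lt; lia.
  have -> : bz i%:Z i%:Z = 1 by rewrite /bz /= binn.
  rewrite mulr1z add0r subrr !sbE.
  have [N hN] := hP.
  transitivity (isum (fun p => isum (fun q => P p q (m + i%:Z - p - q) *~ bz p i%:Z))).
    apply: eq_isum => p; rewrite /sb23 sbE isumMz; last exact/sb_fin_supp/trunc3_fix1.
    by apply: eq_isum => q; rewrite bz0 mulr1z; congr (P _ _ _ *~ _); lia.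
  transitivity (isum (fun p => isum (fun q =>
      P p (q + i%:Z - p) (m - q) *~ bz p i%:Z))).
    apply: eq_isum => p; rewrite -[LHS](isum_shift (i%:Z - p)).
    by apply: eq_isum => q; congr (P _ _ _ *~ _); lia.
  rewrite (@isum_exchange _ _ N (m + i%:Z - N - N + 1) (N + N - i%:Z) (m - N + 1)).
    apply: eq_isum => q; rewrite bz0 mulr1z /sb12 sbE.
    by apply: eq_isum => p; congr (P _ _ _ *~ _); lia.
  by move=> p q pq; rewrite hN ?mul0rz//; lia.
pose P2 p := dx (P p).
have hP2 : trunc3 P2.
  have [N hN] := hP; exists (N - 1) => p q r pqr.
  by rewrite /P2 /dx hN ?mul0rz//; lia.
(* The coefficient of z^(j+1) is recovered from that of z^j in the derivative, at the cost of
   dividing by j + 1. *)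
apply: (tf_mulrz (n := j) tf).
rewrite -[j.+1]addn1 PoszD sb_deriv; last exact: trunc2_sbsb.
rewrite -[RHS]sb_dx; last exact: trunc2_sb12.
have -> : dy (fun a b => sb (sb23 P b) a m) = fun a b => sb (sb23 P2 b) a m.
  apply: funext2 => a b; rewrite /dy !sbE isumMz; last first.
    exact/sb_fin_supp/trunc2_sb23.
  apply: eq_isum => p; rewrite /sb23 sb_dx; last exact: trunc3_fix1.
  by rewrite -!mulrzA mulrC.
have -> : dx (sb12 P i%:Z) =
    add2 (sb12 P2 i%:Z) (fun q r => sb12 P (i%:Z + 1) q r *~ (i%:Z + 1)).
  apply: funext2 => q r; rewrite /dx /sb12 sb_deriv//.
  exact: trunc3_fix3.
rewrite IH// -[i%:Z + 1]PoszD addn1 IH// sbD; first last.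
- have [N hN] := @trunc2_sb12 P i.+1 hP; exists N => q r qr.
  by rewrite hN// mul0rz.
- exact: trunc2_sb12.
congr (_ + _); rewrite !sbE isumMz; last exact/sb_fin_supp/trunc2_sb12.
by apply: eq_isum => q; rewrite -!mulrzA mulrC.
Qed.

End Taylor.

(** * The Taylor substitution on distributions with a pole at x1 = x2 *)

Section Localized.
Variable M : zmodType.
Implicit Types (R : int -> int -> M).

Definition local2 (k : nat) R : Prop := trunc2 (iter k (@mul_sub M) R).

(** R(x + x0, x) for R with a pole at x1 = x2: the series (x1 - x2)^k R is expanded and divided by
    x0^k, whence the index k + i. A nonlocal R gets the default k = 0. *)
Definition Sub R (i m : int) : M :=
  let k := xget 0%N [set k | local2 k R] in
  sb (iter k (@mul_sub M) R) (k%:Z + i) m.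

Lemma iter_mul_subD k R R' :
  iter k (@mul_sub M) (add2 R R') = add2 (iter k (@mul_sub M) R) (iter k (@mul_sub M) R').
Proof.
elim: k => //= k ->; apply: funext2 => m n.
by rewrite /mul_sub /add2 opprD addrACA.
Qed.

Lemma iter_mul_subN k R :
  iter k (@mul_sub M) (opp2 R) = opp2 (iter k (@mul_sub M) R).
Proof.
elim: k => //= k ->; apply: funext2 => m n.
by rewrite /mul_sub /opp2 opprB opprK addrC.
Qed.

Lemma local2W k k' R : (k <= k')%N -> local2 k R -> local2 k' R.
Proof. by move=> /subnK <- h; rewrite /local2 iterD; exact: trunc2_iter_sub. Qed.

Lemma local2D k R R' : local2 k R -> local2 k R' -> local2 k (add2 R R').
Proof. by rewrite /local2 iter_mul_subD; exact: trunc2D. Qed.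

Lemma local2N k R : local2 k R -> local2 k (opp2 R).
Proof. by rewrite /local2 iter_mul_subN; exact: trunc2N. Qed.

Lemma local2_sub k R : local2 k R -> local2 k (mul_sub R).
Proof. by rewrite /local2 -iterSr iterS; exact: trunc2_mul_sub. Qed.

Lemma sb_iter_sub k R i m : trunc2 R ->
  sb (iter k (@mul_sub M) R) (k%:Z + i) m = sb R i m.
Proof.
move=> hR; elim: k => [|k IH]; first by rewrite add0r.
rewrite iterS sb_mul_sub; last exact: trunc2_iter_sub.
by rewrite -IH; congr (sb _ _ _); lia.
Qed.

(** One more factor x1 - x2 is one more factor x0, so the choice of k is immaterial. *)
Lemma SubE k R i m : local2 k R -> Sub R i m = sb (iter k (@mul_sub M) R) (k%:Z + i) m.
Proof.
move=> hk; rewrite /Sub; case: xgetP => [k' _ /= hk'|h]; last by case: (h k).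
have aux a b : (a <= b)%N -> local2 a R ->
    sb (iter a (@mul_sub M) R) (a%:Z + i) m = sb (iter b (@mul_sub M) R) (b%:Z + i) m.
  by move=> /subnK <- ha; rewrite iterD PoszD -addrA [RHS]sb_iter_sub.
by case: (leqP k' k) => [|/ltnW] le; [apply: aux|apply/esym/aux].
Qed.

Lemma SubD k R R' i m : local2 k R -> local2 k R' ->
  Sub (add2 R R') i m = Sub R i m + Sub R' i m.
Proof.
move=> h h'; rewrite (SubE _ _ (local2D h h')) (SubE _ _ h) (SubE _ _ h').
by rewrite iter_mul_subD sbD.
Qed.

Lemma SubN k R i m : local2 k R -> Sub (opp2 R) i m = - Sub R i m.
Proof.
move=> h; rewrite (SubE _ _ (local2N h)) (SubE _ _ h).
by rewrite iter_mul_subN sbN.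
Qed.

Lemma Sub_sub k R i m : local2 k R -> Sub (mul_sub R) i m = Sub R (i - 1) m.
Proof.
move=> h; rewrite (SubE _ _ (local2_sub h)) (SubE _ _ h).
rewrite -iterSr iterS sb_mul_sub//; congr (sb _ _ _); lia.
Qed.

End Localized.

(** * Associativity of the products a(x)_n b(x) *)

Section ThreeVariables.
Variable M : zmodType.
Implicit Types (A : int -> int -> M) (P : int -> int -> int -> M).

Definition s12 P (p q r : int) : M := P (p - 1) q r - P p (q - 1) r.
Definition s13 P (p q r : int) : M := P (p - 1) q r - P p q (r - 1).
Definition s23 P (p q r : int) : M := P p (q - 1) r - P p q (r - 1).

Lemma iter_comm (T : Type) (f g : T -> T) (m n : nat) x :
  (forall x, f (g x) = g (f x)) -> iter m f (iter n g x) = iter n g (iter m f x).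
Proof.
move=> fg; elim: n x => //= n IH x; rewrite -IH.
by elim: m {IH} => //= m ->.
Qed.

Lemma s12_s13 P : s12 (s13 P) = s13 (s12 P).
Proof.
apply: funext3 => p q r.
by rewrite /s12 /s13 !opprB addrACA [RHS]addrACA; congr (_ + _); rewrite addrC.
Qed.

Lemma s12_s23 P : s12 (s23 P) = s23 (s12 P).
Proof.
apply: funext3 => p q r.
by rewrite /s12 /s23 !opprB addrACA [RHS]addrACA; congr (_ + _); rewrite addrC.
Qed.

Lemma s13_s23 P : s13 (s23 P) = s23 (s13 P).
Proof.
apply: funext3 => p q r.
by rewrite /s13 /s23 !opprB addrACA [RHS]addrACA; congr (_ + _); rewrite addrC.
Qed.

Lemma iter_s12 k P p q r :
  iter k s12 P p q r = iter k (@mul_sub M) (fun p q => P p q r) p q.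
Proof. by elim: k p q => //= k IH p q; rewrite /s12 /mul_sub !IH. Qed.

Lemma iter_s23 k P p q r : iter k s23 P p q r = iter k (@mul_sub M) (P p) q r.
Proof. by elim: k q r => //= k IH q r; rewrite /s23 /mul_sub !IH. Qed.

Lemma iter_mul_sub_morph (N : zmodType) (h : N -> M) k (A : int -> int -> N) m n :
  zmod_morphism h ->
  iter k (@mul_sub M) (fun m n => h (A m n)) m n = h (iter k (@mul_sub N) A m n).
Proof. by move=> hB; elim: k m n => //= k IH m n; rewrite /mul_sub hB !IH. Qed.

Lemma trunc2_s12 P : (forall p, trunc2 (P p)) -> forall p, trunc2 (s12 P p).
Proof.
by move=> hP p; apply: trunc2D (hP (p - 1)) _; apply/trunc2N/trunc2X/hP.
Qed.

Lemma trunc2_s13 P : (forall p, trunc2 (P p)) -> forall p, trunc2 (s13 P p).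
Proof.
by move=> hP p; apply: trunc2D (hP (p - 1)) _; apply/trunc2N/trunc2Y/hP.
Qed.

Lemma trunc2_iter_s12 k P : (forall p, trunc2 (P p)) -> forall p, trunc2 (iter k s12 P p).
Proof. by move=> hP; elim: k => //= k IH; exact: trunc2_s12. Qed.

Lemma trunc2_iter_s13 k P : (forall p, trunc2 (P p)) -> forall p, trunc2 (iter k s13 P p).
Proof. by move=> hP; elim: k => //= k IH; exact: trunc2_s13. Qed.

(** For x2 = x3 + y one has x1 - x2 = (x1 - x3) - y, and y shifts the index j. *)
Lemma sb23_s12 P j : (forall p, trunc2 (P p)) ->
  sb23 (s12 P) j = add2 (mul_sub (sb23 P j)) (opp2 (sb23 P (j - 1))).
Proof.
move=> hP; apply: funext2 => p m.
rewrite /sb23 /add2 /opp2 /mul_sub.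
rewrite -[s12 P p]/(add2 (P (p - 1)) (opp2 (sX (P p)))).
rewrite sbD ?sbN ?sb_X ?opprD ?addrA//; [exact: trunc2X|exact/trunc2N/trunc2X].
Qed.

Lemma sb23_s13 P j : (forall p, trunc2 (P p)) -> sb23 (s13 P) j = mul_sub (sb23 P j).
Proof.
move=> hP; apply: funext2 => p m.
rewrite /sb23 /mul_sub -[s13 P p]/(add2 (P (p - 1)) (opp2 (sY (P p)))).
rewrite sbD ?sbN ?sb_Y//; [exact: trunc2Y|exact/trunc2N/trunc2Y].
Qed.

Lemma sb23_iter_s13 k P j : (forall p, trunc2 (P p)) ->
  sb23 (iter k s13 P) j = iter k (@mul_sub M) (sb23 P j).
Proof.
move=> hP; elim: k => //= k IH; rewrite sb23_s13 ?IH//.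
exact: trunc2_iter_s13.
Qed.

Lemma trunc2_s13' P : (forall r, trunc2 (fun p q => P p q r)) ->
  forall r, trunc2 (fun p q => s13 P p q r).
Proof.
move=> hP r; apply: (@trunc2D M (sX (fun p q => P p q r))); first exact: trunc2X.
by apply: (@trunc2N M (fun p q => P p q (r - 1))).
Qed.

Lemma trunc2_iter_s13' k P : (forall r, trunc2 (fun p q => P p q r)) ->
  forall r, trunc2 (fun p q => iter k s13 P p q r).
Proof. by move=> hP; elim: k => //= k IH; exact: trunc2_s13'. Qed.

Lemma trunc2_s23' P : (forall r, trunc2 (fun p q => P p q r)) ->
  forall r, trunc2 (fun p q => s23 P p q r).
Proof.
move=> hP r; apply: (@trunc2D M (sY (fun p q => P p q r))); first exact: trunc2Y.
by apply: (@trunc2N M (fun p q => P p q (r - 1))).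
Qed.

Lemma trunc2_iter_s23' k P : (forall r, trunc2 (fun p q => P p q r)) ->
  forall r, trunc2 (fun p q => iter k s23 P p q r).
Proof. by move=> hP; elim: k => //= k IH; exact: trunc2_s23'. Qed.

(** For x1 = x2 + y one has x1 - x3 = (x2 - x3) + y; the sign of y is opposite to that in
    [sb23_s12]. *)
Lemma sb12_s13 P i : (forall r, trunc2 (fun p q => P p q r)) ->
  sb12 (s13 P) i = add2 (mul_sub (sb12 P i)) (sb12 P (i - 1)).
Proof.
move=> hP; apply: funext2 => q r.
set A := fun p q => P p q r; set B := fun p q => P p q (r - 1).
have hA : trunc2 A := hP r; have hB : trunc2 B := hP (r - 1).
transitivity (sb A i (q - 1) + sb A (i - 1) q - sb B i q); last by rewrite addrAC.
by rewrite -(sb_X _ _ hA) -(sbN _ _ hB) -sbD//; [exact: trunc2X|exact: trunc2N].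
Qed.

Lemma sb12_s23 P i : (forall r, trunc2 (fun p q => P p q r)) ->
  sb12 (s23 P) i = mul_sub (sb12 P i).
Proof.
move=> hP; apply: funext2 => q r.
set A := fun p q => P p q r; set B := fun p q => P p q (r - 1).
have hA : trunc2 A := hP r; have hB : trunc2 B := hP (r - 1).
transitivity (sb A i (q - 1) - sb B i q); last by [].
by rewrite -sb_Y -(sbN _ _ hB) -sbD//; [exact: trunc2Y|exact: trunc2N].
Qed.

Lemma sb12_iter_s23 k P i : (forall r, trunc2 (fun p q => P p q r)) ->
  sb12 (iter k s23 P) i = iter k (@mul_sub M) (sb12 P i).
Proof.
move=> hP; elim: k => //= k IH; rewrite sb12_s23 ?IH//.
exact: trunc2_iter_s23'.
Qed.

(** The monomial (x1 x2)^k becomes (x + x0)^k x^k. *)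
Lemma sb_shift k A i j : trunc2 A ->
  sb (fun a b => A (a - k%:Z) (b - k%:Z)) i j = iter k (@mul_add M) (sb A) i (j - k%:Z).
Proof.
move=> hA; elim: k i j => [|k IH] i j.
  by rewrite /= !sbE; apply: eq_isum => p; rewrite !subr0.
have hB : trunc2 (fun a b => A (a - k%:Z) (b - k%:Z)).
  by case: hA => N hN; exists (N + k%:Z) => a b ab; apply: hN; lia.
rewrite -[LHS]/(sb (fun a b => A (a - k.+1%:Z) (b - k.+1%:Z)) i j).
rewrite (_ : (fun a b => _) = sX (sY (fun a b => A (a - k%:Z) (b - k%:Z)))).
  rewrite sb_X ?sb_Y; last exact: trunc2Y.
  rewrite !IH [LHS]addrC (_ : j - 1 - k%:Z = j - k.+1%:Z); last by lia.
  by rewrite (_ : j - 1 - 1 - k%:Z = j - k.+1%:Z - 1)//; lia.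
by apply: funext2 => a b; rewrite /sX /sY; congr (A _ _); lia.
Qed.

(** The coefficients of the lowest power of x0 are determined first, then the next ones in turn. The
    lower bound in x0 matters: x0 + x2 kills a delta distribution. *)
Lemma mul_add_inj k A B (N : int) :
  (forall i j, i < N -> A i j = 0) -> (forall i j, i < N -> B i j = 0) ->
  iter k (@mul_add M) A = iter k (@mul_add M) B -> A = B.
Proof.
elim: k A B => //= k IH A B hA hB.
have low C : (forall i j, i < N -> C i j = 0) ->
    forall i j, i < N -> iter k (@mul_add M) C i j = 0.
  move=> hC; elim: k {IH} => //= k IHk i j iN.
  by rewrite /mul_add !IHk ?addr0//; lia.
move=> e; apply: IH => //; apply: funext2 => i j.
have [iN|iN] := ltP i N; first by rewrite !low.
rewrite -(subrK N i); have -> : i - N = (absz (i - N)%R)%:Z by lia.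
elim: (absz _) j => [|n IHn] j.
  have := congr1 (fun f => f N (j + 1)) e; rewrite /mul_add addrK.
  by rewrite !(low _ _ (N - 1))// ?add0r//; lia.
have := congr1 (fun f => f (n.+1%:Z + N) (j + 1)) e; rewrite /mul_add addrK.
rewrite (_ : n.+1%:Z + N - 1 = n%:Z + N); last by lia.
by rewrite IHn => /addrI.
Qed.

End ThreeVariables.

Section ProductCoefficients.
Variables (K : comNzRingType) (V : lmodType K).
Implicit Types (a b c : V -> lser V).

Lemma nprodE k a b n w m : compatible_pair k a b ->
  nprod a n b w m = Sub (prod2 a b w) (- n - 1) m.
Proof.
move=> hk; rewrite /nprod; set k' := xget _ _.
have hk' : compatible_pair k' a b by rewrite /k'; case: xgetP => [? _ //|/(_ k)].
rewrite (SubE _ _ (hk' w)) mkLE; last exact/sb_trunc/hk'.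
by rewrite /sb addrA.
Qed.

Lemma nprod_large k a b n : compatible_pair k a b -> k%:Z <= n -> nprod a n b = fun=> 0.
Proof.
move=> hk nk; apply/funext => w; apply: lserP => m.
by rewrite (nprodE _ _ _ hk) (SubE _ _ (hk w)) sb_neg//; lia.
Qed.

Lemma compatible_pairW k k' a b : (k <= k')%N ->
  compatible_pair k a b -> compatible_pair k' a b.
Proof. by move=> kk' h w; exact: local2W (h w). Qed.

Definition triple a b c w (p q r : int) : V := a (b (c w r) q) p.

Lemma iter_s12_triple k a b c w p q r :
  iter k (@s12 V) (triple a b c w) p q r = iter k (@mul_sub V) (prod2 a b (c w r)) p q.
Proof. exact: iter_s12. Qed.

Lemma iter_s23_triple k a b c w p q r : zmod_morphism a ->
  iter k (@s23 V) (triple a b c w) p q r = a (iter k (@mul_sub V) (prod2 b c w) q r) p.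
Proof.
move=> aB; rewrite iter_s23 -(@iter_mul_sub_morph V V (fun v => a v p))//.
by move=> x y; rewrite aB.
Qed.

End ProductCoefficients.

Section Associativity.
Variables (K : comNzRingType) (V : lmodType K).
Hypothesis tf : torsion_free V.
Variables (a b c : V -> lser V) (w : V) (k : nat).
Hypothesis aB : zmod_morphism a.

Let T := triple a b c w.
Let Z := iter k (@s23 V) T.
Let Y := iter k (@s12 V) T.
Let P := iter k (@s13 V) (iter k (@s12 V) Z).
(** [G p q] is the coefficient of z^p y^q in Y_E(a, z) Y_E(b, y) c, and [H i j] that of x0^i y^j in
    Y_E(Y_E(a, x0) b, y) c, both applied to [w]. Associativity relates them by z = y + x0. *)
Let G (p q : int) : lser V := nprod a (- p - 1) (nprod b (- q - 1) c) w.
Let H (i j : int) : lser V := nprod (nprod a (- i - 1) b) (- j - 1) c w.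

Hypothesis hP : trunc3 P.
Hypothesis hab : compatible_pair k a b.
Hypothesis hbc : compatible_pair k b c.
Hypothesis ha_bc : forall n, exists l, compatible_pair l a (nprod b n c).
Hypothesis hab_c : forall n, exists l, compatible_pair l (nprod a n b) c.

Lemma trunc2_Z p : trunc2 (Z p).
Proof.
have [N hN] := hbc w; exists N => q r qr; rewrite /Z iter_s23_triple// hN//.
by rewrite (zmod_morph0 aB).
Qed.

Lemma trunc2_Y r : trunc2 (fun p q => Y p q r).
Proof.
have [N hN] := hab (c w r); exists N => p q pq.
by rewrite /Y iter_s12_triple hN.
Qed.

(** The substitution is x2 = x3 + y. The exponent l is kept apart from k so that the factors x1 - x2
    can be turned into z - y one at a time. *)
Let R (l : nat) (j : int) := sb23 (iter l (@s12 V) Z) j.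

Lemma R0E j : R 0 j = prod2 a (nprod b (k%:Z - j - 1) c) w.
Proof.
apply: funext2 => p m.
rewrite /prod2 (nprodE _ _ _ hbc) (SubE _ _ (hbc w)) /R /sb23 /= .
rewrite (_ : k%:Z + (- (k%:Z - j - 1) - 1) = j); last by lia.
rewrite !sbE.
have hB : zmod_morphism (fun v => a v p) by move=> x y; rewrite aB.
rewrite (isum_raddf hB); last exact/sb_fin_supp/hbc.
by apply: eq_isum => q; rewrite (zmod_morphMz hB) /Z iter_s23_triple.
Qed.

Lemma RSE l j : R l.+1 j = add2 (mul_sub (R l j)) (opp2 (R l (j - 1))).
Proof. exact/sb23_s12/trunc2_iter_s12/trunc2_Z. Qed.

Lemma local2_R l j : exists n, local2 n (R l j).
Proof.
elim: l j => [|l IH] j.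
  by rewrite R0E; have [n hn] := ha_bc (k%:Z - j - 1); exists n; apply: hn.
have [n1 h1] := IH j; have [n2 h2] := IH (j - 1); exists (maxn n1 n2).
rewrite RSE; apply/local2D/local2N; last exact: local2W (leq_maxr _ _) h2.
exact/local2_sub/(local2W (leq_maxl _ _) h1).
Qed.

(** Setting x1 = x3 + z turns each x1 - x2 into z - y; the shift of j by k is the factor y^k left by
    (x2 - x3)^k. *)
Lemma Sub_R l i j m :
  Sub (R l j) i m = iter l (@mul_sub V) (fun i j => G i (j - k%:Z) m) i j.
Proof.
elim: l i j => [|l IH] i j.
  have [n hn] := ha_bc (k%:Z - j - 1).
  rewrite R0E /G /= (_ : - (j - k%:Z) - 1 = k%:Z - j - 1); last by lia.
  by rewrite (nprodE _ _ _ hn) (_ : - (- i - 1) - 1 = i)//; lia.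
have [n1 h1] := local2_R l j; have [n2 h2] := local2_R l (j - 1).
have h1' := local2W (leq_maxl n1 n2) h1; have h2' := local2W (leq_maxr n1 n2) h2.
rewrite RSE (SubD _ _ (local2_sub h1') (local2N h2')) (Sub_sub _ _ h1').
by rewrite (SubN _ _ h2') !IH.
Qed.

Lemma iter_mul_sub_shift (M : zmodType) l (A : int -> int -> M) (d e : int) i j :
  iter l (@mul_sub M) (fun i j => A (i - d) (j - e)) i j
  = iter l (@mul_sub M) A (i - d) (j - e).
Proof.
elim: l i j => //= l IH i j; rewrite /mul_sub !IH.
by rewrite [i - 1 - d]addrAC [j - 1 - e]addrAC.
Qed.

(** The factors (x1 - x3)^k and (x2 - x3)^k become z^k and y^k, which are the two index shifts, and
    (x1 - x2)^k becomes (z - y)^k. *)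
Lemma sb_sb23_P i j m :
  sb (sb23 P j) i m = iter k (@mul_sub V) (fun i j => G i j m) (i - k%:Z) (j - k%:Z).
Proof.
have eP : sb23 P j = iter k (@mul_sub V) (R k j).
  exact/sb23_iter_s13/trunc2_iter_s12/trunc2_Z.
have hR : local2 k (R k j) by rewrite /local2 -eP; exact: trunc2_sb23.
have := Sub_R k (i - k%:Z) j m; rewrite (SubE _ _ hR) -eP addrC subrK => ->.
have := iter_mul_sub_shift k (fun i j => G i j m) 0 k%:Z (i - k%:Z) j.
rewrite subr0 => <-; congr (iter k _ _ _ _).
by apply: funext2 => x y; rewrite subr0.
Qed.

Let S (l : nat) (i : int) := sb12 (iter l (@s13 V) Y) i.

Lemma S0E i : S 0 i = prod2 (nprod a (k%:Z - i - 1) b) c w.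
Proof.
apply: funext2 => q r.
rewrite /prod2 (nprodE _ _ _ hab) (SubE _ _ (hab _)) /S /sb12 /=.
rewrite (_ : k%:Z + (- (k%:Z - i - 1) - 1) = i); last by lia.
by rewrite !sbE; apply: eq_isum => p; rewrite /Y iter_s12_triple.
Qed.

Lemma SSE l i : S l.+1 i = add2 (mul_sub (S l i)) (S l (i - 1)).
Proof. exact/sb12_s13/trunc2_iter_s13'/trunc2_Y. Qed.

Lemma local2_S l i : exists n, local2 n (S l i).
Proof.
elim: l i => [|l IH] i.
  by rewrite S0E; have [n hn] := hab_c (k%:Z - i - 1); exists n; apply: hn.
have [n1 h1] := IH i; have [n2 h2] := IH (i - 1); exists (maxn n1 n2).
rewrite SSE; apply/local2D; last exact: local2W (leq_maxr _ _) h2.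
exact/local2_sub/(local2W (leq_maxl _ _) h1).
Qed.

(** With x1 = x2 + x0 and x2 = x3 + y each factor x1 - x3 becomes x0 + y, and (x1 - x2)^k leaves the
    shift of i. *)
Lemma Sub_S l i j m :
  Sub (S l i) j m = iter l (@mul_add V) (fun i j => H (i - k%:Z) j m) i j.
Proof.
elim: l i j => [|l IH] i j.
  have [n hn] := hab_c (k%:Z - i - 1).
  rewrite S0E /H /= (_ : - (i - k%:Z) - 1 = k%:Z - i - 1); last by lia.
  by rewrite (nprodE _ _ _ hn) (_ : - (- j - 1) - 1 = j)//; lia.
have [n1 h1] := local2_S l i; have [n2 h2] := local2_S l (i - 1).
have h1' := local2W (leq_maxl n1 n2) h1; have h2' := local2W (leq_maxr n1 n2) h2.
rewrite SSE (SubD _ _ (local2_sub h1') h2') (Sub_sub _ _ h1') !IH.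
by rewrite addrC.
Qed.

Lemma P_commute : P = iter k (@s23 V) (iter k (@s13 V) Y).
Proof.
rewrite /P /Z (iter_comm _ _ _ (@s12_s23 V)) (iter_comm _ _ _ (@s13_s23 V)).
by [].
Qed.

Lemma sb_sb12_P i j m :
  sb (sb12 P i) j m = iter k (@mul_add V) (fun i j => H (i - k%:Z) j m) i (j - k%:Z).
Proof.
have eP : sb12 P i = iter k (@mul_sub V) (S k i).
  by rewrite P_commute; exact/sb12_iter_s23/trunc2_iter_s13'/trunc2_Y.
have hS : local2 k (S k i) by rewrite /local2 -eP; exact: trunc2_sb12.
by have := Sub_S k i (j - k%:Z) m; rewrite (SubE _ _ hS) -eP addrC subrK => ->.
Qed.

(** The two expansions of P agree by [taylor], with z = y + x0. The common factor y^k (x0 + y)^k is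
    then cancelled: the power of y is a shift, and [mul_add_inj] applies because both sides, once
    multiplied by x0^k, have no negative power of x0. *)
Lemma nprod_assoc i j m :
  trunc2 (iter k (@mul_sub V) (fun p q => G p q m)) ->
  sb (iter k (@mul_sub V) (fun p q => G p q m)) (k%:Z + i) j = H i j m.
Proof.
move=> hG; pose A i j := sb (iter k (@mul_sub V) (fun p q => G p q m)) i j.
suff e : A = fun i j => H (i - k%:Z) j m.
  by have := congr1 (fun f => f (k%:Z + i) j) e; rewrite /A [k%:Z + i]addrC addrK.
apply: (@mul_add_inj V k _ _ 0) => [{}i {}j i0|{}i {}j i0|].
- by rewrite /A sb_neg.
- rewrite /H (nprod_large hab); last by lia.
  have hc : compatible_pair 0 (fun=> 0) c by move=> v; exists 0.
  rewrite (nprodE _ _ _ hc) (SubE _ _ (hc w)) /= sbE isum0// => p.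
  by rewrite /prod2 mul0rz.
apply: funext2 => {}i {}j.
have := @sb_sb12_P i (j + k%:Z) m; rewrite addrK => <-.
rewrite -(taylor tf _ _ _ hP).
have -> : (fun x y => sb (sb23 P y) x m) = fun x y =>
    (iter k (@mul_sub V) (fun p q => G p q m)) (x - k%:Z) (y - k%:Z).
  by apply: funext2 => x y; rewrite sb_sb23_P.
by rewrite sb_shift// addrK.
Qed.

End Associativity.

(** * The Taylor substitution on series in two variables *)

Lemma lcoefMz (M : zmodType) (s : lser M) (k n : int) : (s *~ k) n = s n *~ k.
Proof. exact: (zmod_morphMz (@coefB M n)). Qed.

Lemma lcoef_isum (M : zmodType) (f : int -> lser M) n : fin_supp f ->
  isum f n = isum (fun i => f i n) :> M.
Proof. exact: (isum_raddf (@coefB M n)). Qed.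

Section SeriesTaylor.
Variables (R : comNzRingType) (M : lmodType R).
Implicit Types (s t : lser (lser M)) (g : lser R).

Definition gtr s : Prop := trunc2 (fun m n => s m n).

Definition mk2 (A : int -> int -> M) : lser (lser M) := mkL (fun m => mkL (A m)).

Lemma mk2E A m n : trunc2 A -> mk2 A m n = A m n.
Proof.
move=> [N hN].
have e p : mkL (A p) = A p :> (int -> M).
  by rewrite mkLE//; exists N => q qN; apply: hN; rewrite qN orbT.
rewrite /mk2 mkLE ?e//; exists N => p pN; apply: lserP => q.
by rewrite e hN ?pN.
Qed.

Lemma gtr_mk2 A : trunc2 A -> gtr (mk2 A).
Proof. by move=> hA; have [N hN] := hA; exists N => m n mn; rewrite mk2E// hN. Qed.

Definition sbL (j : int) s : lser M := mkL (sb (fun m n => s m n) j).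

Lemma sbLE j s m : gtr s -> sbL j s m = sb (fun m n => s m n) j m.
Proof. by move=> hs; rewrite /sbL mkLE//; exact: sb_trunc. Qed.

Lemma gtrD s t : gtr s -> gtr t -> gtr (s + t).
Proof. by move=> hs ht; exact: (trunc2D hs ht). Qed.

Lemma gtr_lD s : gtr s -> gtr (lD s).
Proof.
move=> /trunc2dx [N hN]; exists N => m n mn.
by rewrite lDE lcoefMz -[RHS](hN m n mn).
Qed.

Lemma gtr_lconst g s : gtr s -> gtr (lconst g *: s).
Proof.
move=> [N hN]; have [a ha] := lser_trunc g; exists (Num.min N (N + a)) => m n mn.
rewrite lconst_scale lscaleE_isum isum0// => i.
have [ia|ia] := ltP i a; first by rewrite ha ?scale0r.
by rewrite hN ?scaler0//; lia.
Qed.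

Lemma lm_lconst_scale g s m n :
  (lm (@lconst R) g *: s) m n = isum (fun i => g i *: s (m - i) n).
Proof.
rewrite lscaleE_isum lcoef_isum; last exact: lscale_fin_supp.
by apply: eq_isum => i; rewrite lmE ?lconst_scale//; exact: lconstB.
Qed.

Lemma gtr_lm_lconst g s : gtr s -> gtr (lm (@lconst R) g *: s).
Proof.
move=> [N hN]; have [a ha] := lser_trunc g; exists (Num.min N (N + a)) => m n mn.
rewrite lm_lconst_scale isum0// => i.
have [ia|ia] := ltP i a; first by rewrite ha ?scale0r.
by rewrite hN ?scaler0//; lia.
Qed.

Lemma sbLD j s t : gtr s -> gtr t -> sbL j (s + t) = sbL j s + sbL j t.
Proof.
move=> hs ht; apply: lserP => m; rewrite lcoefD !sbLE//; last exact: gtrD.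
by rewrite -sbD.
Qed.

Lemma sbL_neg j s : j < 0 -> sbL j s = 0.
Proof.
move=> j0; apply: lserP => m; rewrite /sbL mkLE ?sb_neg//.
by exists 0 => n _; rewrite sb_neg.
Qed.

Lemma sbL_lD j s : gtr s -> sbL j (lD s) = sbL (j + 1) s *~ (j + 1).
Proof.
move=> hs; apply: lserP => m; rewrite lcoefMz !sbLE//; last exact: gtr_lD.
rewrite -sb_dx//.
have -> // : (fun m n => lD s m n) = dx (fun m n => s m n).
by apply: funext2 => p q; rewrite lDE lcoefMz.
Qed.

Lemma sbL_lconst j g s : gtr s -> sbL j (lconst g *: s) = g *: sbL j s.
Proof.
move=> hs; apply: lserP => m; rewrite sbLE; last exact: gtr_lconst.
rewrite lscaleE_isum sbE.
have [N hN] := hs; have [a ha] := lser_trunc g.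
transitivity (isum (fun p => isum (fun i => (g i *: s p (m + j - p - i)) *~ bz p j))).
  apply: eq_isum => p; rewrite lconst_scale lscaleE_isum isumMz//.
  exact: lscale_fin_supp.
rewrite (@isum_exchange _ _ N (m + j - a - N + 1) a (m + j - N - N + 1)).
  apply: eq_isum => i; rewrite sbLE// sbE.
  have hB : zmod_morphism (fun x : M => g i *: x) by move=> x y; rewrite scalerBr.
  rewrite (isum_raddf hB); last exact: (sb_fin_supp _ _ hs).
  apply: eq_isum => p; rewrite scalerMzr; congr (_ *: (s p _ *~ _)); lia.
move=> p i pi; have [ia|ia] := ltP i a; first by rewrite ha ?scale0r ?mul0rz.
by rewrite hN ?scaler0 ?mul0rz//; lia.
Qed.

(** At x0 = 0 the factor g(x1) is just g(x); the higher coefficients bring in derivatives of g, as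
    in [sbL_leibniz]. *)
Lemma sbL_lm_lconst g s : gtr s -> sbL 0 (lm (@lconst R) g *: s) = g *: sbL 0 s.
Proof.
move=> hs; apply: lserP => m.
rewrite (@sbLE 0 (lm (@lconst R) g *: s)); last exact: gtr_lm_lconst.
rewrite lscaleE_isum sbE.
have [N hN] := hs; have [a ha] := lser_trunc g.
transitivity (isum (fun p => isum (fun i => g i *: s (p - i) (m - p)))).
  by apply: eq_isum => p; rewrite bz0 mulr1z addr0 lm_lconst_scale.
rewrite (@isum_exchange _ _ (N + a) (m - N + 1) a (m - N - N + 1)).
  apply: eq_isum => i; rewrite sbLE// sbE.
  have hB : zmod_morphism (fun x : M => g i *: x) by move=> x y; rewrite scalerBr.
  rewrite (isum_raddf hB); last exact: (sb_fin_supp _ _ hs).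
  rewrite -[LHS](isum_shift i); apply: eq_isum => p.
  by rewrite bz0 mulr1z addr0 addrK; congr (_ *: s p _); lia.
move=> p i pi; have [ia|ia] := ltP i a; first by rewrite ha ?scale0r.
by rewrite hN ?scaler0//; lia.
Qed.

Lemma lD_lm_lconst_scale g s :
  lD (lm (@lconst R) g *: s) = lm (@lconst R) (lD g) *: s + lm (@lconst R) g *: lD s.
Proof.
rewrite lD_scale (_ : lD (lm (@lconst R) g) = lm (@lconst R) (lD g))//.
apply: lserP => n; rewrite lDE !lmE ?lDE ?(zmod_morphMz (@lconstB R))//; exact: lconstB.
Qed.

End SeriesTaylor.

(** * Locality up to coefficients *)

Lemma calEB (K : comNzRingType) (V : lmodType K) (a : V -> lser V) :
  calE a -> zmod_morphism a.
Proof.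
move=> ha u v; have := ha (-1) v u; rewrite scaleN1r addrC => ->.
by rewrite rmorphN1 scaleN1r addrC.
Qed.

Lemma calEZ (K : comNzRingType) (V : lmodType K) (a : V -> lser V) c u :
  calE a -> a (c *: u) = lconst c *: a u.
Proof.
move=> ha; have := ha c u 0; rewrite addr0 => ->.
by rewrite (zmod_morph0 (calEB ha)) addr0.
Qed.

Lemma lcoef2D (M : zmodType) (s t : lser (lser M)) m n : (s + t) m n = s m n + t m n.
Proof. by []. Qed.

Lemma lcoef2N (M : zmodType) (s : lser (lser M)) m n : (- s) m n = - s m n.
Proof. by []. Qed.

Lemma lcoef2B (M : zmodType) (s t : lser (lser M)) m n : (s - t) m n = s m n - t m n.
Proof. by []. Qed.

(* What is used of the expansions in F((t))[[x1, x2]] of the f(t + x1, t + x2)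
   with no pole at x1 = x2. *)
Record coefficient_ring (K : comNzRingType) (sA : lser (lser K) -> Prop) : Prop := {
  sA1 : sA 1;
  sAM : forall h h', sA h -> sA h' -> sA (h * h');
  sA_int : forall k : int, sA k%:~R;
  sA_inv : forall n : nat, exists2 c, sA c & c *+ n.+1 = 1;
  sA_diff : sA (lX (lser K) - lconst (lX K));
  sA_d1 : forall h, sA h -> sA (lD h);
  sA_d2 : forall h, sA h -> sA (lm (@lD K) h) }.

Section SLocality.
Variables (K : comNzRingType) (V : lmodType K) (psi : V -> V -> lser V).
Variable sA : lser (lser K) -> Prop.
Hypothesis hA : coefficient_ring sA.

Implicit Types (A B C : V -> Prop) (h : lser (lser K)).

Definition lin v : Prop := calE (psi v).

(* The finite sums of the h(t, x1, x2) v(x2) u(x1) with h in sA, u in A and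
   v in B: once both sides are multiplied by a power of x1 - x2, these are the
   right-hand sides of the S_t-locality relations. *)
Inductive Good A B : (V -> lser (lser V)) -> Prop :=
| Good0 : Good A B (fun=> 0)
| GoodS h u v G : sA h -> A u -> B v -> lin u -> lin v -> Good A B G ->
    Good A B (fun w => h *: lm (psi v) (psi u w) + G w).

Definition GoodF A B (g : V -> int -> int -> V) : Prop :=
  exists2 G, Good A B G & forall w m n, g w m n = G w m n.

Lemma Good_ext A B G G' : G =1 G' -> Good A B G -> Good A B G'.
Proof. by move=> /funext->. Qed.

Lemma Good1 A B u v : A u -> B v -> lin u -> lin v ->
  Good A B (fun w => lm (psi v) (psi u w)).
Proof.
move=> Au Bv lu lv.
by apply: Good_ext (GoodS (sA1 hA) Au Bv lu lv (Good0 A B)) => w; rewrite scale1r addr0.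
Qed.

Lemma GoodD A B G G' : Good A B G -> Good A B G' -> Good A B (fun w => G w + G' w).
Proof.
move=> hG hG'; elim: hG => [|h u v {}G hh Au Bv lu lv _ IH].
  by apply: Good_ext hG' => w; rewrite add0r.
by apply: Good_ext (GoodS hh Au Bv lu lv IH) => w; rewrite addrA.
Qed.

Lemma Good_scale A B h G : sA h -> Good A B G -> Good A B (fun w => h *: G w).
Proof.
move=> hh; elim=> [|h' u v {}G hh' Au Bv lu lv _ IH].
  by apply: Good_ext (Good0 A B) => w; rewrite scaler0.
apply: Good_ext (GoodS (sAM hA hh hh') Au Bv lu lv IH) => w.
by rewrite scalerDr scalerA.
Qed.

Lemma Good_mulz A B k G : Good A B G -> Good A B (fun w => G w *~ k).
Proof.
move=> /(Good_scale (sA_int hA k)); apply: Good_ext => w.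
by rewrite scaler_int.
Qed.

Lemma Good_div A B n G : Good A B (fun w => G w *~ (n%:Z + 1)) -> Good A B G.
Proof.
have [c hc c1] := sA_inv hA n; move=> /(Good_scale hc); apply: Good_ext => w.
by rewrite -PoszD addn1 -[_ *~ _]/(_ *+ _) -scalerMnr scalerMnl c1 scale1r.
Qed.

Lemma Good_mono A B A' B' G : (forall v, A v -> A' v) -> (forall v, B v -> B' v) ->
  Good A B G -> Good A' B' G.
Proof.
move=> AA BB; elim=> [|h u v {}G hh Au Bv lu lv _ IH]; first exact: Good0.
exact: GoodS (AA _ Au) (BB _ Bv) lu lv IH.
Qed.

Lemma sub_scale (M : lmodType K) (s : lser (lser M)) m n :
  ((lX (lser K) - lconst (lX K)) *: s) m n = s (m - 1) n - s m (n - 1).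
Proof. by rewrite scalerBl lcoef2B lX_scale lconst_scale lX_scale. Qed.

Lemma iter_mul_sub_series (M : lmodType K) k (s : lser (lser M)) m n :
  iter k (@mul_sub M) (fun m n => s m n) m n
  = ((lX (lser K) - lconst (lX K)) ^+ k *: s) m n.
Proof.
elim: k m n => [|k IH] m n; first by rewrite expr0 scale1r.
by rewrite exprS -scalerA sub_scale /= /mul_sub !IH.
Qed.

Lemma sA_sub k : sA ((lX (lser K) - lconst (lX K)) ^+ k).
Proof.
elim: k => [|k IH]; first by rewrite expr0; exact: sA1.
by rewrite exprS; apply: (sAM hA) IH; exact: sA_diff.
Qed.

Lemma GoodFD A B g g' : GoodF A B g -> GoodF A B g' -> GoodF A B (fun w => add2 (g w) (g' w)).
Proof.
move=> [G hG e] [G' hG' e']; exists (fun w => G w + G' w); first exact: GoodD.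
by move=> w m n; rewrite lcoef2D /add2 e e'.
Qed.

Lemma GoodF_sub A B k g : GoodF A B g -> GoodF A B (fun w => iter k (@mul_sub V) (g w)).
Proof.
move=> [G hG e].
exists (fun w => (lX (lser K) - lconst (lX K)) ^+ k *: G w); first exact/Good_scale/hG/sA_sub.
move=> w m n; rewrite -iter_mul_sub_series; congr (iter k _ _ m n).
by apply: funext2 => x y; rewrite e.
Qed.

Lemma GoodFN A B g : GoodF A B g -> GoodF A B (fun w => opp2 (g w)).
Proof.
move=> [G hG e]; exists (fun w => G w *~ (-1)); first exact: Good_mulz.
by move=> w m n; rewrite mulrN1z lcoef2N /opp2 e.
Qed.

Lemma GoodF_mono A B A' B' g : (forall v, A v -> A' v) -> (forall v, B v -> B' v) ->
  GoodF A B g -> GoodF A' B' g.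
Proof. by move=> AA BB [G hG e]; exists G => //; exact: Good_mono hG. Qed.

(** Locality with a record of the operators after the exchange: those in x1 come from [A], those in
    x2 from [B]. The induction over words needs the record, since an exchange replaces a and b by
    other vectors. *)
Definition SL A B a b : Prop :=
  exists k, GoodF A B (fun w => iter k (@mul_sub V) (prod2 (psi a) (psi b) w)).

Lemma SL_large A B a b : SL A B a b -> exists k0, forall k, (k0 <= k)%N ->
  GoodF A B (fun w => iter k (@mul_sub V) (prod2 (psi a) (psi b) w)).
Proof.
move=> [k0 h]; exists k0 => k /subnK <-.
have [G hG e] := GoodF_sub (k - k0) h.
by exists G => // w m n; rewrite iterD e.
Qed.

Lemma SL_mono A B A' B' a b : (forall v, A v -> A' v) -> (forall v, B v -> B' v) ->
  SL A B a b -> SL A' B' a b.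
Proof. by move=> AA BB [k h]; exists k; exact: GoodF_mono h. Qed.

Lemma iter_mul_sub_low (M : zmodType) k (P : int -> int -> M) (N : int) :
  (forall m n, n < N -> P m n = 0) -> forall m n, n < N -> iter k (@mul_sub M) P m n = 0.
Proof.
move=> hP; elim: k => //= k IH m n nN.
by rewrite /mul_sub !IH ?subr0//; lia.
Qed.

(* A product a(x1) b(x2) w is bounded below in x2, and the other side of the
   locality relation is bounded below in x1. *)
Lemma SL_compatible A B a b : lin a -> SL A B a b ->
  exists k, compatible_pair k (psi a) (psi b).
Proof.
move=> la [k [G _ e]]; exists k => w.
have [N hN] := lser_trunc (psi b w); have [N' hN'] := lser_trunc (G w).
exists (Num.min N N') => m n; rewrite lt_min => /orP[mN|nN].
  by rewrite e hN' ?lcoef0//; lia.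
apply: iter_mul_sub_low (N) _ _ _ _ => [{}m {}n {}nN|]; last by move: nN; rewrite lt_min => /andP[].
by rewrite /prod2 hN// (zmod_morph0 (calEB la)).
Qed.

Definition compat b c : Prop := exists k, compatible_pair k (psi b) (psi c).

Definition Cel k b c (w : V) : lser (lser V) :=
  mk2 (iter k (@mul_sub V) (prod2 (psi b) (psi c) w)).

Lemma CelE k b c w m n : compatible_pair k (psi b) (psi c) ->
  Cel k b c w m n = iter k (@mul_sub V) (prod2 (psi b) (psi c) w) m n.
Proof. by move=> hk; rewrite mk2E. Qed.

Lemma prod2B a b (w w' : V) : lin a -> lin b -> forall m n,
  prod2 (psi a) (psi b) (w - w') m n =
  prod2 (psi a) (psi b) w m n - prod2 (psi a) (psi b) w' m n.
Proof. by move=> la lb m n; rewrite /prod2 (calEB lb) (calEB la). Qed.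

Lemma CelB k b c : lin b -> lin c -> compatible_pair k (psi b) (psi c) ->
  zmod_morphism (Cel k b c).
Proof.
move=> lb lc hk u v; apply: lserP => m; apply: lserP => n.
rewrite lcoef2B !CelE//.
have -> : prod2 (psi b) (psi c) (u - v) =
    add2 (prod2 (psi b) (psi c) u) (opp2 (prod2 (psi b) (psi c) v)).
  by apply: funext2 => x y; rewrite prod2B.
by rewrite iter_mul_subD iter_mul_subN.
Qed.

(* Sums of h(t, x1, x2) h'(t, x1, x3) times (x2 - x3)^k b(x2) c(x3) a(x1) *)
Inductive Good3 k A B C : (V -> lser (lser (lser V))) -> Prop :=
| Good30 : Good3 k A B C (fun=> 0)
| Good3S h h' a b c G : sA h -> sA h' -> A a -> B b -> C c ->
    lin a -> lin b -> lin c -> compatible_pair k (psi b) (psi c) ->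
    Good3 k A B C G ->
    Good3 k A B C (fun w => lm (lm (@lconst K)) h *: (lm (@lconst (lser K)) h' *:
      lm (Cel k b c) (psi a w)) + G w).

Lemma Good3_ext k A B C G G' : G =1 G' -> Good3 k A B C G -> Good3 k A B C G'.
Proof. by move=> /funext->. Qed.

Lemma Good3D k A B C G G' : Good3 k A B C G -> Good3 k A B C G' ->
  Good3 k A B C (fun w => G w + G' w).
Proof.
move=> hG hG'; elim: hG => [|h h' a b c {}G hh hh' Aa Bb Cc la lb lc hk _ IH].
  by apply: Good3_ext hG' => w; rewrite add0r.
by apply: Good3_ext (Good3S hh hh' Aa Bb Cc la lb lc hk IH) => w; rewrite addrA.
Qed.

End SLocality.

Lemma scalerAC (R : comNzRingType) (M : lmodType R) (a b : R) (x : M) :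
  a *: (b *: x) = b *: (a *: x).
Proof. by rewrite !scalerA mulrC. Qed.

(** * Triple products with the exponent of one variable kept as an index *)

Section TripleProducts.
Variables (K : comNzRingType) (V : lmodType K) (psi : V -> V -> lser V).
Variable sA : lser (lser K) -> Prop.
Implicit Types h : lser (lser K).

Local Notation eps12 h := (lm (lm (@lconst K)) h).
Local Notation eps13 h := (lm (@lconst (lser K)) h).

Lemma lX_lm (M N : lmodType K) (f : M -> lser N) (s : lser M) : zmod_morphism f ->
  lX (lser K) *: lm f s = lm f (lX K *: s).
Proof. by move=> fB; apply: lserP => n; rewrite lX_scale !lmE// lX_scale. Qed.

(** Multiplication by x1 - x3 when x1 is the series variable and the exponent r of x3 an index: the
    bound in x1 may depend on r, so the family need not be a series. [colY] and [msX] treat x2 - x3,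
    with the exponent of x3 and of x2 as index respectively. *)
Definition colX (z : int -> lser V) (r : int) : lser V := lX K *: z r - z (r - 1).

Definition colY (z : int -> lser (lser V)) (r : int) : lser (lser V) :=
  lconst (lX K) *: z r - z (r - 1).

Lemma colXE z r p : colX z r p = z r (p - 1) - z (r - 1) p.
Proof. by rewrite /colX lcoefD lcoefN (lX_scale (z r)). Qed.

Lemma colYE z r p q : colY z r p q = z r p (q - 1) - z (r - 1) p q.
Proof. by rewrite /colY lcoef2B (lconst_scale (lX K) (z r)) (lX_scale (z r p)). Qed.

Lemma iter_s13_scale l h (f : V -> lser V) (z : int -> lser V) p q r : zmod_morphism f ->
  iter l (@s13 V) (fun p q r => (h *: lm f (z r)) p q) p q r =
  (h *: lm f (iter l colX z r)) p q.
Proof.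
move=> fB; have -> : iter l (@s13 V) (fun p q r => (h *: lm f (z r)) p q) =
    fun p q r => (h *: lm f (iter l colX z r)) p q.
  elim: l => //= l ->; apply: funext3 => {}p {}q {}r.
  set y := iter _ _ _.
  rewrite /colX (lm_is_zmod_morphism fB) -lX_lm// scalerBr lcoef2B.
  by rewrite (scalerAC h (lX _)) (lX_scale (h *: lm f (y r))).
by [].
Qed.

Lemma iter_colX l (z : int -> lser V) p r :
  (iter l colX z r) p =
  iter l (@mul_sub V) (fun p r => z r p) p r.
Proof.
by elim: l p r => // l IH p r; rewrite !iterS colXE !IH.
Qed.

Lemma iter_s23_scale l h (z : int -> lser (lser V)) p q r :
  iter l (@s23 V) (fun p q r => (h *: z r) p q) p q r =
  (h *: (iter l colY z r)) p q.
Proof.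
have -> : iter l (@s23 V) (fun p q r => (h *: z r) p q) =
    fun p q r => (h *: (iter l colY z r)) p q.
  elim: l => //= l ->; apply: funext3 => {}p {}q {}r.
  set y := iter _ _ _.
  rewrite /colY scalerBr lcoef2B (scalerAC h (lconst _)).
  by rewrite (lconst_scale (lX K) (h *: y r)) (lX_scale ((h *: y r) p)).
by [].
Qed.

Lemma iter_colY l (z : int -> lser (lser V)) p q r :
  (iter l colY z r) p q =
  iter l (@mul_sub V) (fun q r => z r p q) q r.
Proof.
elim: l q r => // l IH q r.
by rewrite !iterS colYE !IH.
Qed.

Definition msX (n : int -> lser V) (q : int) : lser V := n (q - 1) - lX K *: n q.

Lemma msXE n q r : msX n q r = n (q - 1) r - n q (r - 1).
Proof. by rewrite /msX lcoefD lcoefN (lX_scale (n q)). Qed.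

Lemma iter_msX l (n : int -> lser V) q r :
  iter l msX n q r = iter l (@mul_sub V) (fun q r => n q r) q r.
Proof.
by elim: l q r => // l IH q r; rewrite !iterS msXE !IH.
Qed.

Lemma iter_msXB l : zmod_morphism (iter l msX).
Proof.
elim: l => // l IH x y; rewrite !iterS IH; apply/funext => q.
rewrite -[RHS]/(msX (iter l msX x) q - msX (iter l msX y) q) /msX.
by rewrite scalerBr opprB [in RHS]opprB addrACA [RHS]addrACA; congr (_ + _); rewrite addrC.
Qed.

Lemma iter_msXZ l (g : lser K) (n : int -> lser V) :
  iter l msX (g *: n) = g *: iter l msX n.
Proof.
elim: l => // l IH; rewrite !iterS IH; apply/funext => q.
rewrite -[RHS]/(g *: msX (iter l msX n) q) /msX scalerBr.
by rewrite (scalerAC g (lX _)).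
Qed.

Lemma lm_coefZ n (f : V -> lser V) (g : lser K) (t : lser V) : calE f ->
  lm (fun v => f v n) (g *: t) = g *: lm (fun v => f v n) t.
Proof.
move=> hf; have fB : zmod_morphism (fun v => f v n) by move=> x y; rewrite (calEB hf).
apply: lserP => m; rewrite lmE// !lscaleE_isum (isum_raddf fB); last first.
  exact: lscale_fin_supp.
by apply: eq_isum => i; rewrite lmE// calEZ// lconst_scale.
Qed.

(** The operator [Phi], sending t(x3) to (x2 - x3)^k b(x2) t(x3), is linear over K((x3)) because b
    is K-linear. It therefore passes the coefficients of h and acts on c(x3) alone, where
    compatibility makes the result a series. *)
Lemma iter_mul_sub_row k b c h (s : lser V) p q r (w : V) : calE b -> calE c ->
  compatible_pair k b c ->
  iter k (@mul_sub V) (fun q r => b ((h *: lm c s) p r) q) q r =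
  (eps13 h *: lm (fun w => mk2 (iter k (@mul_sub V) (prod2 b c w))) s) p q r.
Proof.
move=> hb hc hk; have cB := calEB hc; have bB := calEB hb.
pose N (t : lser V) (q : int) : lser V := lm (fun v => b v q) t.
have NB : zmod_morphism N.
  by move=> x y; apply/funext => q'; apply: lm_is_zmod_morphism => u v; rewrite bB.
pose Phi t := iter k msX (N t).
have PhiB : zmod_morphism Phi by move=> x y; rewrite /Phi NB iter_msXB.
have PhiZ g t : Phi (g *: t) = g *: Phi t.
  rewrite /Phi -iter_msXZ; congr (iter k msX _); apply/funext => q'.
  by rewrite /N lm_coefZ.
have PhiE t : (fun q r => Phi t q r) = iter k (@mul_sub V) (fun q r => b (t r) q).
  apply: funext2 => q' r'; rewrite /Phi iter_msX.
  congr (iter k _ _ _ _); apply: funext2 => q'' r''.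
  by rewrite /N lmE// => u v; rewrite bB.
rewrite -[LHS](congr1 (fun f => f q r) (PhiE _)).
set C := fun w => mk2 _.
have CB : zmod_morphism C.
  move=> u v; apply: lserP => m; apply: lserP => n; rewrite lcoef2B !mk2E//.
  have -> : prod2 b c (u - v) = add2 (prod2 b c u) (opp2 (prod2 b c v)).
    by apply: funext2 => x y; rewrite /prod2 cB bB.
  by rewrite iter_mul_subD iter_mul_subN.
have toWB : zmod_morphism (fun (x : lser (lser V)) (q : int) => x q) by [].
suff e : Phi ((h *: lm c s) p) = fun q => ((eps13 h *: lm C s) p) q by rewrite e.
rewrite !lscaleE_isum (isum_raddf PhiB); last exact: lscale_fin_supp.
rewrite (isum_raddf toWB); last exact: lscale_fin_supp.
apply: eq_isum => i; rewrite PhiZ !lmE//; last exact: lconstB.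
apply/funext => q'; rewrite -[LHS]/(h i *: Phi _ q') lconst_scale; congr (_ *: _).
apply: lserP => r'; rewrite mk2E; last exact: hk.
by have := congr1 (fun f => f q' r') (PhiE (c (s (p - i)))).
Qed.

Lemma eps12_coef h (s : lser (lser (lser V))) p q r :
  (eps12 h *: s) p q r = (h *: lm (lm (@coef V r)) s) p q.
Proof.
have cB := @coefB V r; have lB := lm_is_zmod_morphism cB.
have hB : zmod_morphism (fun t : lser (lser V) => t q r) by [].
rewrite lscaleE_isum (isum_raddf hB); last exact: lscale_fin_supp.
rewrite (lscaleE_isum h) lcoef_isum; last exact: lscale_fin_supp.
apply: eq_isum => i; rewrite lmE; last exact/lm_is_zmod_morphism/lconstB.
rewrite lm_lconst_scale lscaleE_isum; apply: eq_isum => j.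
by rewrite !lmE.
Qed.

Lemma iter_s23_Cel k b c h h' (s : lser V) p q r : calE b -> calE c ->
  compatible_pair k b c ->
  iter k (@s23 V) (fun p q r => (h *: lm b (lm (@coef V r) (h' *: lm c s))) p q) p q r =
  (eps12 h *: (eps13 h' *:
     lm (fun w => mk2 (iter k (@mul_sub V) (prod2 b c w))) s)) p q r.
Proof.
move=> hb hc hk; have bB := calEB hb.
rewrite iter_s23_scale; set S3 := (eps13 h' *: _).
have -> : iter k colY
    (fun r => lm b (lm (@coef V r) (h' *: lm c s))) r = lm (lm (@coef V r)) S3.
  apply: lserP => m; apply: lserP => n; rewrite iter_colY.
  rewrite !lmE; [|exact: coefB|exact/lm_is_zmod_morphism/coefB].
  rewrite [RHS]/coef -(iter_mul_sub_row _ _ _ _ _ 0 hb hc hk).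
  congr (iter k _ _ n r); apply: funext2 => x y.
  by rewrite !lmE.
by rewrite eps12_coef.
Qed.

End TripleProducts.

(** The Taylor coefficient [sbL j] is additive only on series truncated in both variables, so no
    more than [h 0 = 0] can be asked here; [lm_scale_on] likewise asks for additivity on a subset
    only. *)
Lemma lmE0 (M N : zmodType) (h : M -> N) (s : lser M) n : h 0 = 0 -> lm h s n = h (s n).
Proof.
move=> h0; rewrite mkLE//; have [a ha] := lser_trunc s.
by exists a => m ma; rewrite ha.
Qed.

Lemma isum_raddf_on (M N : zmodType) (T : M -> Prop) (h : M -> N) (f : int -> M) :
  T 0 -> (forall x y, T x -> T y -> T (x + y)) ->
  h 0 = 0 -> (forall x y, T x -> T y -> h (x + y) = h x + h y) ->
  (forall i, T (f i)) -> fin_supp f ->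
  T (isum f) /\ h (isum f) = isum (fun i => h (f i)).
Proof.
move=> T0 TD h0 hD Tf [a [b fab]].
have hab : supp_in (fun i => h (f i)) a b by move=> i hi; rewrite fab.
rewrite (isum_box fab) (isum_box hab).
by elim/big_rec2: _ => // i x y _ [Ty <-]; split; [exact: TD|exact: hD].
Qed.

Lemma lm_scale_on (R S : comNzRingType) (M : lmodType R) (N : lmodType S)
  (A : R -> Prop) (T : M -> Prop) (th : R -> S) (h : M -> N) (f : lser R) (s : lser M) :
  zmod_morphism th -> T 0 -> (forall x y, T x -> T y -> T (x + y)) ->
  h 0 = 0 -> (forall x y, T x -> T y -> h (x + y) = h x + h y) ->
  (forall n, A (f n)) -> (forall n, T (s n)) ->
  (forall r x, A r -> T x -> T (r *: x) /\ h (r *: x) = th r *: h x) ->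
  (forall n, T ((f *: s) n)) /\ lm h (f *: s) = lm th f *: lm h s.
Proof.
move=> thB T0 TD h0 hD fA sT hs.
have aux n := @isum_raddf_on M N T h (fun i => f i *: s (n - i)) T0 TD h0 hD
  (fun i => (hs _ _ (fA i) (sT _)).1) (lscale_fin_supp f s n).
split=> [n|]; first by rewrite lscaleE_isum; case: (aux n).
apply: lserP => n; rewrite lmE0// !lscaleE_isum; case: (aux n) => _ ->.
by apply: eq_isum => i; rewrite lmE// lmE0// (hs _ _ (fA i) (sT _)).2.
Qed.

Section SeriesTaylorZero.
Variables (R : comNzRingType) (M : lmodType R).

Lemma gtr0 : @gtr R M 0.
Proof. by exists 0. Qed.

Lemma sbL0 j : sbL j (0 : lser (lser M)) = 0.
Proof. by have := sbLD j gtr0 gtr0; rewrite addr0 -{1}[sbL j 0]addr0 => /addrI. Qed.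

End SeriesTaylorZero.

Lemma calE_nprod (K : comNzRingType) (V : lmodType K) k (a b : V -> lser V) n :
  calE a -> calE b -> compatible_pair k a b -> calE (nprod a n b).
Proof.
move=> ha hb hk c u v; apply: lserP => m.
rewrite lcoefD lconst_scale !(nprodE _ _ _ hk) !(SubE _ _ (hk _)).
have -> : prod2 a b (c *: u + v) = add2 (fun m n => c *: prod2 a b u m n) (prod2 a b v).
  apply: funext2 => x y; rewrite /prod2 /add2 hb lcoefD lconst_scale.
  by rewrite ha lcoefD lconst_scale.
have cB : zmod_morphism (fun x : V => c *: x) by move=> x y; rewrite scalerBr.
have e : iter k (@mul_sub V) (fun m n => c *: prod2 a b u m n) =
    fun m n => c *: iter k (@mul_sub V) (prod2 a b u) m n.
  by apply: funext2 => x y; rewrite (iter_mul_sub_morph _ _ _ _ cB).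
rewrite iter_mul_subD e sbD; last exact: hk; last first.
  by have [N hN] := hk u; exists N => x y xy; rewrite hN// scaler0.
congr (_ + _); rewrite !sbE (isum_raddf cB); last exact/sb_fin_supp/hk.
by apply: eq_isum => p; rewrite scalerMzr.
Qed.

Lemma lcoef3D (M : zmodType) (s t : lser (lser (lser M))) p q r :
  (s + t) p q r = s p q r + t p q r.
Proof. by rewrite (lcoefD s t) lcoef2D. Qed.

(** * Locality of u(x) with a product b(x)_m c(x) *)

Section RightProducts.
Variables (K : comNzRingType) (V : lmodType K) (psi : V -> V -> lser V).
Variable sA : lser (lser K) -> Prop.
Hypothesis hA : coefficient_ring sA.
Implicit Types (A B C D : V -> Prop) (h : lser (lser K)).

Local Notation eps12 h := (lm (lm (@lconst K)) h).
Local Notation eps13 h := (lm (@lconst (lser K)) h).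

(** Removes a difference factor after a Taylor substitution. There x1 - x2 = (x1 - x3) - y, or x1 -
    x3 = (x2 - x3) + y for left products, so the remaining difference times [rho l j] is
    [rho l.+1 j] up to the coefficient of y^(j-1). The latter is known by induction on j from the
    vanishing for j < 0, and each j costs further powers. The map [theta] carries the sign of y. *)
Lemma unlocal A D (rho : nat -> int -> V -> int -> int -> V)
    (theta : (int -> int -> V) -> int -> int -> V) :
  (forall l j w, mul_sub (rho l j w) = add2 (rho l.+1 j w) (theta (rho l (j - 1) w))) ->
  (forall g, GoodF psi sA A D g -> GoodF psi sA A D (fun w => theta (g w))) ->
  (forall k x, iter k (@mul_sub V) (theta x) = theta (iter k (@mul_sub V) x)) ->
  (forall l j w, j < 0 -> rho l j w = fun _ _ => 0) ->
  forall L,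
  (forall j, exists M, GoodF psi sA A D (fun w => iter M (@mul_sub V) (rho L j w))) ->
  forall j, exists M, GoodF psi sA A D (fun w => iter M (@mul_sub V) (rho 0%N j w)).
Proof.
move=> hrel hth hthc hneg; elim=> // L IH hL; apply: IH => j.
have neg i : i < 0 -> exists M, GoodF psi sA A D (fun w => iter M (@mul_sub V) (rho L i w)).
  move=> i0; exists 0%N; exists (fun=> 0); first exact: Good0.
  by move=> w m n /=; rewrite hneg.
case: j => [j|j]; last exact: neg.
elim: j => [|j [M2 IHj]].
  have [M2 h2] := neg (0 - 1) isT; have [M1 h1] := hL 0.
  exists (M1 + M2).+1; have := GoodFD (GoodF_sub hA M2 h1) (hth _ (GoodF_sub hA M1 h2)).
  congr GoodF; apply/funext => w; rewrite iterSr hrel iter_mul_subD hthc.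
  by rewrite -!iterD [(M2 + M1)%N]addnC.
have [M1 h1] := hL j.+1.
exists (M1 + M2).+1; have := GoodFD (GoodF_sub hA M2 h1) (hth _ (GoodF_sub hA M1 IHj)).
congr GoodF; apply/funext => w; rewrite iterSr hrel iter_mul_subD hthc.
rewrite (_ : j.+1%:Z - 1 = j); last by lia.
by rewrite -!iterD [(M2 + M1)%N]addnC.
Qed.

Definition add3 (P Q : int -> int -> int -> V) p q r := P p q r + Q p q r.

Lemma iter_s13D k P Q : iter k (@s13 V) (add3 P Q) = add3 (iter k (@s13 V) P) (iter k (@s13 V) Q).
Proof.
elim: k => //= k ->; apply: funext3 => p q r.
by rewrite /s13 /add3 opprD addrACA.
Qed.

Lemma iter_s23D k P Q : iter k (@s23 V) (add3 P Q) = add3 (iter k (@s23 V) P) (iter k (@s23 V) Q).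
Proof.
elim: k => //= k ->; apply: funext3 => p q r.
by rewrite /s23 /add3 opprD addrACA.
Qed.

Lemma iter_s13_0 k : iter k (@s13 V) (fun _ _ _ => 0) = fun _ _ _ => 0.
Proof.
elim: k => //= k ->; apply: funext3 => p q r.
by rewrite /s13 subr0.
Qed.

Lemma iter_s23_0 k : iter k (@s23 V) (fun _ _ _ => 0) = fun _ _ _ => 0.
Proof.
elim: k => //= k ->; apply: funext3 => p q r.
by rewrite /s23 subr0.
Qed.

Section Triple.
Variables (A B C : V -> Prop) (c : V).
Hypothesis lc : lin psi c.
Hypothesis hAC : forall a, A a -> SL psi sA A C a c.
Hypothesis hBC : forall b c, B b -> C c -> lin psi b -> lin psi c -> compat psi b c.

Lemma triple_local_term h b (G : V -> lser (lser V)) : sA h -> B b -> lin psi b ->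
  Good psi sA A C G -> exists k0, forall k, (k0 <= k)%N ->
  exists2 G3, Good3 psi sA k A B C G3 & forall w p q r,
    iter k (@s23 V) (fun p q r => (h *: lm (psi b) (lm (@coef V r) (G w))) p q) p q r
    = G3 w p q r.
Proof.
move=> hh Bb lb; have bB := calEB lb; elim=> [|h' a' c' {}G hh' Aa Cc la' lc' _ [k1 IH]].
  exists 0%N => k _; exists (fun=> 0); first exact: Good30.
  move=> w p q r; rewrite (_ : (fun _ _ _ => _) = fun _ _ _ => 0) ?iter_s23_0//.
  apply: funext3 => x y z.
  rewrite (zmod_morph0 (lm_is_zmod_morphism (@coefB V z))).
  by rewrite (zmod_morph0 (lm_is_zmod_morphism bB)) scaler0.
have [k2 hk2] := hBC Bb Cc lb lc'; exists (maxn k1 k2) => k; rewrite geq_max => /andP[kk1 kk2].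
have hk := compatible_pairW kk2 hk2.
have [G3 hG3 e] := IH k kk1.
exists (fun w => eps12 h *: (eps13 h' *: lm (Cel psi k b c') (psi a' w)) + G3 w).
  exact: Good3S.
move=> w p q r; rewrite (_ : (fun _ _ _ => _) = add3
  (fun p q r => (h *: lm (psi b) (lm (@coef V r) (h' *: lm (psi c') (psi a' w)))) p q)
  (fun p q r => (h *: lm (psi b) (lm (@coef V r) (G w))) p q)).
  by rewrite iter_s23D /add3 e (iter_s23_Cel h h' (psi a' w) p q r lb lc' hk) lcoef3D.
apply: funext3 => x y z; rewrite /add3.
rewrite (zmod_morphD (lm_is_zmod_morphism (@coefB V z))).
by rewrite (zmod_morphD (lm_is_zmod_morphism bB)) scalerDr.
Qed.

(** In b(x2) a(x1) c(x3) the power (x1 - x3)^l exchanges a and c, and (x2 - x3)^k then makes b(x2)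
    c'(x3) a series. The new operators c' depend on l, so k is chosen after l. *)
Lemma triple_local (G : V -> lser (lser V)) : Good psi sA A B G ->
  exists l0, forall l, (l0 <= l)%N -> exists k0, forall k, (k0 <= k)%N ->
  exists2 G3, Good3 psi sA k A B C G3 & forall w p q r,
    iter k (@s23 V) (iter l (@s13 V) (fun p q r => G (psi c w r) p q)) p q r = G3 w p q r.
Proof.
elim=> [|h a b {}G hh Aa Bb la lb _ [l1 IH]].
  exists 0%N => l _; exists 0%N => k _; exists (fun=> 0); first exact: Good30.
  by move=> w p q r; rewrite iter_s13_0 iter_s23_0.
have [l2 hl2] := SL_large hA (hAC Aa).
exists (maxn l1 l2) => l; rewrite geq_max => /andP[ll1 ll2].
have [k1 IHk] := IH l ll1; have [G' hG' e'] := hl2 l ll2.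
have [k2 hk2] := triple_local_term hh Bb lb hG'.
exists (maxn k1 k2) => k; rewrite geq_max => /andP[kk1 kk2].
have [G3 hG3 e3] := IHk k kk1; have [G4 hG4 e4] := hk2 k kk2.
exists (fun w => G4 w + G3 w); first exact: Good3D.
move=> w p q r.
rewrite (_ : (fun _ _ _ => _) = add3
  (fun p q r => (h *: lm (psi b) (psi a (psi c w r))) p q)
  (fun p q r => G (psi c w r) p q))//.
rewrite iter_s13D iter_s23D {1}/add3 e3.
rewrite (_ : iter l _ _ = fun p q r => (h *: lm (psi b) (lm (@coef V r) (G' w))) p q).
  by rewrite e4 lcoef3D.
apply: funext3 => x y z.
rewrite (iter_s13_scale _ _ (fun r => psi a (psi c w r)) _ _ _ (calEB lb)).
set zz := iter l _ _ _; suff -> : zz = lm (@coef V z) (G' w) by [].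
by apply: lserP => n; rewrite /zz iter_colX lmE// /coef -e'.
Qed.

End Triple.

End RightProducts.

Section RightLocality.
Variables (K : comNzRingType) (V : lmodType K) (psi : V -> V -> lser V).
Variable sA : lser (lser K) -> Prop.
Hypothesis hA : coefficient_ring sA.
Implicit Types (A B C D : V -> Prop) (h : lser (lser K)).

Local Notation eps12 h := (lm (lm (@lconst K)) h).
Local Notation eps13 h := (lm (@lconst (lser K)) h).

Definition good_family A D (S : V -> lser (lser (lser V))) : Prop :=
  (forall w p, gtr (S w p)) /\ forall j : nat, Good psi sA A D (fun w => lm (sbL j) (S w)).

Lemma lm_sbLD j (s t : lser (lser (lser V))) :
  (forall p, gtr (s p)) -> (forall p, gtr (t p)) ->
  lm (sbL j) (s + t) = lm (sbL j) s + lm (sbL j) t.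
Proof.
move=> hs ht; apply: lserP => p; rewrite lcoefD !lmE0 ?sbL0//.
by rewrite (lcoefD s t) sbLD.
Qed.

Lemma good_familyD A D S S' : good_family A D S -> good_family A D S' ->
  good_family A D (fun w => S w + S' w).
Proof.
move=> [tS gS] [tS' gS']; split=> [w p|j]; first by rewrite lcoefD; exact: gtrD.
by apply: Good_ext (GoodD (gS j) (gS' j)) => w; rewrite lm_sbLD.
Qed.

Lemma lm_sbL_lD j (s : lser (lser (lser V))) : (forall p, gtr (s p)) ->
  lm (sbL j) (lm (@lD _) s) = lm (sbL (j + 1)) s *~ (j + 1).
Proof.
move=> hs; apply: lserP => p.
rewrite lcoefMz (lmE0 _ p (sbL0 _ j)) (lmE0 _ p (sbL0 _ (j + 1))).
by rewrite (lmE s p (@lDB _)) sbL_lD.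
Qed.

Lemma good_family_lD A D S : good_family A D S -> good_family A D (fun w => lm (@lD _) (S w)).
Proof.
move=> [tS gS]; split=> [w p|j].
  by rewrite lmE; [exact/gtr_lD|exact: lDB].
apply: Good_ext (Good_mulz hA (j%:Z + 1) (gS j.+1)) => w.
by rewrite lm_sbL_lD// -PoszD addn1.
Qed.

(** The factor h(t, x1, x3) does not involve x2, so it passes through the substitution. *)
Lemma good_family_eps13 A D h S : sA h -> good_family A D S ->
  good_family A D (fun w => eps13 h *: S w).
Proof.
move=> hh [tS gS].
have key w j : (forall p, gtr ((eps13 h *: S w) p)) /\
    lm (sbL j) (eps13 h *: S w) = h *: lm (sbL j) (S w).
  have [||t e] := @lm_scale_on _ _ _ _ (fun r : lser (lser K) => exists g, r = lconst g)
    (@gtr _ V) (@coef _ 0) (@sbL _ V j) (eps13 h) (S w) (@coefB _ 0) (@gtr0 _ V)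
    (@gtrD _ V) (@sbL0 _ V j) (@sbLD _ V j) _ (tS w).
  - by move=> n; exists (h n); rewrite lmE//; exact: lconstB.
  - move=> _ x [g ->] hx; split; first exact: gtr_lconst.
    by rewrite sbL_lconst// /coef lconstE eqxx.
  split=> //; rewrite e; suff -> : lm (@coef _ 0) (eps13 h) = h by [].
  apply: lserP => n; rewrite !lmE//; last exact: lconstB.
  by rewrite /coef lconstE eqxx.
split=> [w p|j]; first by have [] := key w 0.
by apply: Good_ext (Good_scale hA hh (gS j)) => w; have [_ ->] := key w j.
Qed.

Lemma gtr_eps12 h (s : lser (lser (lser V))) : (forall p, gtr (s p)) ->
  (forall p, gtr ((eps12 h *: s) p)) /\ lm (sbL 0) (eps12 h *: s) = h *: lm (sbL 0) s.
Proof.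
move=> hs.
have [||t e] := @lm_scale_on _ _ _ _ (fun r : lser (lser K) => exists g, r = lm (@lconst K) g)
    (@gtr _ V) (@lm _ _ (@coef _ 0)) (@sbL _ V 0) (eps12 h) s
    (lm_is_zmod_morphism (@coefB _ 0)) (@gtr0 _ V)
    (@gtrD _ V) (@sbL0 _ V 0) (@sbLD _ V 0) _ hs.
- by move=> n; exists (h n); rewrite lmE//; exact/lm_is_zmod_morphism/lconstB.
- move=> _ x [g ->] hx; split; first exact: gtr_lm_lconst.
  rewrite sbL_lm_lconst//; suff -> : lm (@coef _ 0) (lm (@lconst K) g) = g by [].
  apply: lserP => n; rewrite !lmE//; last exact: lconstB.
  by rewrite /coef lconstE eqxx.
split=> //; rewrite e; suff -> : lm (lm (@coef _ 0)) (eps12 h) = h by [].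
apply: lserP => n; rewrite !lmE; [|exact/lm_is_zmod_morphism/lconstB|
  exact/lm_is_zmod_morphism/coefB].
apply: lserP => m; rewrite !lmE//; last exact: lconstB.
by rewrite /coef lconstE eqxx.
Qed.

Lemma lD_eps12 h (s : lser (lser (lser V))) :
  lm (@lD _) (eps12 h *: s) = eps12 (lm (@lD K) h) *: s + eps12 h *: lm (@lD _) s.
Proof.
rewrite (@lm_deriv (lser (lser K)) _ (@lD _) (@lD _)).
- suff -> : lm (@lD _) (eps12 h) = eps12 (lm (@lD K) h) by [].
  have cB := lm_is_zmod_morphism (@lconstB K).
  apply: lserP => n; rewrite (lmE _ n (@lDB _)) (lmE h n cB) (lmE _ n cB) (lmE h n (@lDB K)).
  apply: lserP => m; rewrite lDE (lmE (h n) _ (@lconstB K)) (lmE (lD (h n)) m (@lconstB K)).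
  by rewrite lDE (zmod_morphMz (@lconstB K)).
- exact: lDB.
- exact: lDB.
- exact: lD_scale.
Qed.

(* Induction on the order of the derivative, since d/dx2 moves it by one. *)
Lemma good_family_eps12 A D h S : sA h -> good_family A D S ->
  good_family A D (fun w => eps12 h *: S w).
Proof.
move=> hh hS; split=> [w p|j]; first exact: (gtr_eps12 h (hS.1 w)).1.
elim: j h S hh hS => [|j IH] h S hh hS.
  apply: Good_ext (Good_scale hA hh (hS.2 0%N)) => w.
  by rewrite (gtr_eps12 h (hS.1 w)).2.
apply: (Good_div hA (n := j)).
have h1 := IH _ _ (sA_d2 hA hh) hS; have h2 := IH _ _ hh (good_family_lD hS).
apply: Good_ext (GoodD h1 h2) => w /=.
have tD p : gtr (lm (@lD _) (S w) p) by have [] := good_family_lD hS.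
rewrite -lm_sbLD; [|exact: (gtr_eps12 _ (hS.1 w)).1|exact: (gtr_eps12 _ tD).1].
rewrite -lD_eps12 lm_sbL_lD; last exact: (gtr_eps12 h (hS.1 w)).1.
by rewrite -PoszD addn1.
Qed.

Definition products_in B C D : Prop := forall b c n, B b -> C c -> lin psi b -> lin psi c ->
  D (mode (psi b) n c) /\ psi (mode (psi b) n c) = nprod (psi b) n (psi c).

Lemma sbL_Cel k b c (j : int) w : compatible_pair k (psi b) (psi c) ->
  sbL j (Cel psi k b c w) = nprod (psi b) (k%:Z - j - 1) (psi c) w.
Proof.
move=> hk; apply: lserP => m; rewrite sbLE; last exact/gtr_mk2/hk.
rewrite (nprodE _ _ _ hk) (SubE _ _ (hk w)).
rewrite (_ : k%:Z + (- (k%:Z - j - 1) - 1) = j); last by lia.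
have -> // : (fun m n => Cel psi k b c w m n) = iter k (@mul_sub V) (prod2 (psi b) (psi c) w).
by apply: funext2 => x y; rewrite CelE.
Qed.

(** The Taylor coefficients of (x2 - x3)^k b(x2) c(x3) are the products of b and c, by [sbL_Cel],
    and these are operators of vectors in [D]. *)
Lemma Good3_family k A B C D G : products_in B C D ->
  Good3 psi sA k A B C G -> good_family A D G.
Proof.
move=> hD; elim=> [|h h' a b c {}G hh hh' Aa Bb Cc la lb lc hk _ IH].
  split=> [w p|j]; first exact: gtr0.
  apply: Good_ext (Good0 psi sA A D) => w.
  by apply: lserP => p; rewrite lmE0 ?sbL0.
apply: good_familyD IH; apply: good_family_eps12 => //; apply: good_family_eps13 => //.
have CB := CelB lb lc hk.
split=> [w p|j]; first by rewrite lmE//; exact/gtr_mk2/hk.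
have [Dbc e] := hD b c (k%:Z - j%:Z - 1) Bb Cc lb lc.
have lbc : lin psi (mode (psi b) (k%:Z - j%:Z - 1) c).
  by rewrite /lin e; exact: calE_nprod hk.
apply: Good_ext (Good1 hA Aa Dbc la lbc) => w.
apply: lserP => p; rewrite (lmE0 _ p (sbL0 _ j)) (lmE _ p CB) (lmE _ p (calEB lbc)).
by rewrite sbL_Cel// e.
Qed.

(** Dong's argument: u(x1) b(x2) c(x3) is multiplied by powers of the three differences, u is moved
    to the right, and x2 = x3 + y. The power of x1 - x3 stays in the relation, (x2 - x3)^k only
    shifts the index, and (x1 - x2)^l12 is removed by [unlocal]. *)
Lemma SL_right A B C D u b c m : lin psi u -> lin psi b -> lin psi c -> B b -> C c ->
  (forall a, A a -> SL psi sA A C a c) ->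
  (forall b c, B b -> C c -> lin psi b -> lin psi c -> compat psi b c) ->
  products_in B C D ->
  SL psi sA A B u b -> SL psi sA A D u (mode (psi b) m c).
Proof.
move=> lu lb lc Bb Cc hAC hBC hD [l12 [G hG e12]].
have [l0 hl] := triple_local hA hAC hBC hG.
have [k0 hk0] := hl l0 (leqnn _); have [kbc hkbc] := hBC b c Bb Cc lb lc.
have [G3 hG3 e3] := hk0 (maxn k0 kbc) (leq_maxl _ _).
move: hG3 e3; set k := maxn k0 kbc => hG3 e3.
have hk : compatible_pair k (psi b) (psi c) := compatible_pairW (leq_maxr _ _) hkbc.
have [_ e] := hD b c m Bb Cc lb lc.
have uB := calEB lu.
(* For m >= k the product is 0; otherwise it is the coefficient of y^(k - m - 1). *)
have [km|mk] := leP k%:Z m.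
  exists 0%N; exists (fun=> 0); first exact: Good0.
  move=> w x y /=; rewrite /prod2 e (nprod_large hk)//.
  by rewrite (zmod_morph0 uB).
pose T w := triple (psi u) (psi b) (psi c) w.
pose rho l j w := sb23 (iter l (@s12 V) (iter k (@s23 V) (T w))) j.
have tZ w : forall p, trunc2 (iter k (@s23 V) (T w) p) by move=> p; exact: trunc2_Z.
have rho0 w : rho 0%N (k%:Z - m - 1) w = prod2 (psi u) (psi (mode (psi b) m c)) w.
  by rewrite /rho /T R0E// e (_ : k%:Z - (k%:Z - m - 1) - 1 = m)//; lia.
suff [M [G' hG' e']] : exists M, GoodF psi sA A D
    (fun w => iter M (@mul_sub V) (rho 0%N (k%:Z - m - 1) w)).
  by exists M; exists G' => // w x y; rewrite -rho0 e'.
have good3 := Good3_family hD hG3.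
have hrel l j w : mul_sub (rho l j w) = add2 (rho l.+1 j w) (rho l (j - 1) w).
  rewrite /rho iterS sb23_s12; last exact/trunc2_iter_s12/tZ.
  by apply: funext2 => x y; rewrite /add2 /opp2 subrK.
apply: (@unlocal _ _ _ _ hA A D rho id hrel _ _ _ l12) => // [l j w j0|j].
  by apply: funext2 => x y; rewrite /rho /sb23 sb_neg.
have eG w : iter k (@s23 V) (iter l0 (@s13 V) (iter l12 (@s12 V) (T w))) =
    fun p q r => G3 w p q r.
  apply: funext3 => x y z; rewrite -e3.
  suff -> : iter l12 (@s12 V) (T w) = fun p q r => G (psi c w r) p q by [].
  apply: funext3 => x' y' z'.
  by rewrite /T iter_s12_triple e12.
exists l0; case: j => [j|j]; last first.
  exists (fun=> 0); first exact: Good0.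
  move=> w x y; rewrite -sb23_iter_s13 ?/sb23 ?sb_neg//.
  exact/trunc2_iter_s12/tZ.
exists (fun w => lm (sbL j) (G3 w)); first exact: good3.2.
move=> w x y; rewrite /rho -sb23_iter_s13; last exact/trunc2_iter_s12/tZ.
rewrite (iter_comm _ _ _ (@s12_s23 V)) (iter_comm _ _ _ (@s13_s23 V)) eG.
by rewrite (lmE0 _ x (sbL0 _ j)) sbLE//; exact: good3.1.
Qed.

End RightLocality.

(** * Locality of a product u(x)_m a(x) with b(x) *)

Section LeftLocality.
Variables (K : comNzRingType) (V : lmodType K) (psi : V -> V -> lser V).
Variable sA : lser (lser K) -> Prop.
Hypothesis hA : coefficient_ring sA.
Implicit Types (A B C : V -> Prop) (h : lser (lser K)).

Local Notation eps13 h := (lm (@lconst (lser K)) h).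

Lemma lm_addf (M N : zmodType) (f g : M -> N) (s : lser M) : f 0 = 0 -> g 0 = 0 ->
  lm (fun x => f x + g x) s = lm f s + lm g s.
Proof.
move=> f0 g0; apply: lserP => n; rewrite lcoefD (lmE0 _ n f0) (lmE0 _ n g0) lmE0//.
by rewrite f0 g0 addr0.
Qed.

Lemma Good_at0 A B G : Good psi sA A B G -> G 0 = 0.
Proof.
elim=> // h u v {}G _ _ _ lu lv _ ->.
rewrite (zmod_morph0 (calEB lu)) (zmod_morph0 (lm_is_zmod_morphism (calEB lv))).
by rewrite scaler0 addr0.
Qed.

(** Multiplication by x1 - x3 with the exponent p of x1 as index. The argument v stays free because
    it will run over the coefficients of a(x2) w; [rowX] is the analogue for x1 - x2. *)
Definition rowY (y : int -> V -> lser V) (p : int) (v : V) : lser V :=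
  y (p - 1) v - lX K *: y p v.

Lemma rowYE y p v r : rowY y p v r = y (p - 1) v r - y p v (r - 1).
Proof. by rewrite /rowY lcoefD lcoefN (lX_scale (y p v)). Qed.

Lemma iter_rowYE l y p v r :
  iter l rowY y p v r = iter l (@mul_sub V) (fun p r => y p v r) p r.
Proof. by elim: l p r => // l IH p r; rewrite !iterS rowYE !IH. Qed.

Lemma rowYB y : (forall p, zmod_morphism (y p)) -> forall p, zmod_morphism (rowY y p).
Proof.
move=> yB p u v; rewrite /rowY !yB scalerBr opprB [in RHS]opprB addrACA [RHS]addrACA.
by congr (_ + _); rewrite addrC.
Qed.

Lemma iter_rowYB l y : (forall p, zmod_morphism (y p)) ->
  forall p, zmod_morphism (iter l rowY y p).
Proof. by move=> yB; elim: l => // l IH p; rewrite iterS; exact: rowYB. Qed.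

Lemma iter_s13_row l h (y : int -> V -> lser V) (t : lser V) p q r :
  (forall p, zmod_morphism (y p)) ->
  iter l (@s13 V) (fun p q r => (h *: lm (y p) t) q r) p q r =
  (h *: lm (iter l rowY y p) t) q r.
Proof.
move=> yB; have -> : iter l (@s13 V) (fun p q r => (h *: lm (y p) t) q r) =
    fun p q r => (h *: lm (iter l rowY y p) t) q r; last by [].
elim: l => // l IH; rewrite !iterS IH.
apply: funext3 => {}p {}q {}r.
set x := iter l rowY y; have xB := iter_rowYB l yB.
have -> : lm (rowY x p) t = lm (x (p - 1)) t - lconst (lX K) *: lm (x p) t.
  apply: lserP => n; rewrite (lmE t n (rowYB xB p)) lcoefD lcoefN.
  by rewrite (lmE t n (xB (p - 1))) (lconst_scale (lX K) (lm (x p) t)) (lmE t n (xB p)).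
rewrite scalerBr lcoef2B (scalerAC h (lconst _)).
by rewrite (lconst_scale (lX K) (h *: lm (x p) t)) (lX_scale ((h *: lm (x p) t) q)).
Qed.

Definition rowX (x : int -> lser (lser V)) (p : int) : lser (lser V) :=
  x (p - 1) - lX (lser K) *: x p.

Lemma rowXE x p q : rowX x p q = x (p - 1) q - x p (q - 1).
Proof. by rewrite /rowX lcoefD lcoefN (lX_scale (x p)). Qed.

Lemma iter_rowXE l x p q :
  iter l rowX x p q = iter l (@mul_sub (lser V)) (fun p q => x p q) p q.
Proof. by elim: l p q => // l IH p q; rewrite !iterS rowXE !IH. Qed.

Lemma iter_s12_row l h (x : int -> lser (lser V)) p q r :
  iter l (@s12 V) (fun p q r => (h *: x p) q r) p q r = (h *: iter l rowX x p) q r.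
Proof.
have -> : iter l (@s12 V) (fun p q r => (h *: x p) q r) =
    fun p q r => (h *: iter l rowX x p) q r; last by [].
elim: l => // l IH; rewrite !iterS IH.
apply: funext3 => {}p {}q {}r.
rewrite /rowX scalerBr lcoef2B (scalerAC h (lX _)).
by rewrite (lX_scale (h *: iter l rowX x p)).
Qed.

Lemma iter_mul_sub_colX (R : comNzRingType) (M : lmodType R) l (g : lser R)
    (z : int -> lser M) p q :
  iter l (@mul_sub M) (fun p q => (g *: z q) p) p q =
  (g *: iter l (@colX R M) z q) p.
Proof.
elim: l p q => // l IH p q; rewrite !iterS /mul_sub !IH /colX scalerBr lcoefD lcoefN.
by rewrite (scalerAC g (lX _)) (lX_scale (g *: iter l (@colX R M) z q)).
Qed.

Lemma iter_s12_Cel k h h' b u (t : lser V) p q r : calE b -> calE u ->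
  trunc2 (iter k (@mul_sub V) (fun p q => u (t q) p)) ->
  iter k (@s12 V) (fun p q r => (h *: lm (fun v => (h' *: lm b (u v)) p) t) q r) p q r =
  (lconst h *: (eps13 h' *:
     lm (lm b) (mk2 (iter k (@mul_sub V) (fun p q => u (t q) p))))) p q r.
Proof.
move=> hb hu tk; have bB := calEB hb; have uB := calEB hu.
have lbB := lm_is_zmod_morphism bB.
rewrite (iter_s12_row k h (fun p => lm (fun v => (h' *: lm b (u v)) p) t)).
set C := mk2 _; set S := (eps13 h' *: _).
rewrite (lconst_scale h S).
suff -> : iter k rowX (fun p => lm (fun v => (h' *: lm b (u v)) p) t) p = S p by [].
apply: lserP => {}q; rewrite iter_rowXE /S lm_lconst_scale.
have -> : (fun p q => lm (fun v => (h' *: lm b (u v)) p) t q) =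
    fun p q => (h' *: lm b (u (t q))) p.
  apply: funext2 => x y; rewrite lmE// => v v'.
  by rewrite uB lbB scalerBr.
rewrite (iter_mul_sub_colX k h' (fun q => lm b (u (t q)))) lscaleE_isum.
apply: eq_isum => i; rewrite iter_colX (lmE C _ lbB) (lmE (C (p - i)) q bB).
have e : (fun p q => lm b (u (t q)) p) = fun p q => b (u (t q) p).
  by apply: funext2 => x y; rewrite lmE.
by rewrite e (iter_mul_sub_morph k _ (p - i) q bB) /C mk2E.
Qed.

(* Sums of h(t, x2, x3) h'(t, x1, x3) times (x1 - x2)^k b(x3) u(x1) a(x2) *)
Inductive Good4 k A1 A2 B : (V -> lser (lser (lser V))) -> Prop :=
| Good40 : Good4 k A1 A2 B (fun=> 0)
| Good4S h h' u a b G : sA h -> sA h' -> A1 u -> A2 a -> B b ->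
    lin psi u -> lin psi a -> lin psi b -> compatible_pair k (psi u) (psi a) ->
    Good4 k A1 A2 B G ->
    Good4 k A1 A2 B (fun w => lconst h *: (eps13 h' *:
      lm (lm (psi b)) (Cel psi k u a w)) + G w).

Lemma Good4_ext k A1 A2 B G G' : G =1 G' -> Good4 k A1 A2 B G -> Good4 k A1 A2 B G'.
Proof. by move=> /funext->. Qed.

Lemma Good4D k A1 A2 B G G' : Good4 k A1 A2 B G -> Good4 k A1 A2 B G' ->
  Good4 k A1 A2 B (fun w => G w + G' w).
Proof.
move=> hG hG'; elim: hG => [|h h' u a b {}G hh hh' Au Aa Bb lu la lb hk _ IH].
  by apply: Good4_ext hG' => w; rewrite add0r.
by apply: Good4_ext (Good4S hh hh' Au Aa Bb lu la lb hk IH) => w; rewrite addrA.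
Qed.

Lemma iter_s12D k P Q :
  iter k (@s12 V) (add3 P Q) = add3 (iter k (@s12 V) P) (iter k (@s12 V) Q).
Proof.
elim: k => //= k ->; apply: funext3 => p q r.
by rewrite /s12 /add3 opprD addrACA.
Qed.

Lemma iter_s12_0 k : iter k (@s12 V) (fun _ _ _ => 0) = fun _ _ _ => 0.
Proof.
elim: k => //= k ->; apply: funext3 => p q r.
by rewrite /s12 subr0.
Qed.

Section Triple.
Variables (A1 A2 B B2 : V -> Prop) (u : V).
Hypothesis lu : lin psi u.
Hypothesis huB : forall b, B b -> SL psi sA A1 B2 u b.
Hypothesis hAA : forall u a, A1 u -> A2 a -> lin psi u -> lin psi a -> compat psi u a.

Lemma left_triple_term h a (G : V -> lser (lser V)) : sA h -> A2 a -> lin psi a ->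
  Good psi sA A1 B2 G -> exists k0, forall k, (k0 <= k)%N ->
  exists2 G4, Good4 k A1 A2 B2 G4 & forall w p q r,
    iter k (@s12 V) (fun p q r => (h *: lm (fun v => G v p) (psi a w)) q r) p q r = G4 w p q r.
Proof.
move=> hh Aa la; elim=> [|h' u' b {}G hh' Au Bb lu' lb hG [k1 IH]].
  exists 0%N => k _; exists (fun=> 0); first exact: Good40.
  move=> w p q r; rewrite (_ : (fun _ _ _ => _) = fun _ _ _ => 0) ?iter_s12_0//.
  apply: funext3 => x y z.
  suff -> : lm (fun=> (0 : lser (lser V)) x) (psi a w) = 0 by rewrite scaler0.
  by apply: lserP => n; rewrite lmE0.
have [k2 hk2] := hAA Au Aa lu' la; exists (maxn k1 k2) => k; rewrite geq_max => /andP[kk1 kk2].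
have hk := compatible_pairW kk2 hk2.
have [G4 hG4 e] := IH k kk1.
exists (fun w => lconst h *: (eps13 h' *: lm (lm (psi b)) (Cel psi k u' a w)) + G4 w).
  exact: Good4S.
move=> w p q r; rewrite (_ : (fun _ _ _ => _) = add3
  (fun p q r => (h *: lm (fun v => (h' *: lm (psi b) (psi u' v)) p) (psi a w)) q r)
  (fun p q r => (h *: lm (fun v => G v p) (psi a w)) q r)).
  by rewrite iter_s12D /add3 e (iter_s12_Cel h h' p q r lb lu' (hk w)) lcoef3D.
apply: funext3 => x y z; rewrite /add3.
rewrite -lcoef2D -scalerDr -lm_addf//.
  rewrite (zmod_morph0 (calEB lu')) (zmod_morph0 (lm_is_zmod_morphism (calEB lb))).
  by rewrite scaler0.
by rewrite (Good_at0 hG).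
Qed.

(** In u(x1) b(x3) a(x2) the power (x1 - x3)^l exchanges u and b, and (x1 - x2)^k then makes u'(x1)
    a(x2) a series. The coefficient h(t, x2, x3) passes through u(x1) by K-linearity. *)
Lemma left_triple (G : V -> lser (lser V)) : Good psi sA A2 B G ->
  exists l0, forall l, (l0 <= l)%N -> exists k0, forall k, (k0 <= k)%N ->
  exists2 G4, Good4 k A1 A2 B2 G4 & forall w p q r,
    iter k (@s12 V) (iter l (@s13 V) (fun p q r => psi u (G w q r) p)) p q r = G4 w p q r.
Proof.
have uB := calEB lu.
elim=> [|h a b {}G hh Aa Bb la lb _ [l1 IH]].
  exists 0%N => l _; exists 0%N => k _; exists (fun=> 0); first exact: Good40.
  move=> w p q r; rewrite (_ : (fun _ _ _ => _) = fun _ _ _ => 0) ?iter_s13_0 ?iter_s12_0//.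
  by apply: funext3 => x y z; rewrite (zmod_morph0 uB).
have [l2 hl2] := SL_large hA (huB Bb).
exists (maxn l1 l2) => l; rewrite geq_max => /andP[ll1 ll2].
have [k1 IHk] := IH l ll1; have [G' hG' e'] := hl2 l ll2.
have [k2 hk2] := left_triple_term hh Aa la hG'.
exists (maxn k1 k2) => k; rewrite geq_max => /andP[kk1 kk2].
have [G3 hG3 e3] := IHk k kk1; have [G4 hG4 e4] := hk2 k kk2.
exists (fun w => G4 w + G3 w); first exact: Good4D.
move=> w p q r.
pose y p v := lm (fun x => psi u x p) (psi b v).
have upB x : zmod_morphism (fun v => psi u v x) by move=> v v'; rewrite uB.
have yB x : zmod_morphism (y x).
  by move=> v v'; rewrite /y (calEB lb) (lm_is_zmod_morphism (upB x)).
rewrite (_ : (fun _ _ _ => _) = add3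
  (fun p q r => (h *: lm (y p) (psi a w)) q r)
  (fun p q r => psi u (G w q r) p)).
  rewrite iter_s13D iter_s12D {1}/add3 e3.
  rewrite (_ : iter l _ _ = fun p q r => (h *: lm (fun v => G' v p) (psi a w)) q r).
    by rewrite e4 lcoef3D.
  apply: funext3 => x z t.
  rewrite (iter_s13_row l h (psi a w) x z t yB).
  suff -> : iter l rowY y x = fun v => G' v x by [].
  apply/funext => v; apply: lserP => n; rewrite iter_rowYE -e'.
  congr (iter l _ _ x n); apply: funext2 => x' n'.
  by rewrite /y lmE.
apply: funext3 => x z t; rewrite /add3 lcoef2D.
rewrite (zmod_morphD (upB x)); congr (_ + _).
have lpB := lm_is_zmod_morphism (upB x).
have -> : lm (y x) (psi a w) = lm (lm (fun v => psi u v x)) (lm (psi b) (psi a w)).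
  by apply: lserP => n; rewrite (lmE _ n (yB x)) (lmE _ n lpB) (lmE _ n (calEB lb)).
have := @lm_scaleT _ _ _ _ id (lm (fun v => psi u v x)) h (lm (psi b) (psi a w)) _ lpB.
rewrite (_ : lm id h = h); last by apply: lserP => n; rewrite lmE.
move=> <-//; last by move=> g s; rewrite lm_coefZ.
by rewrite (lmE _ z lpB) (lmE _ t (upB x)).
Qed.

End Triple.

End LeftLocality.

Section LeftLocalityConclusion.
Variables (K : comNzRingType) (V : lmodType K) (psi : V -> V -> lser V).
Variable sA : lser (lser K) -> Prop.
Hypothesis hA : coefficient_ring sA.
Implicit Types (B D : V -> Prop) (h : lser (lser K)).

Local Notation eps13 h := (lm (@lconst (lser K)) h).

(** Counterpart of [good_family] for x1 = x2 + y, which concerns the two outer variables of the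
    nested series. *)
Definition left_family D B (S : V -> lser (lser (lser V))) : Prop :=
  (forall w, gtr (S w)) /\ forall j : nat, Good psi sA D B (fun w => sbL j (S w)).

Lemma left_familyD D B S S' : left_family D B S -> left_family D B S' ->
  left_family D B (fun w => S w + S' w).
Proof.
move=> [tS gS] [tS' gS']; split=> [w|j]; first exact: gtrD.
by apply: Good_ext (GoodD (gS j) (gS' j)) => w; rewrite sbLD.
Qed.

Lemma left_family_lD D B S : left_family D B S -> left_family D B (fun w => lD (S w)).
Proof.
move=> [tS gS]; split=> [w|j]; first exact: gtr_lD.
apply: Good_ext (Good_mulz hA (j%:Z + 1) (gS j.+1)) => w.
by rewrite sbL_lD// -PoszD addn1.
Qed.

Lemma left_family_lconst D B h S : sA h -> left_family D B S ->
  left_family D B (fun w => lconst h *: S w).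
Proof.
move=> hh [tS gS]; split=> [w|j]; first exact: gtr_lconst.
by apply: Good_ext (Good_scale hA hh (gS j)) => w; rewrite sbL_lconst.
Qed.

(** Here h(t, x1, x3) does depend on x1. By the Leibniz rule d/dx1 falls on h or on S, so the
    induction on j lets both vary. *)
Lemma left_family_eps13 D B h S : sA h -> left_family D B S ->
  left_family D B (fun w => eps13 h *: S w).
Proof.
move=> hh hS; split=> [w|j]; first exact/gtr_lm_lconst/hS.1.
elim: j h S hh hS => [|j IH] h S hh hS.
  apply: Good_ext (Good_scale hA hh (hS.2 0%N)) => w.
  by rewrite sbL_lm_lconst//; exact: hS.1.
apply: (Good_div hA (n := j)).
have h1 := IH _ _ (sA_d1 hA hh) hS; have h2 := IH _ _ hh (left_family_lD hS).
apply: Good_ext (GoodD h1 h2) => w /=.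
have tS := hS.1 w; have tD := (left_family_lD hS).1 w.
rewrite -sbLD; [|exact: gtr_lm_lconst|exact: gtr_lm_lconst].
rewrite -lD_lm_lconst_scale sbL_lD; last exact: gtr_lm_lconst.
by rewrite -PoszD addn1.
Qed.

Lemma gtr_lm_lm (M : lmodType K) (b : M -> lser M) (s : lser (lser M)) : zmod_morphism b ->
  gtr s -> @gtr (lser K) (lser M) (lm (lm b) s).
Proof.
move=> bB [N hN]; exists N => m n mn.
rewrite (lmE s m (lm_is_zmod_morphism bB)) (lmE (s m) n bB) hN//.
exact: (zmod_morph0 bB).
Qed.

Lemma sbL_lm_lm (M : lmodType K) j (b : M -> lser M) (s : lser (lser M)) :
  zmod_morphism b -> gtr s -> sbL j (lm (lm b) s : lser (lser (lser M))) = lm b (sbL j s).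
Proof.
move=> bB hs; have lB := lm_is_zmod_morphism bB; have tb := gtr_lm_lm bB hs.
apply: lserP => m; rewrite (@sbLE (lser K) _ j _ m tb) (lmE _ m bB) sbLE//.
rewrite !sbE (isum_raddf bB); last exact: (sb_fin_supp _ _ hs).
apply: eq_isum => p; rewrite (zmod_morphMz bB).
by rewrite (lmE s p lB) (lmE (s p) _ bB).
Qed.

Lemma Good4_family k A1 A2 B D G : products_in psi A1 A2 D ->
  Good4 psi sA k A1 A2 B G -> left_family D B G.
Proof.
move=> hD; elim=> [|h h' u a b {}G hh hh' Au Aa Bb lu la lb hk _ IH].
  split=> [w|j]; first exact: gtr0.
  by apply: Good_ext (Good0 psi sA D B) => w; rewrite sbL0.
apply: left_familyD IH; apply: left_family_lconst => //; apply: left_family_eps13 => //.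
have bB := calEB lb.
have tC w : gtr (Cel psi k u a w) by exact/gtr_mk2/hk.
split=> [w|j]; first exact: gtr_lm_lm.
have [Dua e] := hD u a (k%:Z - j%:Z - 1) Au Aa lu la.
have lua : lin psi (mode (psi u) (k%:Z - j%:Z - 1) a).
  by rewrite /lin e; exact: calE_nprod hk.
apply: Good_ext (Good1 hA Dua Bb lua lb) => w.
by rewrite (sbL_lm_lm j bB (tC w)) sbL_Cel// e.
Qed.

(** Mirror image of [SL_right]: a and b are exchanged first, x1 = x2 + y is substituted, (x2 -
    x3)^l23 stays in the relation and (x1 - x3)^l0 is removed by [unlocal]. *)
Lemma SL_left A1 A2 B B2 D u a b m : lin psi u -> lin psi a -> A1 u -> A2 a ->
  (forall b, B b -> SL psi sA A1 B2 u b) ->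
  (forall u a, A1 u -> A2 a -> lin psi u -> lin psi a -> compat psi u a) ->
  products_in psi A1 A2 D ->
  SL psi sA A2 B a b -> SL psi sA D B2 (mode (psi u) m a) b.
Proof.
move=> lu la Au Aa huB hAA hD [l23 [G hG e23]].
have uB := calEB lu.
have [l0 hl] := left_triple hA lu huB hAA hG.
have [k0 hk0] := hl l0 (leqnn _); have [kua hkua] := hAA u a Au Aa lu la.
have [G4 hG4 e4] := hk0 (maxn k0 kua) (leq_maxl _ _).
move: hG4 e4; set k := maxn k0 kua => hG4 e4.
have hk : compatible_pair k (psi u) (psi a) := compatible_pairW (leq_maxr _ _) hkua.
have [_ e] := hD u a m Au Aa lu la.
have [km|mk] := leP k%:Z m.
  exists 0%N; exists (fun=> 0); first exact: Good0.
  by move=> w x y /=; rewrite /prod2 e (nprod_large hk).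
pose T w := triple (psi u) (psi a) (psi b) w.
pose rho l j w := sb12 (iter l (@s13 V) (iter k (@s12 V) (T w))) j.
have tY w : forall r, trunc2 (fun p q => iter k (@s12 V) (T w) p q r).
  by move=> r; exact: trunc2_Y.
have rho0 w : rho 0%N (k%:Z - m - 1) w = prod2 (psi (mode (psi u) m a)) (psi b) w.
  by rewrite /rho /T S0E// e (_ : k%:Z - (k%:Z - m - 1) - 1 = m)//; lia.
suff [M [G' hG' e']] : exists M, GoodF psi sA D B2
    (fun w => iter M (@mul_sub V) (rho 0%N (k%:Z - m - 1) w)).
  by exists M; exists G' => // w x y; rewrite -rho0 e'.
have good4 := Good4_family hD hG4.
have hrel l j w : mul_sub (rho l j w) = add2 (rho l.+1 j w) (opp2 (rho l (j - 1) w)).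
  rewrite /rho iterS sb12_s13; last exact/trunc2_iter_s13'/tY.
  by apply: funext2 => x y; rewrite /add2 /opp2 addrK.
(* The sign [opp2] comes from x1 - x3 = (x2 - x3) + y. *)
apply: (@unlocal _ _ _ _ hA D B2 rho (@opp2 V) hrel _ _ _ l0) => // [g|k' x|l j w j0|j].
- exact: GoodFN.
- exact: iter_mul_subN.
- by apply: funext2 => x y; rewrite /rho /sb12 sb_neg.
have eG w : iter k (@s12 V) (iter l0 (@s13 V) (iter l23 (@s23 V) (T w))) =
    fun p q r => G4 w p q r.
  apply: funext3 => x y z; rewrite -e4.
  suff -> : iter l23 (@s23 V) (T w) = fun p q r => psi u (G w q r) p by [].
  apply: funext3 => x' y' z'.
  by rewrite /T iter_s23_triple// e23.
have eS w j' : iter l23 (@mul_sub V) (rho l0 j' w) = sb12 (fun p q r => G4 w p q r) j'.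
  rewrite /rho -sb12_iter_s23; last exact/trunc2_iter_s13'/tY.
  rewrite -(iter_comm _ _ _ (@s13_s23 V)) -(iter_comm _ _ _ (@s12_s23 V)).
  by rewrite -(iter_comm _ _ _ (@s12_s13 V)) eG.
exists l23; case: j => [j|j]; last first.
  exists (fun=> 0); first exact: Good0.
  by move=> w x y; rewrite eS /sb12 sb_neg.
exists (fun w => sbL j (G4 w)); first exact: good4.2.
move=> w x y; rewrite eS /sb12; have tG := good4.1 w.
rewrite (@sbLE (lser K) _ j _ x tG) !sbE lcoef_isum; last exact: (sb_fin_supp _ _ tG).
by apply: eq_isum => p; rewrite lcoefMz.
Qed.

End LeftLocalityConclusion.

(** * Locality of all the vertex operators *)

(** The hypotheses in the form used below, with [psi] in place of [Y0] on [U]. Here [tau f] stands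
    for f(t + x), [vd_tau_tau] compares coefficients in f(t + x + x0), and [vd_ind] expresses
    spanning by words. *)
Record vertex_data (K : comNzRingType) (V : lmodType K) (psi : V -> V -> lser V)
    (sA : lser (lser K) -> Prop) (U : V -> Prop) (vac : V) (tau : K -> lser K) : Prop := {
  vd_coef : coefficient_ring sA;
  vd_tf : torsion_free V;
  vd_add : forall u v, psi (u + v) = psi u + psi v;
  vd_scale : forall f v, psi (f *: v) = tau f *: psi v;
  vd_vac : psi vac = @lconst V;
  vd_mode : forall u n v, U u -> psi (mode (psi u) n v) = nprod (psi u) n (psi v);
  vd_lin : forall u, U u -> lin psi u;
  vd_loc : forall u v, U u -> U v -> SL psi sA U U u v;
  vd_ind : forall Pr : V -> Prop, Pr 0 -> Pr vac ->
    (forall f v v', Pr v -> Pr v' -> Pr (f *: v + v')) ->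
    (forall u n v, U u -> Pr v -> Pr (mode (psi u) n v)) -> forall v, Pr v;
  vd_tau : forall f n, n < 0 -> tau f n = 0;
  vd_tau0 : forall f, tau f 0 = f;
  vd_tau_tau : forall f i m, tau (tau f i) m = tau f (m + i) *~ bz (m + i) i;
  vd_creation : forall u, U u -> (forall n, n < 0 -> psi u vac n = 0) /\ psi u vac 0 = u;
  vd_nneg : forall h, sA h -> forall i j, (i < 0) || (j < 0) -> h i j = 0 }.

Section AllLocal.
Variables (K : comNzRingType) (V : lmodType K) (psi : V -> V -> lser V).
Variables (sA : lser (lser K) -> Prop) (U : V -> Prop) (vac : V) (tau : K -> lser K).
Hypothesis hV : vertex_data psi sA U vac tau.
Let hA := vd_coef hV.
Implicit Types (A B D : V -> Prop).

Lemma psi_comb f v v' : psi (f *: v + v') = tau f *: psi v + psi v'.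
Proof. by rewrite (vd_add hV) (vd_scale hV). Qed.

Lemma psi_combE f v v' w : psi (f *: v + v') w = tau f *: psi v w + psi v' w.
Proof. by rewrite psi_comb. Qed.

Lemma psi0 : psi 0 = 0.
Proof. by have := vd_add hV 0 0; rewrite addr0 -{1}[psi 0]addr0 => /addrI. Qed.

Lemma lin0 : lin psi 0.
Proof. by move=> c u v; rewrite psi0 /= scaler0 addr0. Qed.

Lemma lin_comb f v v' : lin psi v -> lin psi v' -> lin psi (f *: v + v').
Proof.
move=> lv lv' c x y; rewrite !psi_combE lv lv' !scalerDr !scalerA.
by rewrite [lconst c * _]mulrC addrACA.
Qed.

Lemma lin_scale f v : lin psi v -> lin psi (f *: v).
Proof. by move=> lv; rewrite -[f *: v]addr0; apply: lin_comb lin0. Qed.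

Lemma lin_vac : lin psi vac.
Proof.
rewrite /lin (vd_vac hV) => c u v; apply: lserP => n.
rewrite lcoefD (lconst_scale c (lconst u)) !lconstE.
by case: eqP; rewrite ?scaler0 ?addr0.
Qed.

Lemma psi_scaleE f v w : psi (f *: v) w = tau f *: psi v w.
Proof. by rewrite (vd_scale hV). Qed.

Definition scale_closed B : Prop := forall f v, B v -> B (f *: v).

(** The factor f(t + x2) need not lie in [sA], so it is absorbed into the operators in x2; this is
    why [B] has to be closed under scaling. *)
Lemma Good_scale_inner A B f G : scale_closed B -> Good psi sA A B G ->
  Good psi sA A B (fun w => lconst (tau f) *: G w).
Proof.
move=> hB; elim=> [|h u v {}G hh Au Bv lu lv _ IH].
  by apply: Good_ext (Good0 psi sA A B) => w; rewrite scaler0.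
apply: Good_ext (GoodS hh Au (hB f v Bv) lu (lin_scale f lv) IH) => w.
rewrite scalerDr (scalerAC (lconst (tau f)) h).
suff -> : lm (psi (f *: v)) (psi u w) = lconst (tau f) *: lm (psi v) (psi u w) by [].
apply: lserP => n; rewrite (lconst_scale (tau f) (lm (psi v) (psi u w))).
by rewrite (lmE _ n (calEB (lin_scale f lv))) (lmE _ n (calEB lv)) psi_scaleE.
Qed.

Lemma Good_scale_outer A B f G : scale_closed A -> Good psi sA A B G ->
  Good psi sA A B (fun w => lm (@lconst K) (tau f) *: G w).
Proof.
move=> hA'; elim=> [|h u v {}G hh Au Bv lu lv _ IH].
  by apply: Good_ext (Good0 psi sA A B) => w; rewrite scaler0.
apply: Good_ext (GoodS hh (hA' f u Au) Bv (lin_scale f lu) lv IH) => w.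
rewrite scalerDr (scalerAC (lm _ (tau f)) h) psi_scaleE.
rewrite (@lm_scaleT _ _ _ _ (@lconst K) (psi v) (tau f) (psi u w) (@lconstB K) (calEB lv))//.
by move=> r x; exact: calEZ.
Qed.

Lemma prod2_scale_inner k f a b w : lin psi a ->
  forall G : lser (lser V),
  (forall m n, iter k (@mul_sub V) (prod2 (psi a) (psi b) w) m n = G m n) ->
  forall m n, iter k (@mul_sub V) (prod2 (psi a) (psi (f *: b)) w) m n =
    (lconst (tau f) *: G) m n.
Proof.
move=> la G e m n; have aB := calEB la.
have mB x : zmod_morphism (fun v => psi a v x) by move=> v v'; rewrite aB.
pose x (m : int) : lser V := lm (fun v => psi a v m) (psi b w).
have -> : prod2 (psi a) (psi (f *: b)) w = fun m n => (tau f *: x) m n.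
  apply: funext2 => p q; rewrite /prod2 psi_scaleE.
  by rewrite -[RHS]/((tau f *: x p) q) /x -lm_coefZ// (lmE _ q (mB p)).
rewrite -iter_msX iter_msXZ -[LHS]/((tau f *: iter k (@msX _ V) x m) n).
rewrite (lconst_scale (tau f) G); suff -> : iter k (@msX _ V) x m = G m by [].
apply: lserP => q; rewrite iter_msX -e.
suff -> : (fun q r => x q r) = prod2 (psi a) (psi b) w by [].
by apply: funext2 => p r; rewrite /x (lmE _ r (mB p)).
Qed.

Lemma prod2_scale_outer k f a b w : forall G : lser (lser V),
  (forall m n, iter k (@mul_sub V) (prod2 (psi a) (psi b) w) m n = G m n) ->
  forall m n, iter k (@mul_sub V) (prod2 (psi (f *: a)) (psi b) w) m n =
    (lm (@lconst K) (tau f) *: G) m n.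
Proof.
move=> G e m n.
have -> : prod2 (psi (f *: a)) (psi b) w = fun p q => (tau f *: psi a (psi b w q)) p.
  by apply: funext2 => p q; rewrite /prod2 psi_scaleE.
rewrite (iter_mul_sub_colX k (tau f) (fun q => psi a (psi b w q))).
rewrite lm_lconst_scale lscaleE_isum; apply: eq_isum => i.
by rewrite iter_colX e.
Qed.

Lemma prod2_addr a b b' w : lin psi a ->
  prod2 (psi a) (psi (b + b')) w = add2 (prod2 (psi a) (psi b) w) (prod2 (psi a) (psi b') w).
Proof.
move=> la; apply: funext2 => p q.
have e : psi (b + b') w = psi b w + psi b' w by rewrite (vd_add hV).
by rewrite /prod2 e (lcoefD (psi b w)) (zmod_morphD (calEB la)) lcoefD.
Qed.

Lemma prod2_addl a a' b w :
  prod2 (psi (a + a')) (psi b) w = add2 (prod2 (psi a) (psi b) w) (prod2 (psi a') (psi b) w).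
Proof.
by apply: funext2 => p q; rewrite /prod2 (vd_add hV).
Qed.

Lemma SL_comb_right A B f a b b' : lin psi a -> scale_closed B ->
  SL psi sA A B a b -> SL psi sA A B a b' -> SL psi sA A B a (f *: b + b').
Proof.
move=> la hB /(SL_large hA)[k1 h1] /(SL_large hA)[k2 h2]; exists (maxn k1 k2).
have [G hG e] := h1 _ (leq_maxl k1 k2); have [G' hG' e'] := h2 _ (leq_maxr k1 k2).
exists (fun w => lconst (tau f) *: G w + G' w); first exact/GoodD/hG'/Good_scale_inner.
move=> w m n; rewrite prod2_addr// iter_mul_subD lcoef2D /add2 e'.
by rewrite (prod2_scale_inner f la (e w)).
Qed.

Lemma SL_comb_left A B f a a' b : scale_closed A ->
  SL psi sA A B a b -> SL psi sA A B a' b -> SL psi sA A B (f *: a + a') b.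
Proof.
move=> hA' /(SL_large hA)[k1 h1] /(SL_large hA)[k2 h2]; exists (maxn k1 k2).
have [G hG e] := h1 _ (leq_maxl k1 k2); have [G' hG' e'] := h2 _ (leq_maxr k1 k2).
exists (fun w => lm (@lconst K) (tau f) *: G w + G' w).
  exact/GoodD/hG'/Good_scale_outer.
move=> w m n; rewrite prod2_addl iter_mul_subD lcoef2D /add2 e'.
by rewrite (prod2_scale_outer f (e w)).
Qed.

Lemma SL0_right A B a : lin psi a -> SL psi sA A B a 0.
Proof.
move=> la; exists 0%N; exists (fun=> 0); first exact: Good0.
move=> w m n; rewrite /= /prod2 psi0 -[(0 : V -> lser V) w]/(0 : lser V).
by rewrite lcoef0 (zmod_morph0 (calEB la)).
Qed.

Lemma SL0_left A B b : SL psi sA A B 0 b.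
Proof.
exists 0%N; exists (fun=> 0); first exact: Good0.
by move=> w m n; rewrite /= /prod2 psi0.
Qed.

Lemma SL_vac_right A B u : lin psi u -> A u -> B vac -> SL psi sA A B u vac.
Proof.
move=> lu Au Bv; exists 0%N; exists (fun w => lm (psi vac) (psi u w)).
  exact: Good1 lin_vac.
move=> w m n /=; rewrite /prod2 (lmE _ m (calEB lin_vac)) (vd_vac hV) !lconstE.
by case: eqP => // _; rewrite (zmod_morph0 (calEB lu)).
Qed.

Lemma SL_vac_left A B b : lin psi b -> A vac -> B b -> SL psi sA A B vac b.
Proof.
move=> lb Av Bb; exists 0%N; exists (fun w => lm (psi b) (psi vac w)).
  exact: Good1 lin_vac _.
move=> w m n /=; rewrite /prod2 (lmE _ m (calEB lb)) (vd_vac hV) !lconstE.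
by case: eqP => // _; rewrite (zmod_morph0 (calEB lb)).
Qed.

Inductive comb (S : V -> Prop) : V -> Prop :=
| comb_zero : comb S 0
| comb_cons f v v' : S v -> comb S v' -> comb S (f *: v + v').

Lemma comb_closed S f v v' : comb S v -> comb S v' -> comb S (f *: v + v').
Proof.
move=> hv hv'; elim: hv => [|g x y Sx _ IH]; first by rewrite scaler0 add0r.
by rewrite scalerDr scalerA -addrA; exact: comb_cons.
Qed.

Lemma comb_scale S : scale_closed (comb S).
Proof. by move=> f v hv; rewrite -[_ *: _]addr0; exact/comb_closed/comb_zero. Qed.

Lemma comb_sub (S : V -> Prop) v : S v -> comb S v.
Proof. by move=> Sv; rewrite -[v]scale1r -[_ *: _]addr0; exact/comb_cons/comb_zero. Qed.

(** Filtration by word length. Exchanging [U] with level n stays within [U] and level n, so each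
    step needs only what is already proved at level n. *)
Fixpoint level (n : nat) : V -> Prop :=
  if n is n'.+1 then
    comb (fun w => level n' w \/ exists u m v, [/\ U u, level n' v & w = mode (psi u) m v])
  else comb (eq vac).

Lemma level_comb n f v v' : level n v -> level n v' -> level n (f *: v + v').
Proof. by case: n => [|n]; exact: comb_closed. Qed.

Lemma level_scale n : scale_closed (level n).
Proof. by case: n => [|n]; exact: comb_scale. Qed.

Lemma level0 n : level n 0.
Proof. by case: n => [|n]; exact: comb_zero. Qed.

Lemma levelS n v : level n v -> level n.+1 v.
Proof. by move=> h; apply: comb_sub; left. Qed.

Lemma levelW n n' v : (n <= n')%N -> level n v -> level n' v.
Proof. by move=> /subnK <- h; elim: (n' - n)%N => // m IH; exact: levelS. Qed.

Lemma level_mode n u m v : U u -> level n v -> level n.+1 (mode (psi u) m v).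
Proof. by move=> Uu hv; apply: comb_sub; right; exists u, m, v. Qed.

Lemma level_all v : exists n, level n v.
Proof.
move: v; apply: (@vd_ind _ _ _ _ _ _ _ hV (fun v => exists n, level n v)) => [||f v v' [n hn] [n' hn']|u n v Uu [n' hn']].
- by exists 0%N; exact: level0.
- by exists 0%N; exact: comb_sub.
- by exists (maxn n n'); apply: level_comb;
    [exact: levelW (leq_maxl _ _) hn|exact: levelW (leq_maxr _ _) hn'].
- by exists n'.+1; exact: level_mode.
Qed.

Definition local_at D v : Prop := lin psi v /\ forall u, U u -> SL psi sA U D u v.

Lemma local_at_comb D S : scale_closed D -> (forall v, S v -> local_at D v) ->
  forall v, comb S v -> local_at D v.
Proof.
move=> hD hS v; elim=> [|f x y /hS[lx Lx] _ [ly Ly]].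
  by split=> [|u Uu]; [exact: lin0|exact/SL0_right/(vd_lin hV)].
split=> [|u Uu]; first exact: lin_comb.
by apply: SL_comb_right => //; [exact: (vd_lin hV)|exact: Lx|exact: Ly].
Qed.

(** Linearity and locality are proved together: the product of a compatible pair of linear operators
    is linear, and compatibility follows from locality at the previous level. *)
Lemma level_local n v : level n v -> local_at (level n) v.
Proof.
elim: n v => [|n IH] v.
  apply: local_at_comb => [|_ <-]; first exact: comb_scale.
  split=> [|u Uu]; first exact: lin_vac.
  by apply: SL_vac_right => //; [exact: (vd_lin hV)|exact: comb_sub].
have hcomp b c : U b -> level n c -> lin psi b -> lin psi c -> compat psi b c.
  move=> Ub hc lb lc; have [_ /(_ _ Ub)] := IH c hc.
  exact: SL_compatible.
apply: local_at_comb => [|{}v]; first exact: level_scale.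
case=> [/IH[lv Lv]|[u [m [c [Uu hc ->]]]]].
  split=> // u Uu; apply: SL_mono (Lv u Uu) => // w; exact: levelS.
have [lc Lc] := IH c hc; have lu := vd_lin hV Uu.
have [k hk] := hcomp u c Uu hc lu lc.
split=> [|x Ux]; first by rewrite /lin (vd_mode hV)//; exact: calE_nprod hk.
apply: (@SL_right _ _ _ _ hA U U (level n)) => //.
- exact: (vd_lin hV).
- by move=> b d j Ub hd _ _; split; [exact: level_mode|exact: (vd_mode hV)].
- exact: (vd_loc hV).
Qed.

Lemma lin_all v : lin psi v.
Proof. by have [n /level_local[]] := level_all v. Qed.

Lemma SL_U u v : U u -> SL psi sA U (fun=> True) u v.
Proof.
move=> Uu; have [n /level_local[_ /(_ u Uu)]] := level_all v.
exact: SL_mono.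
Qed.

(** Induction on the left factor; [SL_U] supplies both the exchange and the compatibility of [U]
    with arbitrary vectors that [SL_left] requires. *)
Lemma SL_all u v : SL psi sA (fun=> True) (fun=> True) u v.
Proof.
move: u v; apply: (@vd_ind _ _ _ _ _ _ _ hV
  (fun u => forall v, SL psi sA (fun=> True) (fun=> True) u v)) => [v|v|f u u' IH IH' v|u n u' Uu IH v].
- exact: SL0_left.
- by apply: SL_vac_left => //; exact: lin_all.
- by apply: SL_comb_left.
- apply: (@SL_left _ _ _ _ hA U (fun=> True) (fun=> True)) => //.
  + exact: lin_all.
  + exact: lin_all.
  + by move=> b _; exact: SL_U.
  + by move=> x a Ux _ lx la; apply: SL_compatible (SL_U a Ux).
  + by move=> x a j Ux _ _ _; split=> //; exact: (vd_mode hV).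
Qed.

Lemma compat_all u v : compat psi u v.
Proof. by apply: SL_compatible (SL_all u v); exact: lin_all. Qed.

End AllLocal.

(** * The map psi is a homomorphism *)

Section TaylorLeibniz.
Variables (R : comNzRingType) (M : lmodType R).
Hypothesis tf : torsion_free M.
Implicit Types (g : lser R) (s : lser (lser M)).

Lemma lser_torsion_free : torsion_free (lser M).
Proof.
move=> s n sn; apply: lserP => m; apply: (tf (n := n)).
by rewrite -[s m *+ n.+1]/(s m *~ n.+1%:Z) -lcoefMz -[s *~ _]/(s *+ n.+1) sn.
Qed.

(* The coefficient of x0^i in g(x + x0) *)
Definition theta (i : int) g : lser R := mkL (fun m : int => g (m + i) *~ bz (m + i) i).

Lemma thetaE i g m : theta i g m = g (m + i) *~ bz (m + i) i.
Proof.
rewrite mkLE//; have [a ha] := lser_trunc g; exists (a - i) => n na.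
by rewrite ha ?mul0rz//; lia.
Qed.

Lemma theta0 g : theta 0 g = g.
Proof. by apply: lserP => m; rewrite thetaE addr0 bz0 mulr1z. Qed.

Lemma theta_neg i g : i < 0 -> theta i g = 0.
Proof. by move=> i0; apply: lserP => m; rewrite thetaE bz_neg. Qed.

Lemma theta_lD i g : theta i (lD g) = theta (i + 1) g *~ (i + 1).
Proof.
apply: lserP => m; rewrite lcoefMz !thetaE lDE -!mulrzA addrA bz_absorb addrK.
by rewrite mulrC.
Qed.

Lemma theta_sb_fin_supp j g s : fin_supp (fun i => theta i g *: sbL (j - i) s).
Proof.
exists 0, (j + 1) => i /orP[i0|ij]; first by rewrite theta_neg ?scale0r.
by rewrite sbL_neg ?scaler0//; lia.
Qed.

(** Induction on j: d/dx1 becomes d/dx0 and obeys the product rule, and the factor j + 1 is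
    cancelled by torsion-freeness. *)
Lemma sbL_leibniz j g s : gtr s ->
  sbL j (lm (@lconst R) g *: s) = isum (fun i => theta i g *: sbL (j - i) s).
Proof.
case: j => [j|j] hs; last first.
  rewrite sbL_neg// isum0// => i; have [i0|i0] := ltP i 0.
    by rewrite theta_neg ?scale0r.
  by rewrite sbL_neg ?scaler0//; lia.
elim: j g s hs => [|j IH] g s hs.
  rewrite sbL_lm_lconst// (@isum1 _ _ 0) ?theta0 ?subr0// => i i0.
  have [i1|i1] := ltP i 0; first by rewrite theta_neg ?scale0r.
  by rewrite sbL_neg ?scaler0//; move: i0; rewrite neq_lt; lia.
apply: (tf_mulrz (n := j) lser_torsion_free); rewrite isumMz; last exact: theta_sb_fin_supp.
rewrite -[j.+1]addn1 PoszD -sbL_lD; last exact: gtr_lm_lconst.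
rewrite lD_lm_lconst_scale sbLD; [|exact: gtr_lm_lconst|exact/gtr_lm_lconst/gtr_lD].
rewrite !IH//; last exact: gtr_lD.
rewrite -[X in X + _](isum_shift (-1)) -isumD; last exact: theta_sb_fin_supp; last first.
  exact: (fin_supp_shift (-1) (theta_sb_fin_supp j (lD g) s)).
apply: eq_isum => i /=; rewrite theta_lD subrK sbL_lD//.
rewrite (_ : j%:Z - (i - 1) = j%:Z + 1 - i); last by lia.
rewrite (_ : j%:Z - i + 1 = j%:Z + 1 - i); last by lia.
rewrite -scalerMzl -scalerMzr -mulrzDr; congr (_ *~ _); lia.
Qed.

End TaylorLeibniz.

Section LowerBounds.
Variable M : zmodType.
Implicit Types P : int -> int -> int -> M.

Definition low P (N : int) : Prop :=
  forall p q r, [|| p < N, q < N | r < N] -> P p q r = 0.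
Definition low1 N P : Prop := forall p q r, p < N -> P p q r = 0.
Definition low2 N P : Prop := forall p q r, q < N -> P p q r = 0.
Definition low3 N P : Prop := forall p q r, r < N -> P p q r = 0.

Lemma iter_low (L : (int -> int -> int -> M) -> Prop)
    (f : (int -> int -> int -> M) -> int -> int -> int -> M) k P :
  (forall P, L P -> L (f P)) -> L P -> L (iter k f P).
Proof. by move=> hf hP; elim: k => //= k; exact: hf. Qed.

Lemma low1_s12 N P : low1 N P -> low1 N (@s12 M P).
Proof. by move=> h p q r pN; rewrite /s12 !h ?subr0//; lia. Qed.
Lemma low1_s13 N P : low1 N P -> low1 N (@s13 M P).
Proof. by move=> h p q r pN; rewrite /s13 !h ?subr0//; lia. Qed.
Lemma low1_s23 N P : low1 N P -> low1 N (@s23 M P).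
Proof. by move=> h p q r pN; rewrite /s23 !h ?subr0//; lia. Qed.
Lemma low2_s12 N P : low2 N P -> low2 N (@s12 M P).
Proof. by move=> h p q r pN; rewrite /s12 !h ?subr0//; lia. Qed.
Lemma low2_s13 N P : low2 N P -> low2 N (@s13 M P).
Proof. by move=> h p q r pN; rewrite /s13 !h ?subr0//; lia. Qed.
Lemma low2_s23 N P : low2 N P -> low2 N (@s23 M P).
Proof. by move=> h p q r pN; rewrite /s23 !h ?subr0//; lia. Qed.
Lemma low3_s12 N P : low3 N P -> low3 N (@s12 M P).
Proof. by move=> h p q r pN; rewrite /s12 !h ?subr0//; lia. Qed.
Lemma low3_s13 N P : low3 N P -> low3 N (@s13 M P).
Proof. by move=> h p q r pN; rewrite /s13 !h ?subr0//; lia. Qed.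
Lemma low3_s23 N P : low3 N P -> low3 N (@s23 M P).
Proof. by move=> h p q r pN; rewrite /s23 !h ?subr0//; lia. Qed.

End LowerBounds.

Section Homomorphism.
Variables (K : comNzRingType) (V : lmodType K) (psi : V -> V -> lser V).
Variables (sA : lser (lser K) -> Prop) (U : V -> Prop) (vac : V) (tau : K -> lser K).
Hypothesis hV : vertex_data psi sA U vac tau.
Let hA := vd_coef hV.
Let tf := vd_tf hV.
Let lin := lin_all hV.
Let psiB v := calEB (lin v).

Lemma psi_zmod : zmod_morphism psi.
Proof.
move=> u v; have := psi_comb hV (-1) v u; rewrite scaleN1r addrC => ->.
have := psi_comb hV (-1) v v; rewrite scaleN1r addNr (psi0 hV) => /esym/eqP.
by rewrite addr_eq0 => /eqP ->; rewrite addrC.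
Qed.

(** Each variable has its own bound: x1 after u has been moved to the right, x2 from the
    compatibility of a and v, x3 from v(x3) w itself. Further factors preserve these bounds, so one
    k serves for all w. *)
Lemma triple_trunc u a v : exists k0, forall k, (k0 <= k)%N -> forall w,
  trunc3 (iter k (@s13 V) (iter k (@s12 V) (iter k (@s23 V)
    (triple (psi u) (psi a) (psi v) w)))).
Proof.
have [l12 [G hG e12]] := SL_all hV u a.
have hAC x (_ : True) : SL psi sA (fun=> True) (fun=> True) x v := SL_all hV x v.
have hBC b c (_ : True) (_ : True) (_ : calE (psi b)) (_ : calE (psi c)) :
  compat psi b c := compat_all hV b c.
have [l13 hl] := triple_local hA hAC hBC hG.
have [l23 hk] := hl l13 (leqnn _); have [G3 _ e3] := hk l23 (leqnn _).
have [kc hkc] := compat_all hV a v.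
exists (l12 + (l13 + (l23 + kc)))%N => k kk w.
set T := triple _ _ _ w.
have [N1 hN1] : exists N1, low1 N1 (iter l23 (@s23 V) (iter l13 (@s13 V) (iter l12 (@s12 V) T))).
  have [N1 hN1] := lser_trunc (G3 w); exists N1 => p q r pN.
  suff -> : iter l12 (@s12 V) T = fun p q r => G (psi v w r) p q.
    by rewrite e3 hN1 ?lcoef0.
  apply: funext3 => x y z.
  by rewrite /T iter_s12_triple e12.
have [N2 hN2] : exists N2, low2 N2 (iter kc (@s23 V) T).
  have [N2 hN2] := hkc w; exists N2 => p q r qN.
  by rewrite iter_s23_triple// hN2 ?qN// (zmod_morph0 (psiB u)).
have [N3 hN3] : exists N3, low3 N3 T.
  have [N3 hN3] := lser_trunc (psi v w); exists N3 => p q r rN.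
  by rewrite /T /triple hN3// (zmod_morph0 (psiB a)) lcoef0 (zmod_morph0 (psiB u)).
exists (Num.min N1 (Num.min N2 N3)) => p q r; rewrite !lt_min.
set Q := iter k _ _ => pqr.
have Q1 : low1 N1 Q.
  have -> : Q = iter (k - l13) (@s13 V) (iter (k - l12) (@s12 V) (iter (k - l23) (@s23 V)
      (iter l23 (@s23 V) (iter l13 (@s13 V) (iter l12 (@s12 V) T))))).
    rewrite -(iterD (k - l23)) subnK; last by lia.
    rewrite -(iter_comm l13 k _ (@s13_s23 V)) (iter_comm _ l13 _ (@s12_s13 V)).
    rewrite -(iterD (k - l13)) subnK; last by lia.
    rewrite -(iter_comm l12 k _ (@s12_s23 V)) -(iterD (k - l12)) subnK//; lia.
  by do 3 (apply: (@iter_low _ (low1 N1)) => [P|];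
    first by [exact: low1_s13|exact: low1_s12|exact: low1_s23]).
have Q2 : low2 N2 Q.
  have -> : Q = iter k (@s13 V) (iter k (@s12 V) (iter (k - kc) (@s23 V)
      (iter kc (@s23 V) T))) by rewrite -(iterD (k - kc)) subnK//; lia.
  by do 3 (apply: (@iter_low _ (low2 N2)) => [P|];
    first by [exact: low2_s13|exact: low2_s12|exact: low2_s23]).
have Q3 : low3 N3 Q.
  by do 3 (apply: (@iter_low _ (low3 N3)) => [P|];
    first by [exact: low3_s13|exact: low3_s12|exact: low3_s23]).
case/or3P: pqr => h; [apply: Q1|apply: Q2|apply: Q3]; move: h; lia.
Qed.

Lemma psi_vac_nprod n v : psi (mode (psi vac) n v) = nprod (psi vac) n (psi v).
Proof.
have cp : compatible_pair 0 (psi vac) (psi v).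
  move=> w; have [N hN] := lser_trunc (psi v w); exists (Num.min 0 N) => p q.
  rewrite lt_min /= /prod2 (vd_vac hV) lconstE; case: eqP => // -> pq.
  by rewrite hN//; move: pq; lia.
apply/funext => w; apply: lserP => m; rewrite (nprodE _ _ _ cp) (SubE _ _ (cp w)).
rewrite sbE (@isum1 _ _ 0) => [|p p0]; last first.
  by rewrite /= /prod2 (vd_vac hV) lconstE (negPf p0) mul0rz.
rewrite /= /prod2 /mode (vd_vac hV) !lconstE eqxx add0r subr0.
have [e|e] := eqVneq (- n - 1) 0; first by rewrite e addr0 bz0 mulr1z.
rewrite (psi0 hV) -[(0 : V -> lser V) w]/(0 : lser V) lcoef0.
have [n0|n0] := ltP (- n - 1) 0; first by rewrite bz_neg.
by rewrite bz_small//; move: e; rewrite neq_lt; lia.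
Qed.

Lemma nprod_sbL k a b n w : compatible_pair k a b ->
  nprod a n b w = sbL (k%:Z - n - 1) (mk2 (iter k (@mul_sub V) (prod2 a b w))).
Proof.
move=> hk; apply: lserP => m; rewrite (nprodE _ _ _ hk) (SubE _ _ (hk w)).
rewrite sbLE; last exact/gtr_mk2/hk.
rewrite (_ : k%:Z + (- n - 1) = k%:Z - n - 1); last by lia.
have -> // : (fun p q => mk2 (iter k (@mul_sub V) (prod2 a b w)) p q) =
  iter k (@mul_sub V) (prod2 a b w).
by apply: funext2 => x y; rewrite mk2E.
Qed.

(** On the left the coefficients of f(t + x0) are shifted by [psi] to f(t + x + x0); on the right
    f(t + x1) is expanded at x1 = x + x0. These agree by [vd_tau_tau], and [sbL_leibniz] combines
    them with the products of a. *)
Lemma psi_scale_nprod f a n v :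
  (forall n v, psi (mode (psi a) n v) = nprod (psi a) n (psi v)) ->
  psi (mode (psi (f *: a)) n v) = nprod (psi (f *: a)) n (psi v).
Proof.
move=> ha; have [k hk] := compat_all hV a v.
have [k' hk'] := compat_all hV (f *: a) v.
have {}hk := compatible_pairW (leq_maxl k k') hk.
have {}hk' := compatible_pairW (leq_maxr k k') hk'; move: hk hk'.
set l := maxn k k' => hk hk'; apply/funext => w.
rewrite (nprod_sbL _ _ hk').
set C := mk2 (iter l (@mul_sub V) (prod2 (psi a) (psi v) w)).
have tC : gtr C by exact/gtr_mk2/hk.
have -> : mk2 (iter l (@mul_sub V) (prod2 (psi (f *: a)) (psi v) w)) =
    lm (@lconst K) (tau f) *: C.
  apply: lserP => p; apply: lserP => q; rewrite mk2E; last exact: hk'.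
  by apply: (prod2_scale_outer hV) => x y; rewrite mk2E//; exact: hk.
rewrite (sbL_leibniz tf)// /mode (psi_scaleE hV) lscaleE_isum.
rewrite (isum_raddf psi_zmod); last exact: lscale_fin_supp.
have evB : zmod_morphism (fun g : V -> lser V => g w) by [].
rewrite (isum_raddf evB); last first.
  have [x [y h]] := lscale_fin_supp (tau f) (psi a v) (- n - 1); exists x, y => i hi.
  by rewrite h// (psi0 hV).
apply: eq_isum => i; rewrite (psi_scaleE hV).
have [i0|i0] := ltP i 0.
  rewrite (vd_tau hV)// theta_neg// scale0r.
  suff -> : tau 0 = 0 by rewrite scale0r.
  apply: lserP => m; have := vd_tau_tau hV f i m.
  by rewrite (vd_tau hV f i0) => ->; rewrite bz_neg.
have -> : tau (tau f i) = theta i (tau f).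
  by apply: lserP => m; rewrite thetaE (vd_tau_tau hV).
congr (_ *: _); rewrite (_ : - n - 1 - i = - (n + i) - 1); last by lia.
rewrite -/(mode (psi a) (n + i) v) ha (nprod_sbL _ _ hk).
by rewrite (_ : l%:Z - (n + i) - 1 = l%:Z - n - 1 - i)//; lia.
Qed.

Lemma mode_opp (a : V -> lser V) (p : int) v : mode a (- p - 1) v = a v p.
Proof. by rewrite /mode; have -> : - (- p - 1) - 1 = p by lia. Qed.

Lemma mode_add a a' n v : mode (psi (a + a')) n v = mode (psi a) n v + mode (psi a') n v.
Proof. by rewrite /mode (vd_add hV). Qed.

Lemma psi_add_nprod a a' n v :
  (forall n v, psi (mode (psi a) n v) = nprod (psi a) n (psi v)) ->
  (forall n v, psi (mode (psi a') n v) = nprod (psi a') n (psi v)) ->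
  psi (mode (psi (a + a')) n v) = nprod (psi (a + a')) n (psi v).
Proof.
move=> ha ha'; rewrite mode_add [LHS](vd_add hV) ha ha'.
have [k hk] := compat_all hV a v; have [k' hk'] := compat_all hV a' v.
have {}hk := compatible_pairW (leq_maxl k k') hk.
have {}hk' := compatible_pairW (leq_maxr k k') hk'; move: hk hk'.
set l := maxn k k' => hk hk'.
have h : compatible_pair l (psi (a + a')) (psi v).
  by move=> w; rewrite (prod2_addl hV) iter_mul_subD; exact: trunc2D.
apply/funext => w; apply: lserP => m.
rewrite -[LHS]/((nprod (psi a) n (psi v) w + nprod (psi a') n (psi v) w) m) lcoefD.
rewrite (nprodE _ _ _ h) (nprodE _ _ _ hk) (nprodE _ _ _ hk').
by rewrite (prod2_addl hV) (SubD _ _ (hk w) (hk' w)).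
Qed.

(** By the hypothesis on a, [psi] sends u_p (a_q v) to the iterated product, so the coefficients of
    u(x1) a(x2) v are sent to the input of [nprod_assoc]. Being additive, [psi] commutes with the
    substitution, which computes (u_m a)_n v. *)
Lemma psi_mode_nprod u m a : U u ->
  (forall n v, psi (mode (psi a) n v) = nprod (psi a) n (psi v)) ->
  forall n v, psi (mode (psi (mode (psi u) m a)) n v) =
    nprod (psi (mode (psi u) m a)) n (psi v).
Proof.
move=> Uu ha n v; apply/funext => w; apply: lserP => j.
have [k1 hP] := triple_trunc u a v.
have [k2 hk2] := compat_all hV u a; have [k3 hk3] := compat_all hV a v.
pose k := (k1 + (k2 + k3))%N.
have hPk := hP k (leq_addr _ _) w.
have hua : compatible_pair k (psi u) (psi a).
  by apply: compatible_pairW hk2; rewrite /k; lia.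
have hav : compatible_pair k (psi a) (psi v).
  by apply: compatible_pairW hk3; rewrite /k; lia.
have hu_av i : exists l, compatible_pair l (psi u) (nprod (psi a) i (psi v)).
  by rewrite -ha; exact: (compat_all hV).
have hua_v i : exists l, compatible_pair l (nprod (psi u) i (psi a)) (psi v).
  by rewrite -(vd_mode hV)//; exact: (compat_all hV).
pose X := prod2 (psi u) (psi a) v.
have evB : zmod_morphism (fun x : V => psi x w j) by move=> x y; rewrite psi_zmod.
have eG : (fun p q => nprod (psi u) (- p - 1) (nprod (psi a) (- q - 1) (psi v)) w j) =
    fun p q => psi (X p q) w j.
  apply: funext2 => p q; rewrite -ha -(vd_mode hV)//.
  by rewrite (mode_opp (psi a)) (mode_opp (psi u)).
have eA : iter k (@mul_sub V) (fun p q => psi (X p q) w j) =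
    fun p q => psi (iter k (@mul_sub V) X p q) w j.
  by apply: funext2 => p q; rewrite (iter_mul_sub_morph k _ p q evB).
have := @nprod_assoc _ _ tf (psi u) (psi a) (psi v) w k (psiB u) hPk hua hav hu_av hua_v
  (- m - 1) (- n - 1) j.
have em : - (- m - 1) - 1 = m by lia.
have en : - (- n - 1) - 1 = n by lia.
rewrite eG eA em en.
rewrite (vd_mode hV m a Uu) => <-; last first.
  have [N hN] := hua v; exists N => p q pq; rewrite hN// (psi0 hV).
  by [].
rewrite {1}/mode (nprodE _ _ _ hua) (SubE _ _ (hua v)) !sbE.
rewrite (isum_raddf evB); last exact/sb_fin_supp/hua.
by apply: eq_isum => p; rewrite (zmod_morphMz evB).
Qed.

Lemma psi_nprod a n v : psi (mode (psi a) n v) = nprod (psi a) n (psi v).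
Proof.
move: a n v; apply: (@vd_ind _ _ _ _ _ _ _ hV
  (fun a => forall n v, psi (mode (psi a) n v) = nprod (psi a) n (psi v))).
- move=> n v; rewrite /mode (psi0 hV) -[(0 : V -> lser V) v]/(0 : lser V) lcoef0 (psi0 hV).
  have cp : compatible_pair 0 (0 : V -> lser V) (psi v) by move=> w; exists 0.
  apply/funext => w; apply: lserP => m; rewrite (nprodE _ _ _ cp) (SubE _ _ (cp w)).
  by rewrite sbE isum0// => p; rewrite /= /prod2 -[(0 : V -> lser V) _]/(0 : lser V) mul0rz.
- exact: psi_vac_nprod.
- by move=> f a a' ha ha' n v; apply: psi_add_nprod => // {}n {}v; apply: psi_scale_nprod.
- by move=> u m a Uu ha; exact: psi_mode_nprod.
Qed.

End Homomorphism.

(** * The Jacobi identity *)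

Definition sbz (p i : int) : int := if i is Posz k then (-1) ^+ k * binz p k else 0.

Lemma sbz_neg p i : i < 0 -> sbz p i = 0. Proof. by case: i. Qed.

Lemma sbz_pascal p i : sbz (p + 1) i = sbz p i - sbz p (i - 1).
Proof.
case: i => [[|k]|k]; first by rewrite /sbz !binz0 subr0.
  rewrite /sbz (_ : k.+1%:Z - 1 = k%:Z) ?binz_pascal; last by lia.
  by rewrite exprS; ring.
by rewrite !sbz_neg ?subr0//; lia.
Qed.

Lemma sbz0 i : sbz 0 i = (i == 0)%:R.
Proof. by case: i => [[|k]|k] //=; rewrite mulr0. Qed.

(** The two expansions of (x1 - x2)^(-q-1) differ by a derivative of the delta function, whose
    residue against x1^P is the Taylor coefficient binom(P, q). *)
Lemma sbz_residue (q : nat) (P : int) :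
  sbz (Negz q) (P - q%:Z) - (-1) ^ Negz q * sbz (Negz q) (- P - 1) = bz P q.
Proof.
case: P => [P|P].
  rewrite (sbz_neg _ (i := - P%:Z - 1)) ?mulr0 ?subr0; last by lia.
  have [Pq|qP] := ltnP P q; first by rewrite sbz_neg ?bz_small//; lia.
  rewrite subzn// /sbz /= mulrA -expr2 sqrr_sign mul1r.
  by rewrite subnKC// bin_sub.
rewrite sbz_neg ?sub0r; last by lia.
rewrite (_ : - Negz P - 1 = P%:Z); last by lia.
rewrite /sbz /bz /= [(-1) ^+ P * (_ * _)]mulrA -expr2 sqrr_sign mul1r.
rewrite -mulNr; congr (_ * _).
  rewrite /exprz invr_sign exprS; ring.
by rewrite addnC -[in RHS]bin_sub ?leq_addl// addnK.
Qed.

Section JacobiCore.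
Variable M : zmodType.
Implicit Types A B E Y : int -> int -> M.

Definition lowX A : Prop := exists N : int, forall p q, p < N -> A p q = 0.
Definition lowY A : Prop := exists N : int, forall p q, q < N -> A p q = 0.

(* The coefficients of (x1 - x2)^p A, of (- x2 + x1)^p B and of the right-hand
   side of the Jacobi identity at x0^(-p-1) *)
Definition J1 A (p n1 n2 : int) : M :=
  isum (fun i => A (n1 - p + i) (n2 - i) *~ sbz p i).
Definition J2 B (p n1 n2 : int) : M :=
  isum (fun i => B (n1 - i) (n2 - p + i) *~ ((-1) ^ p * sbz p i)).
Definition J3 Y (p n1 n2 : int) : M :=
  isum (fun i => Y (- p - 1 - i) (n2 + 1 + n1 + i) *~ sbz (n1 + i) i).

Lemma J1_fin_supp A p n1 n2 z : lowY A ->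
  fin_supp (fun i => A (n1 - p + i) (n2 - i) *~ sbz z i).
Proof.
move=> [N hN]; exists 0, (n2 - N + 1) => i /orP[i0|iN].
  by rewrite sbz_neg ?mulr0z.
by rewrite hN ?mul0rz//; lia.
Qed.

Lemma J2_fin_supp B p n1 n2 z c : lowX B ->
  fin_supp (fun i => B (n1 - i) (n2 - p + i) *~ (c * sbz z i)).
Proof.
move=> [N hN]; exists 0, (n1 - N + 1) => i /orP[i0|iN].
  by rewrite sbz_neg ?mulr0 ?mulr0z.
by rewrite hN ?mul0rz//; lia.
Qed.

Lemma J3_fin_supp Y n0 n1 n2 (z : int -> int) : lowX Y ->
  fin_supp (fun i => Y (n0 - i) (n2 + n1 + i) *~ sbz (z i) i).
Proof.
move=> [N hN]; exists 0, (n0 - N + 1) => i /orP[i0|iN].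
  by rewrite sbz_neg ?mulr0z.
by rewrite hN ?mul0rz//; lia.
Qed.

Lemma fsum_delta12 A n0 n1 n2 :
  mul3 delta_12_0 (fun m0 m1 m2 => if m0 == 0 then A m1 m2 else 0) n0 n1 n2 =
  J1 A (- n0 - 1) n1 n2.
Proof.
rewrite /mul3 (@fsum_inj _ _ (fun i : int => (n0, - n0 - 1 - i, i))) /=.
- apply: eq_isum => i; rewrite subrr eqxx /delta_12_0 /binpow /sbz.
  rewrite (_ : n1 - (- n0 - 1 - i) = n1 - (- n0 - 1) + i); last by lia.
  by case: i => // k; rewrite subrK eqxx.
- by move=> i j [].
- move=> [[a b] c] /=; case: (n0 - a =P 0) => [e|_]; last by rewrite mul0rz eqxx.
  rewrite /delta_12_0 /binpow; case: c => [c|c]; last by rewrite mulr0z eqxx.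
  case: (b + c%:Z =P - a - 1) => [e' _|_]; last by rewrite mulr0z eqxx.
  exists c%:Z; congr (_, _, _); lia.
Qed.

Lemma fsum_delta21 B n0 n1 n2 :
  mul3 delta_21_0 (fun m0 m1 m2 => if m0 == 0 then B m1 m2 else 0) n0 n1 n2 =
  J2 B (- n0 - 1) n1 n2.
Proof.
rewrite /mul3 (@fsum_inj _ _ (fun i : int => (n0, i, - n0 - 1 - i))) /=.
- apply: eq_isum => i; rewrite subrr eqxx /delta_21_0 /binpow /sbz.
  rewrite (_ : n2 - (- n0 - 1 - i) = n2 - (- n0 - 1) + i); last by lia.
  by case: i => // k; rewrite subrK eqxx.
- by move=> i j [].
- move=> [[a b] c] /=; case: (n0 - a =P 0) => [e|_]; last by rewrite mul0rz eqxx.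
  rewrite /delta_21_0 /binpow; case: b => [b|b]; last by rewrite mulr0 mulr0z eqxx.
  case: (c + b%:Z =P - a - 1) => [e' _|_]; last by rewrite mulr0 mulr0z eqxx.
  exists b%:Z; congr (_, _, _); lia.
Qed.

Lemma fsum_delta10 Y n0 n1 n2 :
  mul3 delta_10_2 (fun m0 m1 m2 => if m1 == 0 then Y m0 m2 else 0) n0 n1 n2 =
  J3 Y (- n0 - 1) n1 n2.
Proof.
rewrite /mul3 (@fsum_inj _ _ (fun i : int => (i, n1, - 1 - n1 - i))) /=.
- apply: eq_isum => i; rewrite subrr eqxx /delta_10_2 /binpow /sbz.
  rewrite (_ : n2 - (- 1 - n1 - i) = n2 + 1 + n1 + i); last by lia.
  rewrite (_ : - (- n0 - 1) - 1 - i = n0 - i); last by lia.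
  rewrite (_ : - (- 1 - n1 - i) - 1 = n1 + i); last by lia.
  by case: i => // k; rewrite eqxx.
- by move=> i j [].
- move=> [[a b] c] /=; case: (n1 - b =P 0) => [e|_]; last by rewrite mul0rz eqxx.
  rewrite /delta_10_2 /binpow; case: a => [a|a]; last by rewrite mulr0z eqxx.
  case: (b + a%:Z =P - c - 1) => [e' _|_]; last by rewrite mulr0z eqxx.
  exists a%:Z; congr (_, _, _); lia.
Qed.

(** The three terms of the Jacobi identity all satisfy J_(p+1) = (x1 - x2) J_p; for the third one
    this is x1 - x2 = x0 on the support of the delta function. The descent in [jacobi_core] rests on
    it. *)
Lemma J1S A p : lowY A -> J1 A (p + 1) = mul_sub (J1 A p).
Proof.
move=> hA; apply: funext2 => n1 n2; rewrite /mul_sub /J1.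
rewrite -[X in _ = _ - X](isum_shift (-1)) -isumB; [|exact: J1_fin_supp|].
  apply: eq_isum => i /=; rewrite sbz_pascal.
  rewrite (_ : n1 - (p + 1) + i = n1 - 1 - p + i); last by lia.
  rewrite (_ : n1 - p + (i - 1) = n1 - 1 - p + i); last by lia.
  rewrite (_ : n2 - 1 - (i - 1) = n2 - i); last by lia.
  by rewrite mulrzBr.
exact: (fin_supp_shift (-1) (J1_fin_supp p n1 (n2 - 1) p hA)).
Qed.

Lemma J2S B p : lowX B -> J2 B (p + 1) = mul_sub (J2 B p).
Proof.
move=> hB; apply: funext2 => n1 n2; rewrite /mul_sub /J2.
rewrite -[X in _ = X - _](isum_shift (-1)) -isumB; [|
  exact: (fin_supp_shift (-1) (J2_fin_supp p (n1 - 1) n2 p _ hB))|exact: J2_fin_supp].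
apply: eq_isum => i /=; rewrite sbz_pascal.
rewrite (_ : n1 - 1 - (i - 1) = n1 - i); last by lia.
rewrite (_ : n2 - p + (i - 1) = n2 - 1 - p + i); last by lia.
rewrite (_ : n2 - (p + 1) + i = n2 - 1 - p + i); last by lia.
by rewrite -mulrzBr exprzDr// expr1z; congr (_ *~ _); ring.
Qed.

Lemma J3S Y p : lowX Y -> J3 Y (p + 1) = mul_sub (J3 Y p).
Proof.
move=> hY; apply: funext2 => n1 n2; rewrite /mul_sub /J3.
have e1 : forall i : int, n2 + 1 + (n1 - 1) + i = n2 + n1 + i by lia.
have e2 : forall i : int, n2 - 1 + 1 + n1 + i = n2 + n1 + i by lia.
rewrite -isumB; last 2 first.
- by have := J3_fin_supp (- p - 1) n1 n2 (fun i => n1 - 1 + i) hY;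
    congr fin_supp; apply/funext => i; rewrite e1.
- by have := J3_fin_supp (- p - 1) n1 n2 (fun i => n1 + i) hY;
    congr fin_supp; apply/funext => i; rewrite e2.
rewrite -[RHS](isum_shift 1); apply: eq_isum => i.
rewrite e1 e2 -mulrzBr (_ : - p - 1 - (i + 1) = - (p + 1) - 1 - i); last by lia.
rewrite (_ : n2 + n1 + (i + 1) = n2 + 1 + n1 + i); last by lia.
rewrite (_ : n1 + (i + 1) = n1 + i + 1); last by lia.
rewrite (_ : n1 - 1 + (i + 1) = n1 + i); last by lia.
rewrite [sbz (n1 + i + 1) _]sbz_pascal addrK; congr (_ *~ _); ring.
Qed.

Lemma J1_mul_sub A p : lowY A -> J1 (mul_sub A) p = mul_sub (J1 A p).
Proof.
move=> hA; apply: funext2 => n1 n2; rewrite /mul_sub /J1.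
rewrite -isumB; [|exact: J1_fin_supp|exact: J1_fin_supp].
apply: eq_isum => i; rewrite mulrzBl.
by congr (A _ _ *~ _ - A _ _ *~ _); lia.
Qed.

Lemma J2_mul_sub B p : lowX B -> J2 (mul_sub B) p = mul_sub (J2 B p).
Proof.
move=> hB; apply: funext2 => n1 n2; rewrite /mul_sub /J2.
rewrite -isumB; [|exact: J2_fin_supp|exact: J2_fin_supp].
apply: eq_isum => i; rewrite mulrzBl.
by congr (B _ _ *~ _ - B _ _ *~ _); lia.
Qed.

Lemma lowY_iter k A : lowY A -> lowY (iter k (@mul_sub M) A).
Proof. by move=> [N hN]; exists N; exact: iter_mul_sub_low. Qed.

Lemma lowX_iter k B : lowX B -> lowX (iter k (@mul_sub M) B).
Proof.
move=> [N hN]; exists N; elim: k => //= k IH p q pN.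
by rewrite /mul_sub !IH ?subr0//; lia.
Qed.

Lemma J1_iter k A p : lowY A -> J1 (iter k (@mul_sub M) A) p = J1 A (p + k%:Z).
Proof.
move=> hA; elim: k p => [|k IH] p; first by rewrite addr0.
rewrite iterS J1_mul_sub; last exact: lowY_iter.
by rewrite IH -J1S//; congr J1; lia.
Qed.

Lemma J2_iter k B p : lowX B -> J2 (iter k (@mul_sub M) B) p = J2 B (p + k%:Z).
Proof.
move=> hB; elim: k p => [|k IH] p; first by rewrite addr0.
rewrite iterS J2_mul_sub; last exact: lowX_iter.
by rewrite IH -J2S//; congr J2; lia.
Qed.

Lemma J10 A : J1 A 0 = A.
Proof.
apply: funext2 => n1 n2; rewrite /J1 (@isum1 _ _ 0).
  by rewrite sbz0 eqxx mulr1z !subr0 ?addr0.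
by move=> i i0; rewrite sbz0 (negPf i0) mulr0z.
Qed.

Lemma J20 B : J2 B 0 = B.
Proof.
apply: funext2 => n1 n2; rewrite /J2 (@isum1 _ _ 0).
  by rewrite sbz0 eqxx expr0z mulr1 mulr1z !subr0 ?addr0.
by move=> i i0; rewrite sbz0 (negPf i0) mulr0 mulr0z.
Qed.

(* The residue in x1 of the Jacobi identity *)
Lemma J_residue E q n : trunc2 E ->
  J1 E (Negz q) (-1) n - J2 E (Negz q) (-1) n = sb E q n.
Proof.
move=> [N hN]; have hY : lowY E by exists N => x y h; apply: hN; rewrite h orbT.
have hX : lowX E by exists N => x y h; apply: hN; rewrite h.
rewrite /J1 /J2 -[X in X - _ = _](isum_shift (- q%:Z)).
rewrite -[X in _ - X = _](isum_rev (-1)) -isumB; first last.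
- have [a [b h]] := J2_fin_supp (Negz q) (-1) n (Negz q) ((-1) ^ Negz q) hX.
  by exists (-1 - b), (-1 - a + 1) => i hi; apply: h; lia.
- exact: (fin_supp_shift (- q%:Z) (J1_fin_supp (Negz q) (-1) n (Negz q) hY)).
rewrite sbE; apply: eq_isum => P /=.
rewrite (_ : -1 - Negz q + (P - q%:Z) = P); last by lia.
rewrite (_ : n - (P - q%:Z) = n + q%:Z - P); last by lia.
rewrite (_ : -1 - (-1 - P) = P); last by lia.
rewrite (_ : n - Negz q + (-1 - P) = n + q%:Z - P); last by lia.
by rewrite -mulrzBr [-1 - P]addrC sbz_residue.
Qed.

Lemma sub_rearrange (a1 a2 b1 b2 c1 c2 : M) :
  a1 - a2 = b1 - b2 + (c1 - c2) -> a1 - (b1 + c1) = a2 - (b2 + c2).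
Proof.
rewrite addrACA -opprD; set b := b1 + c1 => /eqP; rewrite subr_eq => /eqP ->.
by rewrite addrAC [b - _ - b]addrAC subrr add0r addrC.
Qed.

(** For p >= k the third term vanishes and the identity is the locality relation times (x1 -
    x2)^(p-k). Descending from there, the defect at p is killed by x1 - x2 and has zero residue in
    x1, hence is 0. *)
Lemma jacobi_core k A B : lowY A -> lowX B ->
  iter k (@mul_sub M) A = iter k (@mul_sub M) B ->
  forall p, J1 A p = add2 (J2 B p) (J3 (Sub A) p).
Proof.
move=> hA hB e; pose E := iter k (@mul_sub M) A.
have tE : trunc2 E.
  have [N hN] := lowY_iter k hA; have [N' hN'] := lowX_iter k hB.
  exists (Num.min N N') => m n; rewrite lt_min => /orP[mN|nN].
    by rewrite /E e hN'//; lia.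
  by rewrite /E hN//; lia.
have tS i m : Sub A i m = sb E (k%:Z + i) m by apply: SubE.
have hY : lowX (Sub A) by exists (- k%:Z) => i m h; rewrite tS sb_neg//; lia.
have top p : k%:Z <= p -> J1 A p = add2 (J2 B p) (J3 (Sub A) p).
  move=> kp; have -> : p = (p - k%:Z) + k%:Z by rewrite subrK.
  have -> : p - k%:Z = 0 + (absz (p - k%:Z)%R)%:Z by lia.
  rewrite -J1_iter// -J1_iter; last exact: lowY_iter.
  rewrite -J2_iter// -J2_iter; last exact: lowX_iter.
  rewrite J10 J20 e; apply: funext2 => n1 n2.
  rewrite /add2 /J3 isum0 ?addr0// => i.
  have [i0|i0] := ltP i 0; first by rewrite sbz_neg ?mulr0z.
  by rewrite tS sb_neg ?mul0rz//; lia.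
suff main q : J1 A (k%:Z - q%:Z) = add2 (J2 B (k%:Z - q%:Z)) (J3 (Sub A) (k%:Z - q%:Z)).
  move=> p; have [kp|/ltW pk] := leP k%:Z p; first exact: top.
  by have := main (absz (k%:Z - p)%R); rewrite (_ : k%:Z - _ = p)//; lia.
elim: q => [|q IH]; first by apply: top; lia.
set p := k%:Z - q.+1%:Z.
have ep : p + 1 = k%:Z - q%:Z by rewrite /p; lia.
pose J := add2 (J1 A p) (opp2 (add2 (J2 B p) (J3 (Sub A) p))).
(* Thus [J m n] depends only on m + n, and it is enough to treat m = -1. *)
have J_eq m n : J (m - 1) n = J m (n - 1).
  have := congr1 (fun f => f m n) IH; rewrite -ep J1S// /add2 J2S// J3S// /mul_sub => h.
  exact: sub_rearrange.
have J_res n : J (-1) n = 0.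
  have hq : p = Negz q + k%:Z by rewrite /p; lia.
  rewrite /J /add2 /opp2 hq -J1_iter// -J2_iter// -e.
  rewrite opprD addrA J_residue// /J3 (@isum1 _ _ 0).
    rewrite tS -hq /p; rewrite (_ : k%:Z + _ = q%:Z); last by lia.
    by rewrite (_ : n + 1 + -1 + 0 = n) ?addr0 /sbz ?binz0 ?mulr1z ?subrr//; lia.
  move=> i i0; have [i1|i1] := ltP i 0; first by rewrite sbz_neg ?mulr0z.
  (* The other summands carry binom(i - 1, i), which is 0 for i >= 1. *)
  suff -> : sbz (-1 + i) i = 0 by rewrite mulr0z.
  move: i0 i1; case: i => // [[|i]]// _ _.
  rewrite (_ : -1 + i.+1%:Z = i%:Z) /sbz /= ?bin_small ?mulr0//; lia.
have J0 m n : J m n = 0.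
  have up t n' : J (-1 + t%:Z) n' = 0.
    elim: t n' => [|t IHt] n'; first by rewrite addr0 J_res.
    rewrite -[n'](addrK 1) -J_eq (_ : -1 + t.+1%:Z - 1 = -1 + t%:Z) ?IHt//; lia.
  have down t n' : J (-1 - t%:Z) n' = 0.
    elim: t n' => [|t IHt] n'; first by rewrite subr0 J_res.
    rewrite (_ : -1 - t.+1%:Z = -1 - t%:Z - 1) ?J_eq ?IHt//; lia.
  have [m1|m1] := leP (-1) m.
    by have := up (absz (m + 1)%R) n; rewrite (_ : -1 + _ = m)//; lia.
  by have := down (absz (m + 1)%R) n; rewrite (_ : -1 - _ = m)//; lia.
apply: funext2 => m n.
by apply/eqP; rewrite -subr_eq0; apply/eqP; exact: J0.
Qed.

End JacobiCore.

(** * Weak associativity and the creation property *)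

Section WeakAssociativity.
Variable M : zmodType.
Implicit Types A : int -> int -> M.

Lemma subst_x0_plus_x2E A i m :
  subst_x0_plus_x2 A i m = isum (fun p => A p (m + i - p) *~ bz p (p - i)).
Proof.
rewrite /subst_x0_plus_x2 (@fsum_inj _ _ (fun p => (p, m + i - p)))/=.
- apply: eq_isum => p; congr (_ *~ _).
  rewrite (_ : m - (m + i - p) = p - i); last by lia.
  rewrite /binpow /bz; case e : (p - i) => [k|//].
  by rewrite expr1n mul1r ifT//; apply/eqP; lia.
- by move=> p q [].
- move=> [p q] /=; rewrite /binpow; case e : (m - q) => [k|k]; last by rewrite mulr0z eqxx.
  case: (i + k%:Z =P p) => [e' _|_]; last by rewrite mulr0z eqxx.
  by exists p; congr pair; lia.
Qed.

Lemma subst_fin_supp A i m : lowY A -> fin_supp (fun p => A p (m + i - p) *~ bz p (p - i)).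
Proof.
move=> [N hN]; exists i, (m + i - N + 1) => p /orP[pi|pN].
  by rewrite bz_neg ?mulr0z//; lia.
by rewrite hN ?mul0rz//; lia.
Qed.

Lemma lowY_sX A : lowY A -> lowY (sX A).
Proof. by move=> [N hN]; exists N => p q qN; rewrite /sX hN. Qed.

Lemma subst_sX A : lowY A ->
  subst_x0_plus_x2 (sX A) = mul_add (subst_x0_plus_x2 A).
Proof.
move=> hA; apply: funext2 => i m.
rewrite /mul_add !subst_x0_plus_x2E -isumD; [|exact: subst_fin_supp|exact: subst_fin_supp].
rewrite -[LHS](isum_shift 1); apply: eq_isum => p; rewrite /sX addrK.
rewrite bz_pascal.
rewrite (_ : m + i - (p + 1) = m + i - 1 - p); last by lia.
rewrite (_ : m + (i - 1) - p = m + i - 1 - p); last by lia.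
rewrite (_ : m - 1 + i - p = m + i - 1 - p); last by lia.
rewrite (_ : p + 1 - i = p - (i - 1)); last by lia.
by rewrite (_ : p - (i - 1) - 1 = p - i) ?mulrzDr//; lia.
Qed.

Lemma subst_sY A i m : subst_x0_plus_x2 (sY A) i m = subst_x0_plus_x2 A i (m - 1).
Proof.
rewrite !subst_x0_plus_x2E; apply: eq_isum => p; rewrite /sY.
by rewrite (_ : m + i - p - 1 = m - 1 + i - p)//; lia.
Qed.

Lemma subst_mul_sub A i m : lowY A ->
  subst_x0_plus_x2 (mul_sub A) i m = subst_x0_plus_x2 A (i - 1) m.
Proof.
move=> hA; have hX := lowY_sX hA.
have hY : lowY (sY A) by case: hA => N hN; exists N => p q qN; rewrite /sY hN//; lia.
have -> : subst_x0_plus_x2 (mul_sub A) i m =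
    subst_x0_plus_x2 (sX A) i m - subst_x0_plus_x2 (sY A) i m.
  rewrite !subst_x0_plus_x2E -isumB; [|exact: subst_fin_supp|exact: subst_fin_supp].
  by apply: eq_isum => p; rewrite -mulrzBl.
by rewrite subst_sY subst_sX// /mul_add addrK.
Qed.

Lemma subst_iter_sub k A i m : lowY A ->
  subst_x0_plus_x2 (iter k (@mul_sub M) A) i m = subst_x0_plus_x2 A (i - k%:Z) m.
Proof.
move=> hA; elim: k i => [|k IH] i; first by rewrite subr0.
rewrite iterS subst_mul_sub; last exact: lowY_iter.
by rewrite IH (_ : i - 1 - k%:Z = i - k.+1%:Z)//; lia.
Qed.

(** For p >= 0 the expansion of (x0 + x2)^p is a polynomial, so it is the same in nonnegative powers
    of either variable. *)
Lemma subst_sb A i m : (forall p q, p < 0 -> A p q = 0) ->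
  subst_x0_plus_x2 A i m = sb A i m.
Proof.
move=> hA; rewrite subst_x0_plus_x2E sbE; apply: eq_isum => p.
have [p0|p0] := ltP p 0; first by rewrite hA// !mul0rz.
congr (_ *~ _); have [i0|i0] := ltP i 0.
  by rewrite (bz_neg _ i0) bz_small//; lia.
have [pi|ip] := ltP p i; first by rewrite bz_neg ?bz_small//; lia.
case: p p0 ip => // p _; case: i i0 => // i _; rewrite lez_nat => ip.
by rewrite subzn// /bz /= bin_sub.
Qed.

Lemma sb_sX A : trunc2 A -> sb (sX A) = mul_add (sb A).
Proof.
move=> hA; apply: funext2 => j m.
by rewrite sb_X// /mul_add addrC.
Qed.

Lemma trunc2_iter_sX l A : trunc2 A -> trunc2 (iter l (@sX M) A).
Proof. by move=> hA; elim: l => //= l; exact: trunc2X. Qed.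

Lemma iter_sX l A p q : iter l (@sX M) A p q = A (p - l%:Z) q.
Proof.
elim: l p => [|l IH] p; first by rewrite subr0.
by rewrite iterS /sX IH (_ : p - 1 - l%:Z = p - l.+1%:Z)//; lia.
Qed.

Lemma iter_mul_add_shift l A (d : int) i j :
  iter l (@mul_add M) (fun i j => A (i - d) j) i j = iter l (@mul_add M) A (i - d) j.
Proof.
elim: l i j => // l IH i j; rewrite !iterS /mul_add !IH.
by rewrite [i - 1 - d]addrAC.
Qed.

Lemma weak_assoc k A : lowY A -> local2 k A -> exists l : nat,
  iter l (@mul_add M) (subst_x0_plus_x2 A) = iter l (@mul_add M) (Sub A).
Proof.
move=> hA hk; pose E := iter k (@mul_sub M) A.
have [N hN] : trunc2 E := hk; have hE : lowY E := lowY_iter k hA.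
(* The factor x1^l removes the negative powers of x1 from (x1 - x2)^k A; under x1 = x0 + x2 it is
   the factor (x0 + x2)^l of weak associativity. *)
pose l := absz N; exists l.
have lowYl : lowY (iter l (@sX M) E) by elim: l => //= l; exact: lowY_sX.
have e1 : subst_x0_plus_x2 (iter l (@sX M) E) = iter l (@mul_add M) (subst_x0_plus_x2 E).
  have : forall n, lowY (iter n (@sX M) E) by elim=> //= n; exact: lowY_sX.
  by move=> hl; elim: (l) => // n IH; rewrite !iterS subst_sX ?IH.
have e2 : sb (iter l (@sX M) E) = iter l (@mul_add M) (sb E).
  by elim: (l) => // n IH; rewrite !iterS sb_sX ?IH//; exact: trunc2_iter_sX.
have e3 : iter l (@mul_add M) (subst_x0_plus_x2 E) = iter l (@mul_add M) (sb E).
  rewrite -e1 -e2; apply: funext2 => i m; apply: subst_sb => p q p0.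
  by rewrite iter_sX hN//; rewrite /l; lia.
have eS : subst_x0_plus_x2 A = fun i m => subst_x0_plus_x2 E (i - - k%:Z) m.
  apply: funext2 => i m; rewrite subst_iter_sub//.
  by rewrite (_ : i - - k%:Z - k%:Z = i)//; lia.
have eB : Sub A = fun i m => sb E (i - - k%:Z) m.
  by apply: funext2 => i m; rewrite (SubE _ _ hk) opprK addrC.
apply: funext2 => i m.
by rewrite eS eB !iter_mul_add_shift e3.
Qed.

End WeakAssociativity.

Section Creation.
Variables (K : comNzRingType) (V : lmodType K) (psi : V -> V -> lser V).
Variables (sA : lser (lser K) -> Prop) (U : V -> Prop) (vac : V) (tau : K -> lser K).
Hypothesis hV : vertex_data psi sA U vac tau.

Lemma lowY_prod2 a b w : lowY (prod2 (psi a) (psi b) w).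
Proof.
have [N hN] := lser_trunc (psi b w); exists N => p q qN.
by rewrite /prod2 hN// (zmod_morph0 (calEB (lin_all hV a))).
Qed.

Lemma psi_weak_assoc u v w : exists l : nat,
  iter l (@mul_add V) (subst_x0_plus_x2 (prod2 (psi u) (psi v) w)) =
  iter l (@mul_add V) (fun i m : int => psi (psi u v i) w m).
Proof.
have [k hk] := compat_all hV u v.
have [l e] := weak_assoc (lowY_prod2 u v w) (hk w); exists l; rewrite e.
congr (iter l _ _); apply: funext2 => i m.
rewrite -(mode_opp (psi u)) (psi_nprod hV) (nprodE _ _ _ hk).
by have -> : - (- i - 1) - 1 = i by lia.
Qed.

(** The operators in x1 come from [U], so they have no pole on the vacuum, and the coefficients in
    [sA] have no negative power. *)
Lemma Good_vac B G : Good psi sA U B G -> forall p q, p < 0 -> G vac p q = 0.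
Proof.
elim=> // h u v {}G hh Uu Bv lu lv _ IH p q p0; rewrite lcoef2D IH// addr0.
rewrite lscaleE_isum lcoef_isum; last exact: lscale_fin_supp.
apply: isum0 => i; have [i0|i0] := ltP i 0.
  have -> : h i = 0 by apply: lserP => j; rewrite (vd_nneg hV hh) ?i0.
  by rewrite scale0r.
rewrite (lmE (psi u vac) (p - i) (calEB lv)) (vd_creation hV Uu).1; last by lia.
by rewrite (zmod_morph0 (calEB lv)) scaler0.
Qed.

Lemma iter_mul_sub_const k (A : int -> int -> V) m : (forall p q, q < 0 -> A p q = 0) ->
  iter k (@mul_sub V) A m 0 = A (m - k%:Z) 0.
Proof.
move=> hA; elim: k m => [|k IH] m; first by rewrite subr0.
rewrite iterS /mul_sub IH (@iter_mul_sub_low _ k A 0 hA m (0 - 1))// subr0.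
by rewrite (_ : m - 1 - k%:Z = m - k.+1%:Z)//; lia.
Qed.

(** For u_n v, locality brings operators of [U] next to the vacuum, so (x1 - x2)^k u(x1) v(x2) 1 has
    no negative power of x1; the induction hypothesis excludes those of x2. Hence x = 0 may be set
    in the product, which leaves u(x0) v. *)
Lemma psi_creation v : (forall n, n < 0 -> psi v vac n = 0) /\ psi v vac 0 = v.
Proof.
move: v; apply: (@vd_ind _ _ _ _ _ _ _ hV
  (fun v => (forall n, n < 0 -> psi v vac n = 0) /\ psi v vac 0 = v)).
- by rewrite (psi0 hV).
- rewrite (vd_vac hV); split=> [n n0|]; last by rewrite lconstE eqxx.
  by rewrite lconstE; case: eqP => // e; move: n0; rewrite e.
- move=> f v v' [v0 v1] [w0 w1]; rewrite (psi_combE hV).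
  have fs n : (forall i, i >= 0 -> psi v vac (n - i) = 0) -> (tau f *: psi v vac) n = 0.
    move=> h; rewrite lscaleE_isum isum0// => i; have [i0|i0] := ltP i 0.
      by rewrite (vd_tau hV)// scale0r.
    by rewrite h// scaler0.
  split=> [n n0|]; rewrite lcoefD.
    by rewrite w0// fs ?addr0// => i i0; rewrite v0//; lia.
  rewrite w1 lscaleE_isum (@isum1 _ _ 0) => [|i i0].
    by rewrite subr0 (vd_tau0 hV) v1.
  have [i1|i1] := ltP i 0; first by rewrite (vd_tau hV)// scale0r.
  by rewrite v0 ?scaler0//; move: i0; rewrite neq_lt; lia.
- move=> u n v Uu [v0 v1].
  have [k [G hG e]] := SL_U hV v Uu.
  have lu := calEB (vd_lin hV Uu).
  have pq (p q : int) : q < 0 -> prod2 (psi u) (psi v) vac p q = 0.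
    by move=> q0; rewrite /prod2 v0// (zmod_morph0 lu).
  pose A := iter k (@mul_sub V) (prod2 (psi u) (psi v) vac).
  have Aq p q : q < 0 -> A p q = 0 by move=> q0; apply: (@iter_mul_sub_low _ k _ 0 pq).
  have Ap p q : p < 0 -> A p q = 0.
    by move=> p0; rewrite /A e; exact: Good_vac hG _ _ p0.
  have hk : local2 k (prod2 (psi u) (psi v) vac).
    by exists 0 => p q /orP[p0|q0]; [exact: Ap|exact: Aq].
  have [k' hk'] := compat_all hV u v.
  have E m : psi (mode (psi u) n v) vac m = sb A (k%:Z + (- n - 1)) m.
    by rewrite (vd_mode hV)// (nprodE _ _ _ hk') (SubE _ _ hk).
  split=> [m m0|]; rewrite E sbE.
    apply: isum0 => p; have [p0|p0] := ltP p 0; first by rewrite Ap ?mul0rz.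
    have [pm|mp] := ltP p (k%:Z + (- n - 1)); first by rewrite bz_small ?mulr0z.
    by rewrite Aq ?mul0rz//; lia.
  (* Only p = j can contribute: the binomial coefficient vanishes for 0 <= p < j, and for p > j the
     exponent of x2 is negative. *)
  set j := k%:Z + _; rewrite (@isum1 _ _ j) => [|p pj]; last first.
    have [p0|p0] := ltP p 0; first by rewrite Ap ?mul0rz.
    have [pm|mp] := ltP p j; first by rewrite bz_small ?mulr0z.
    by rewrite Aq ?mul0rz//; move: pj mp; rewrite neq_lt; lia.
  have -> : 0 + j - j = 0 by lia.
  have Aj : A j 0 = mode (psi u) n v.
    by rewrite /A iter_mul_sub_const// /prod2 v1 /mode /j addrAC subrr add0r.
  have [j0|j0] := ltP j 0; first by rewrite -Aj Ap// mul0rz.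
  rewrite Aj; suff -> : bz j j = 1 by rewrite mulr1z.
  by case: (j) j0 => // i _; rewrite /bz /= binn.
Qed.

End Creation.

(** * The embedding of fractions f(t + x1, t + x2) *)

Lemma frac_repr (R : idomainType) (x : {fraction R}) :
  x = FracField.tofrac \n_(repr x) / FracField.tofrac \d_(repr x).
Proof.
have d0 := denom_ratioP (repr x).
rewrite -[LHS]reprK; unlock FracField.tofrac.
rewrite -[X in _ = _ * X]FracField.pi_inv -[RHS]FracField.pi_mul.
rewrite /FracField.mulf /FracField.invf !numden_Ratio ?oner_neq0 ?mulr1 ?mul1r//.
by rewrite Ratio_numden.
Qed.

Definition subring (R : comNzRingType) (A : R -> Prop) : Prop :=
  [/\ A 0, A 1, forall x y, A x -> A y -> A (x + y),
    forall x, A x -> A (- x) & forall x y, A x -> A y -> A (x * y)].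

Section LaurentProducts.
Variable R : comNzRingType.
Implicit Types f g : lser R.

Lemma lD_mul f g : lD (f * g) = lD f * g + f * lD g.
Proof. exact: (@lD_scale R R^o f g). Qed.

Lemma lm_deriv_mul (d : R -> R) f g : zmod_morphism d ->
  (forall x y, d (x * y) = d x * y + x * d y) ->
  lm d (f * g) = lm d f * g + f * lm d g.
Proof. by move=> dB hd; exact: (@lm_deriv R R^o d d f g dB dB hd). Qed.

Lemma lm_mul (S : comNzRingType) (th : R -> S) f g : zmod_morphism th ->
  (forall x y, th (x * y) = th x * th y) -> lm th (f * g) = lm th f * lm th g.
Proof. by move=> thB hth; exact: (@lm_scaleT R S R^o S^o th th f g thB thB hth). Qed.

Lemma coefM_lead f g : (forall n, n < 0 -> f n = 0) -> (forall n, n < 0 -> g n = 0) ->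
  (f * g) 0 = f 0 * g 0.
Proof. by move=> hf hg; have := lmul_lead hf hg; rewrite addr0. Qed.

(** Nested twice, this describes A[[x1, x2]] inside the iterated Laurent series, where inverses can
    be formed. *)
Definition in_pser (A : R -> Prop) (f : lser R) : Prop :=
  (forall n, n < 0 -> f n = 0) /\ forall n, A (f n).

Lemma in_pser_mul A f g : subring A -> in_pser A f -> in_pser A g -> in_pser A (f * g).
Proof.
move=> [A0 _ AD _ AM] [f0 fA] [g0 gA].
have e n := @lmul_bound R f g 0 0 n (absz n).+1 f0 g0.
split=> n => [n0|].
  by rewrite (@lmul_bound R f g 0 0 n 0 f0 g0) ?big_nil//; lia.
rewrite e; last by lia.
by elim/big_rec: _ => // i x _; apply: AD; exact: AM.
Qed.

Lemma in_pserD A f g : subring A -> in_pser A f -> in_pser A g -> in_pser A (f + g).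
Proof.
move=> [_ _ AD _ _] [f0 fA] [g0 gA]; split=> n => [n0|]; rewrite lcoefD; last exact: AD.
by rewrite f0// g0// addr0.
Qed.

Lemma in_pserN A f : subring A -> in_pser A f -> in_pser A (- f).
Proof.
move=> [_ _ _ AN _] [f0 fA]; split=> n => [n0|]; rewrite lcoefN; last exact: AN.
by rewrite f0// oppr0.
Qed.

Lemma in_pser_const A c : subring A -> A c -> in_pser A (lconst c).
Proof.
move=> [A0 _ _ _ _] Ac; split=> n; rewrite lconstE; last by case: eqP.
by case: eqP => // ->.
Qed.

Lemma subring_pser A : subring A -> subring (in_pser A).
Proof.
move=> hA; have [A0 A1 _ _ _] := hA; split.
- by split=> n; rewrite lcoef0.
- exact: (in_pser_const hA A1).
- by move=> f g; exact: in_pserD.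
- by move=> f; exact: in_pserN.
- by move=> f g; exact: in_pser_mul.
Qed.

End LaurentProducts.

(** Comparing lowest coefficients shows that the inverse has no negative power; the usual recursion
    then keeps its coefficients in [A]. *)
Lemma in_pser_inv (R : fieldType) (A : R -> Prop) (s : lser R) :
  subring A -> in_pser A s -> s 0 != 0 -> A (s 0)^-1 -> in_pser A s^-1.
Proof.
move=> hA [s0 sA] u0 uA; have [A0 A1 AD AN AM] := hA.
have sn0 : s != 0 by apply: contraNneq u0 => ->; rewrite lcoef0.
pose g := s^-1; have gs : g * s = 1 by rewrite /g mulVf.
have gn0 : g != 0 by rewrite invr_eq0.
have g0 n : n < 0 -> g n = 0.
  have [a [ga hg]] := lser_lead gn0.
  have := lmul_lead hg s0; rewrite gs addr0 lcoef1; case: eqP => [a0 _|_ /esym/eqP].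
    by rewrite -a0; exact: hg.
  by rewrite mulf_eq0 (negPf ga) (negPf u0).
have rec (n : nat) : g n%:Z = (s 0)^-1 *
    ((n == 0%N)%:R - \sum_(i < n) g i%:Z * s (n%:Z - i%:Z)).
  have := @lmul_bound R g s 0 0 n n.+1 g0 s0; rewrite gs lcoef1.
  rewrite big_map -[X in iota 0 X]subn0 -/(index_iota 0 n.+1) big_mkord big_ord_recr /=.
  rewrite !add0r subrr => e; rewrite -(_ : (n%:Z == 0) = (n == 0%N))//.
  rewrite e; last by lia.
  under eq_bigr do rewrite add0r.
  by rewrite addrAC subrr add0r mulrCA mulVf// mulr1.
split=> // n; case: n => [n|n]; last by rewrite g0.
elim/ltn_ind: n => n IH; rewrite rec; apply: (AM) => //; apply: (AD).
  by case: eqP.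
by apply: AN; elim/big_rec: _ => // i x _ Ax; apply: (AD) => //; apply: (AM) => //; exact: IH.
Qed.

(* iota_{t,x2,x1} g(t + x1, t + x2), for g in F[[x1, x2]] *)
HB.lock Definition sigma (F : fieldType) (g : pser (pser F)) : lser (lser (lser F)) :=
  iota_pser (shift_t_pser g).
Arguments sigma {F} g.

Section Sigma.
Variable F : fieldType.
Hypothesis charF : [pchar F] =i pred0.

Local Notation Fx12 := (pser (pser F)).

Definition cf (g : Fx12) (i j : nat) : F := pcoef (pcoef g i) j.

Lemma pser_neg (R : comNzRingType) (f : pser R) n : n < 0 -> val f n = 0.
Proof. by case: f => f /= /asboolP; apply. Qed.

Lemma pserP (R : comNzRingType) (f g : pser R) : (forall i, pcoef f i = pcoef g i) -> f = g.
Proof.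
move=> fg; apply: val_inj; apply: lserP => -[n|n]; first exact: fg.
by rewrite !pser_neg.
Qed.

Lemma cfP (g g' : Fx12) : (forall i j, cf g i j = cf g' i j) -> g = g'.
Proof. by move=> e; apply: pserP => i; apply: pserP => j; exact: e. Qed.

Lemma cf0 i j : cf 0 i j = 0. Proof. by []. Qed.

Lemma pcoefB (R : comNzRingType) (f g : pser R) i : pcoef (f - g) i = pcoef f i - pcoef g i.
Proof. by rewrite /pcoef raddfB lcoefD lcoefN. Qed.

Lemma cfB (g g' : Fx12) i j : cf (g - g') i j = cf g i j - cf g' i j.
Proof. by rewrite /cf !pcoefB. Qed.

Definition mk12 (c : nat -> nat -> F) : Fx12 := mkP (fun i => mkP (c i)).

Lemma cf_mk12 c i j : cf (mk12 c) i j = c i j.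
Proof. by rewrite /cf /mk12 !pcoef_mkP. Qed.

Lemma valB (R : comNzRingType) : zmod_morphism (@lser_of_pser R).
Proof. by []. Qed.

Lemma valM (R : comNzRingType) (f g : pser R) :
  lser_of_pser (f * g) = lser_of_pser f * lser_of_pser g.
Proof. exact: (rmorphM (val : pser R -> lser R)). Qed.

Definition emb (g : Fx12) : lser (lser F) := lm (@lser_of_pser F) (val g).

Lemma embB : zmod_morphism emb.
Proof. by move=> x y; rewrite /emb raddfB (lm_is_zmod_morphism (@valB F)). Qed.

Lemma iota_emb (x : pser Fx12) : iota_pser x = lm emb (lser_of_pser x).
Proof. exact: erefl. Qed.

Lemma sigma_emb g : sigma g = lm emb (lser_of_pser (shift_t_pser g)).
Proof. by rewrite unlock iota_emb. Qed.

Lemma sigma_nat (g : Fx12) (i j k : nat) :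
  sigma g i%:Z j%:Z k%:Z = k`!%:R^-1 * iter k (@deriv12 F) (cf g) i j.
Proof.
rewrite sigma_emb (lmE _ i embB) (lmE _ j (@valB F)).
rewrite -[LHS]/(pcoef (pcoef (pcoef (shift_t_pser g) i) j) k).
by rewrite /shift_t_pser !pcoef_mkP.
Qed.

Lemma sigma_neg (g : Fx12) i j k : [|| i < 0, j < 0 | k < 0] -> sigma g i j k = 0.
Proof.
rewrite sigma_emb (lmE _ i embB) (lmE _ j (@valB F)) => /or3P[i0|j0|k0].
- by rewrite [val (shift_t_pser g) i]pser_neg.
- by rewrite [val (val (shift_t_pser g) i) j]pser_neg.
- by rewrite pser_neg.
Qed.

Lemma natF_neq0 n : n.+1%:R != 0 :> F.
Proof. by rewrite ((pcharf0P F).1 charF). Qed.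

End Sigma.

Lemma lm_mul_on (R S : comNzRingType) (P : R -> Prop) (th : R -> S) (f g : lser R) :
  zmod_morphism th -> (forall x y, P x -> P y -> th (x * y) = th x * th y) ->
  (forall n, P (f n)) -> (forall n, P (g n)) -> lm th (f * g) = lm th f * lm th g.
Proof.
move=> thB hth hf hg.
apply: (@lm_scale R S R^o S^o [pred x | `[< P x >]] P th th f g thB thB) => //.
  by move=> n; apply/asboolP; exact: hf.
by move=> r x /asboolP Pr Px; exact: hth.
Qed.

Lemma leibniz_rearrange (R : comNzRingType) (a b x y x' y' : R) :
  (x + y) * b + a * (x' + y') = x * b + a * x' + (y * b + a * y').
Proof. by rewrite mulrDl mulrDr addrACA. Qed.

Section SigmaMorphism.
Variable F : fieldType.
Hypothesis charF : [pchar F] =i pred0.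

Local Notation K := (lser F).
Local Notation Fx12 := (pser (pser F)).
Local Notation L3 := (lser (lser (lser F))).
Local Notation D1 := (@lD (lser (lser F))).
Local Notation D2 := (lm (@lD (lser F))).
Local Notation Dt := (lm (lm (@lD F))).
Implicit Types g : Fx12.

Lemma field_torsion_free : torsion_free F.
Proof.
move=> x n /eqP; rewrite -mulr_natl mulf_eq0 (negPf (natF_neq0 charF n)) /=.
by move/eqP.
Qed.

Lemma D1E (s : L3) i j k : D1 s i j k = s (i + 1) j k *~ (i + 1).
Proof. by rewrite lDE !lcoefMz. Qed.

Lemma D2E (s : L3) i j k : D2 s i j k = s i (j + 1) k *~ (j + 1).
Proof. by rewrite (lmE s i (@lDB _)) lDE lcoefMz. Qed.

Lemma DtE (s : L3) i j k : Dt s i j k = s i j (k + 1) *~ (k + 1).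
Proof.
by rewrite (lmE s i (lm_is_zmod_morphism (@lDB F))) (lmE (s i) j (@lDB F)) lDE.
Qed.

Lemma lser3P (s s' : L3) : (forall i j k, s i j k = s' i j k) -> s = s'.
Proof. by move=> e; apply: lserP => i; apply: lserP => j; apply: lserP => k. Qed.

Definition nneg3 (s : L3) : Prop := forall i j k, [|| i < 0, j < 0 | k < 0] -> s i j k = 0.

Definition zcf (g : Fx12) (i j : int) : F :=
  if i is Posz i' then if j is Posz j' then cf g i' j' else 0 else 0.

Lemma sigma0 g i j : sigma g i j 0 = zcf g i j.
Proof.
case: i => [i|i]; last by rewrite sigma_neg.
case: j => [j|j]; last by rewrite sigma_neg// orbT.
by rewrite -[0]/(Posz 0) sigma_nat /= invr1 mul1r.
Qed.

Lemma sigma_ode g : Dt (sigma g) = D1 (sigma g) + D2 (sigma g).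
Proof.
apply: lser3P => i j k; rewrite lcoef3D D1E D2E DtE.
have [k0|k0] := ltP k 0.
  rewrite [sigma g (i + 1) j k]sigma_neg ?k0 ?orbT// [sigma g i (j + 1) k]sigma_neg ?k0 ?orbT//.
  have [->|k1] := eqVneq k (-1); first by rewrite addNr mulr0z !mul0rz addr0.
  rewrite sigma_neg ?mul0rz ?addr0//; apply/or3P; apply: Or33.
  by move: k1 k0; rewrite neq_lt; lia.
case: k k0 => // k _; case: i => [i|i]; last first.
  rewrite [sigma g _ j (k%:Z + 1)]sigma_neg// [sigma g _ (j + 1) k]sigma_neg// !mul0rz addr0.
  have [->|i0] := eqVneq (Negz i + 1) 0; first by rewrite mulr0z.
  by rewrite sigma_neg ?mul0rz//; move: i0; rewrite neq_lt; lia.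
case: j => [j|j]; last first.
  rewrite [sigma g i _ (k%:Z + 1)]sigma_neg ?orbT// [sigma g _ (Negz j) k]sigma_neg ?orbT//.
  rewrite !mul0rz add0r; have [->|i0] := eqVneq (Negz j + 1) 0; first by rewrite mulr0z.
  by rewrite sigma_neg ?mul0rz//; move: i0; rewrite neq_lt; lia.
rewrite -!PoszD !addn1 !sigma_nat iterS /deriv12 -!pmulrn.
rewrite -[LHS]mulr_natl -[X in _ = X + _]mulr_natl -[X in _ = _ + X]mulr_natl.
rewrite factS natrM invfM !mulrA divff ?natF_neq0// mul1r mulrDr !mulrA.
by rewrite ![k`!%:R^-1 * _]mulrC.
Qed.

(* exp(t (d/dx1 + d/dx2)) g is the solution of ds/dt = ds/dx1 + ds/dx2 whose
   value at t = 0 is g; this makes sigma a ring morphism. *)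
Lemma sigma_unique s g : nneg3 s -> Dt s = D1 s + D2 s ->
  (forall i j, s i j 0 = zcf g i j) -> s = sigma g.
Proof.
move=> hs ode s0; apply: lser3P => i j k.
case: k => [k|k]; last by rewrite hs ?sigma_neg ?orbT.
elim: k i j => [|k IH] i j; first by rewrite s0 sigma0.
apply: (tf_mulrz (n := k) field_torsion_free).
rewrite -[k.+1]addn1 PoszD -(DtE s) -(DtE (sigma g)) ode sigma_ode.
rewrite (lcoef3D (D1 s) (D2 s) i j k) (lcoef3D (D1 (sigma g)) (D2 (sigma g)) i j k).
rewrite (D1E s i j k) (D1E (sigma g) i j k) (D2E s i j k) (D2E (sigma g) i j k).
by rewrite !IH.
Qed.

Lemma sigma_nneg g : nneg3 (sigma g).
Proof. by move=> i j k; exact: sigma_neg. Qed.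

Lemma lcoef3B (s t : L3) i j k : (s - t) i j k = s i j k - t i j k.
Proof. by rewrite lcoef3D (lcoefN t) (lcoef2N _ j). Qed.

Lemma zcfB g g' i j : zcf (g - g') i j = zcf g i j - zcf g' i j.
Proof.
rewrite /zcf; case: i => i; last by rewrite subr0.
by case: j => j; [exact: cfB|rewrite subr0].
Qed.

Lemma sigmaB : zmod_morphism (@sigma F).
Proof.
move=> g g'; apply/esym/sigma_unique => [i j k h||i j].
- by rewrite lcoef3B !sigma_neg// subr0.
- rewrite (lm_is_zmod_morphism (lm_is_zmod_morphism (@lDB F))).
  rewrite (lm_is_zmod_morphism (@lDB K)) lDB !sigma_ode opprD addrACA.
  by [].
- by rewrite (lcoef3B (sigma g) (sigma g') i j 0) !sigma0 zcfB.
Qed.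

Definition dser1 (g : Fx12) : Fx12 := mk12 (fun i j => cf g i.+1 j *+ i.+1).
Definition dser2 (g : Fx12) : Fx12 := mk12 (fun i j => cf g i j.+1 *+ j.+1).

(** d/dx1 commutes with the differential equation [sigma_ode], so both sides solve it with the same
    value at t = 0. *)
Lemma sigma_d1 g : D1 (sigma g) = sigma (dser1 g).
Proof.
apply: sigma_unique => [i j k h||i j].
- rewrite D1E; have [->|i0] := eqVneq (i + 1) 0; first by rewrite mulr0z.
  by rewrite sigma_neg ?mul0rz//; move: h i0; rewrite neq_lt; lia.
- apply: lser3P => i j k; rewrite lcoef3D DtE D2E !D1E.
  rewrite -mulrzA mulrC mulrzA -DtE sigma_ode lcoef3D D1E D2E mulrzDl.
  by congr (_ + _); rewrite -!mulrzA mulrC.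
- rewrite D1E sigma0; case: i => [i|i]; last first.
    have [->|i0] := eqVneq (Negz i + 1) 0; first by rewrite mulr0z.
    rewrite /zcf; case e : (Negz i + 1) => [m|m]; last by rewrite mul0rz.
    by move: e i0; lia.
  rewrite -PoszD addn1; case: j => [j|j] /=; last by rewrite mul0rz.
  by rewrite cf_mk12.
Qed.

Lemma sigma_d2 g : D2 (sigma g) = sigma (dser2 g).
Proof.
apply: sigma_unique => [i j k h||i j].
- rewrite D2E; have [->|i0] := eqVneq (j + 1) 0; first by rewrite mulr0z.
  by rewrite sigma_neg ?mul0rz//; move: h i0; rewrite neq_lt; lia.
- apply: lser3P => i j k; rewrite lcoef3D DtE D1E !D2E.
  rewrite -mulrzA mulrC mulrzA -DtE sigma_ode lcoef3D D1E D2E mulrzDl.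
  by rewrite -!mulrzA [(i + 1) * (j + 1)]mulrC.
- rewrite D2E sigma0; case: i => [i|i]; last by rewrite /= mul0rz.
  case: j => [j|j]; last first.
    have [->|i0] := eqVneq (Negz j + 1) 0; first by rewrite mulr0z.
    rewrite /zcf; case e : (Negz j + 1) => [m|m]; last by rewrite mul0rz.
    by move: e i0; lia.
  by rewrite -PoszD addn1 /= cf_mk12.
Qed.

Lemma embE g i j : emb g i j = zcf g i j.
Proof.
rewrite (lmE (val g) i (@valB F)); case: i => [i|i]; last by rewrite pser_neg.
case: j => [j|j]; first exact: erefl.
exact: (pser_neg (val g i)).
Qed.

Lemma embM g g' : emb (g * g') = emb g * emb g'.
Proof.
rewrite /emb rmorphM; apply: lm_mul; first exact: valB.
exact: valM.
Qed.

Lemma emb_inj : injective (@emb F).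
Proof.
move=> g g' e; apply: cfP => i j.
by have := embE g i%:Z j%:Z; rewrite e embE.
Qed.

Let T0 (x : F) : Prop := True.
Lemma subring_T (R : comNzRingType) : subring (fun _ : R => True).
Proof. by []. Qed.

Lemma nneg3P (s : L3) : nneg3 s <-> in_pser (in_pser (in_pser T0)) s.
Proof.
split=> [hs|[h1 h2] i j k /or3P[i0|j0|k0]].
- split=> [i i0|i].
    by apply: lserP => j; apply: lserP => k; rewrite hs ?i0.
  split=> [j j0|j]; first by apply: lserP => k; rewrite hs ?j0 ?orbT.
  by split=> // k k0; rewrite hs ?k0 ?orbT.
- by rewrite h1.
- by rewrite (h2 i).1.
- by rewrite ((h2 i).2 j).1.
Qed.

Lemma nneg3M s s' : nneg3 s -> nneg3 s' -> nneg3 (s * s').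
Proof.
have h3 : subring (in_pser (in_pser T0)) by exact/subring_pser/subring_pser/subring_T.
by move=> /nneg3P hs /nneg3P hs'; apply/nneg3P/in_pser_mul.
Qed.

Lemma sigmaM g g' : sigma (g * g') = sigma g * sigma g'.
Proof.
apply/esym/sigma_unique.
- by apply: nneg3M; exact: sigma_nneg.
- have d2 (x y : lser (lser F)) :
      lm (@lD F) (x * y) = lm (@lD F) x * y + x * lm (@lD F) y.
    by apply: lm_deriv_mul; [exact: lDB|exact: lD_mul].
  rewrite lD_mul (@lm_deriv_mul _ (@lD K)); [|exact: lDB|exact: lD_mul].
  rewrite (@lm_deriv_mul _ (lm (@lD F))) //; last exact/lm_is_zmod_morphism/lDB.
  by rewrite (sigma_ode g) (sigma_ode g'); exact: leibniz_rearrange.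
(* Setting t = 0 is multiplicative on power series in t, and it takes [sigma] to [emb]. *)
- move=> i j; have c0 (s : L3) : lm (lm (@coef F 0)) s i j = s i j 0.
    rewrite (lmE s i (lm_is_zmod_morphism (@coefB F 0))).
    by rewrite (lmE (s i) j (@coefB F 0)).
  rewrite -c0 -embE embM.
  have hP (g0 : Fx12) := (nneg3P _).1 (sigma_nneg g0).
  rewrite (@lm_mul_on _ _ (in_pser (in_pser T0)) (lm (@coef F 0))); first last.
  + exact: (hP g').2.
  + exact: (hP g).2.
  + move=> x y [_ hx] [_ hy]; apply: (@lm_mul_on _ _ (in_pser T0)) => //.
    by move=> f f' [hf _] [hf' _]; exact: coefM_lead.
  + exact/lm_is_zmod_morphism/coefB.
  suff e g0 : lm (lm (@coef F 0)) (sigma g0) = emb g0 by rewrite !e.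
  apply: lserP => p; apply: lserP => q; rewrite embE -sigma0.
  rewrite (lmE _ p (lm_is_zmod_morphism (@coefB F 0))).
  by rewrite (lmE _ q (@coefB F 0)).
Qed.

End SigmaMorphism.

(** * Poles of p(t + x1, t + x2)^-1 *)

(** The representative [repr y] is arbitrary; cross multiplication makes the quotient of images
    independent of it. *)
Lemma frac_morph (R : idomainType) (L : fieldType) (phi : R -> L) (a b : R)
    (y : {fraction R}) :
  (forall x x', phi (x * x') = phi x * phi x') -> (forall x, x != 0 -> phi x != 0) ->
  b != 0 -> y = FracField.tofrac a / FracField.tofrac b ->
  phi \n_(repr y) / phi \d_(repr y) = phi a / phi b.
Proof.
move=> phiM phi0 b0 ey; have d0 := denom_ratioP (repr y).
have : \n_(repr y) * b = a * \d_(repr y).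
  apply/eqP; rewrite -tofrac_eq !rmorphM /=; apply/eqP.
  have bF : FracField.tofrac b != 0 by rewrite tofrac_eq0.
  have dF : FracField.tofrac \d_(repr y) != 0 by rewrite tofrac_eq0.
  apply: (mulIf (invr_neq0 dF)); rewrite mulrAC -frac_repr {1}ey.
  by rewrite (mulfVK bF) (mulfK dF).
move=> /(congr1 phi); rewrite !phiM => e.
apply/eqP; rewrite eqr_div ?phi0//; apply/eqP.
by rewrite e.
Qed.

Section Poles.
Variable F : fieldType.
Hypothesis charF : [pchar F] =i pred0.

Local Notation K := (lser F).
Local Notation Fx12 := (pser (pser F)).
Local Notation x12 := (lX (lser K) - lconst (lX K)).
Implicit Types p g : Fx12.

Lemma emb_neq0 p : p != 0 -> emb p != 0.
Proof.
by apply: contraNneq => e; apply/eqP; apply: emb_inj; rewrite e (zmod_morph0 (@embB F)).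
Qed.

Lemma emb1 : emb (1 : Fx12) = 1.
Proof.
have e0 := emb_neq0 (oner_neq0 Fx12).
by apply: (mulfI e0); rewrite -embM !mulr1.
Qed.

Lemma sigma_neq0 p : p != 0 -> sigma p != 0.
Proof.
apply: contraNneq => e; apply/eqP; apply: cfP => i j.
by have := sigma0 p i%:Z j%:Z; rewrite e /= => <-.
Qed.

Lemma sigma1 : sigma (1 : Fx12) = 1.
Proof.
have s0 := sigma_neq0 (oner_neq0 Fx12).
by apply: (mulfI s0); rewrite -sigmaM// !mulr1.
Qed.

Definition hi2 (N : int) (s : lser (lser F)) : Prop :=
  forall i j, (N <= i) || (N <= j) -> s i j = 0.

Lemma hi2M N N' s s' : hi2 N s -> hi2 N' s' -> hi2 (N + N') (s * s').
Proof.
move=> hs hs' i j; rewrite lcoefM => h.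
rewrite lcoef_isum; last exact: (@lscale_fin_supp _ (lser F)^o s s' i).
apply: isum0 => a; rewrite lcoefM; apply: isum0 => b.
have [aN|Na] := boolP ((N <= a) || (N <= b)); first by rewrite hs// mul0r.
by rewrite [X in _ * X]hs' ?mulr0//; move: h Na; lia.
Qed.

Lemma polynomial2P p : polynomial2 p <-> exists N, hi2 N (emb p).
Proof.
split=> [[N hN]|[N hN]].
  exists N%:Z => i j ij; rewrite embE; case: i ij => // i; case: j => // j ij.
  by apply: hN; move: ij; rewrite !lez_nat.
exists (absz N) => i j ij; rewrite -[LHS]/(zcf p i%:Z j%:Z) -embE.
by apply: hN; move: ij; lia.
Qed.

Lemma polynomial2M p g : polynomial2 p -> polynomial2 g -> polynomial2 (p * g).
Proof.
move=> /polynomial2P[N hN] /polynomial2P[N' hN'].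
by apply/polynomial2P; exists (N + N'); rewrite embM; exact: hi2M.
Qed.

Lemma polynomial2_int (k : int) : polynomial2 (1 *~ k : Fx12).
Proof.
apply/polynomial2P; exists 1 => i j ij.
rewrite (zmod_morphMz (@embB F)) emb1 !lcoefMz lcoef1.
case: eqP ij => [->|_ _]; last by rewrite mul0rz.
case/orP=> //= j1; rewrite lcoef1; case: eqP j1 => [->|] //.
by rewrite mul0rz.
Qed.

Definition X12 : Fx12 := mk12 (fun i j =>
  ((i == 1%N) && (j == 0%N))%:R - ((i == 0%N) && (j == 1%N))%:R).

Lemma sub_lXE (R : comNzRingType) i j :
  (lX (lser R) - lconst (lX R)) i j =
  ((i == 1) && (j == 0))%:R - ((i == 0) && (j == 1))%:R.
Proof.
rewrite lcoef2B lXE lconstE; congr (_ - _).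
  by case: (i == 1) => //=; rewrite lcoef1.
by case: (i == 0) => //=; rewrite lXE.
Qed.

Lemma emb_X12 : emb X12 = lX (lser F) - lconst (lX F).
Proof.
apply: lserP => i; apply: lserP => j; rewrite embE sub_lXE.
case: i => [i|i]; last by rewrite subrr.
by case: j => [j|j]; rewrite /= ?andbF ?subrr// cf_mk12.
Qed.

Lemma polynomial2_X12 : polynomial2 X12.
Proof.
exists 2%N => i j; rewrite -/(cf X12 i j) cf_mk12.
by case: i => [|[|i]]; case: j => [|[|j]] //= _; rewrite subrr.
Qed.

Lemma X12_neq0 : X12 != 0.
Proof.
apply/eqP => /(congr1 (fun g => cf g 1 0)); rewrite cf_mk12 /= subr0 cf0.
by move/eqP; rewrite oner_eq0.
Qed.

(** The variable t cancels in (t + x1) - (t + x2). *)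
Lemma sigma_X12 : sigma X12 = x12.
Proof.
have kE i j k : x12 i j k =
    (((i == 1) && (j == 0))%:R - ((i == 0) && (j == 1))%:R) *+ (k == 0) :> F.
  rewrite sub_lXE lcoefD lcoefN.
  have e (b : bool) : (b%:R : K) k = b%:R *+ (k == 0) :> F.
    by case: b => /=; rewrite ?lcoef1 ?lcoef0 ?mul0rn//; case: eqP.
  by rewrite !e -mulrnBl.
apply/esym/(sigma_unique charF) => [i j k h|//|i j].
- rewrite kE; have [k0|k0] := eqVneq k 0; last by rewrite mulr0n.
  have -> : (i == 1) && (j == 0) = false by apply/negP => /andP[/eqP a /eqP b]; move: h; lia.
  have -> : (i == 0) && (j == 1) = false by apply/negP => /andP[/eqP a /eqP b]; move: h; lia.
  by rewrite subrr mul0rn.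
- apply: lser3P => i j k; rewrite lcoef3D DtE D1E D2E !kE.
  have -> : (((i == 1) && (j == 0))%:R - ((i == 0) && (j == 1))%:R) *+ (k + 1 == 0)
      *~ (k + 1) = 0 :> F.
    case: (k + 1 =P 0) => [->|_]; first by rewrite mulr0z.
    exact: mul0rz.
  have [k0|k0] := eqVneq k 0; last by rewrite !mulr0n !mul0rz addr0.
  rewrite !mulr1n (_ : (i + 1 == 1) = (i == 0)); last by apply/eqP/eqP; lia.
  rewrite (_ : (j + 1 == 1) = (j == 0)); last by apply/eqP/eqP; lia.
  have -> : (i + 1 == 0) && (j == 1) = (j == 1) && (i == -1).
    by rewrite andbC; congr (_ && _); apply/eqP/eqP; lia.
  have -> : (i == 1) && (j + 1 == 0) = (i == 1) && (j == -1).
    by congr (_ && _); apply/eqP/eqP; lia.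
  have z (b : bool) (a c : int) : (b && (a == - 1))%:R *~ (a + 1) = 0 :> F.
    by have [->|_] := eqVneq a (-1); rewrite ?andbT ?andbF ?addNr ?mulr0z ?mul0rz.
  rewrite !mulrzBl !z// subr0 sub0r.
  have [->|i0] := eqVneq i 0; last by rewrite ?andbF /= !mul0rz ?subr0 ?oppr0 ?addr0.
  have [->|j0] := eqVneq j 0; last by rewrite ?andbF /= !mul0rz ?subr0 ?oppr0 ?addr0.
  by rewrite !add0r subrr.
- rewrite kE eqxx mulr1n; case: i => [i|i]; last by rewrite subrr.
  by case: j => [j|j]; rewrite /= ?andbF ?subrr// cf_mk12.
Qed.

End Poles.

(* The derivative of the fraction h = g / p, written without division *)
Lemma frac_deriv (R : comNzRingType) (p h g p' h' g' : R) :
  p * h = g -> p' * h + p * h' = g' -> p * p * h' = p * g' - p' * g.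
Proof. by move=> <- <-; ring. Qed.

(** * The ring of coefficients regular at x1 = x2 *)

Section FractionRing.
Variable F : fieldType.
Hypothesis charF : [pchar F] =i pred0.

Local Notation K := (lser F).
Local Notation Fx12 := (pser (pser F)).
Local Notation L3 := (lser (lser K)).
Implicit Types (p g : Fx12) (h : L3).

Lemma subring_mulz (R : comNzRingType) (A : R -> Prop) x (k : int) :
  subring A -> A x -> A (x *~ k).
Proof.
move=> [A0 _ AD AN _] Ax; have An n : A (x *+ n).
  by elim: n => [|n IH]; rewrite ?mulr0n ?mulrS//; exact: AD.
by case: k => n; [exact: An|rewrite NegzE mulrNz; apply: AN; exact: An].
Qed.

Lemma in_pser_lD (R : comNzRingType) (A : R -> Prop) f :
  subring A -> in_pser A f -> in_pser A (lD f).
Proof.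
move=> hA [f0 fA]; split=> n; rewrite lDE; last exact: subring_mulz.
move=> n0; have [->|n1] := eqVneq (n + 1) 0; first by rewrite mulr0z.
by rewrite f0 ?mul0rz//; move: n0 n1; rewrite neq_lt; lia.
Qed.

Lemma in_pser_lm (R : comNzRingType) (A : R -> Prop) (th : R -> R) f :
  zmod_morphism th -> (forall x, A x -> A (th x)) -> in_pser A f -> in_pser A (lm th f).
Proof.
move=> thB hth [f0 fA]; split=> n; rewrite (lmE f n thB); last exact: hth.
by move=> n0; rewrite f0// (zmod_morph0 thB).
Qed.

Definition pser2 : L3 -> Prop := in_pser (in_pser (fun _ : K => True)).

(** The regular expansions of g(t + x1, t + x2) / p(t + x1, t + x2). The fraction is recorded by
    cross multiplication, so that products and derivatives need no division. *)
Definition setA h : Prop :=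
  pser2 h /\
  exists p g, [/\ polynomial2 p, p != 0 & sigma p * h = sigma g].

Let sub1 : subring (in_pser (fun _ : K => True)) := subring_pser (@subring_T K).
Lemma sigma_in_pser p : pser2 (sigma p).
Proof.
have [h1 h2] := (nneg3P _).1 (@sigma_nneg F p).
split=> // i; have [h3 h4] := h2 i; split=> // j.
Qed.

Lemma setA_sigma p : setA (sigma p).
Proof.
split; first exact: sigma_in_pser.
exists 1, p; split; rewrite ?oner_neq0//.
  exact: (polynomial2_int F 1).
by rewrite (sigma1 charF) mul1r.
Qed.

Lemma setA_deriv (D : L3 -> L3) (d : Fx12 -> Fx12) h :
  (forall x y, D (x * y) = D x * y + x * D y) -> (forall g, D (sigma g) = sigma (d g)) ->
  pser2 (D h) ->
  setA h -> setA (D h).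
Proof.
move=> DM Ds hD [_ [p [g [pp p0 e]]]]; split=> //.
exists (p * p), (p * d g - d p * g); split; [exact: polynomial2M|by rewrite mulf_neq0|].
rewrite (sigmaB charF) !(sigmaM charF).
by apply: (frac_deriv (h := h) e); rewrite -!Ds -DM e.
Qed.

Lemma natK_neq0 n : n.+1%:R != 0 :> K.
Proof.
apply/eqP => /(congr1 (fun f : K => f 0)).
rewrite -[n.+1%:R]/(1 *~ n.+1%:Z) lcoefMz lcoef1 lcoef0 /= => /eqP.
by rewrite (negPf (natF_neq0 charF n)).
Qed.

Lemma setA_coefficient_ring : coefficient_ring setA.
Proof.
split.
- by rewrite -(sigma1 charF); exact: setA_sigma.
- move=> h h' [hh [p [g [pp p0 e]]]] [hh' [p' [g' [pp' p0' e']]]].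
  split; first exact: in_pser_mul.
  exists (p * p'), (g * g'); split; [exact: polynomial2M|by rewrite mulf_neq0|].
  by rewrite !(sigmaM charF) mulrACA e e'.
- move=> k; suff -> : k%:~R = sigma (1 *~ k : Fx12) by exact: setA_sigma.
  by rewrite (zmod_morphMz (sigmaB charF)) sigma1.
- move=> n.
  have c1 : lconst (lconst (n.+1%:R^-1 : K)) *+ n.+1 = 1.
    have e : (n.+1%:R^-1 : K) *+ n.+1 = 1 by rewrite -[LHS]mulr_natr mulVf ?natK_neq0.
    have eM (x : K) m : lconst (lconst x) *+ m = lconst (lconst (x *+ m)).
      by rewrite !raddfMn.
    by rewrite eM e.
  exists (lconst (lconst n.+1%:R^-1)); last first.
    exact: c1.
  split; first by apply: (in_pser_const sub1); apply: in_pser_const.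
  exists (1 *~ n.+1), 1; split; first exact: polynomial2_int.
    apply/eqP => /(congr1 (@emb F)); rewrite (zmod_morphMz (@embB F)) (zmod_morph0 (@embB F)).
    rewrite emb1 => /(congr1 (fun s : lser K => s 0 0)).
    rewrite !lcoefMz lcoef1 lcoef1 => /eqP.
    by rewrite (negPf (natF_neq0 charF n)).
  rewrite (zmod_morphMz (sigmaB charF)) sigma1// -[_ *~ _]/(1 *+ n.+1).
  by rewrite mulrnAl mul1r.
- by rewrite -(sigma_X12 charF); exact: setA_sigma.
- move=> h hh; apply: (setA_deriv (d := @dser1 F)) (hh); first exact: lD_mul.
  + exact: sigma_d1.
  + by apply: in_pser_lD (hh.1).
- move=> h hh; apply: (setA_deriv (d := @dser2 F)) (hh).
  + by move=> x y; apply: lm_deriv_mul; [exact: lDB|exact: lD_mul].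
  + exact: sigma_d2.
  + apply: in_pser_lm (hh.1); first exact: lDB.
    by move=> x; exact: in_pser_lD.
Qed.

Lemma setA_nneg h i j : setA h -> (i < 0) || (j < 0) -> h i j = 0.
Proof. by move=> [[h1 h2] _] /orP[i0|j0]; [rewrite h1|rewrite (h2 i).1]. Qed.

End FractionRing.

Lemma sub_mulE (R : comNzRingType) (s : lser (lser R)) i j :
  ((lX (lser R) - lconst (lX R)) * s) i j = s (i - 1) j - s i (j - 1).
Proof. exact: (@sub_scale R R^o s i j). Qed.

(** * Order of the pole along x1 = x2 *)

Section PoleOrder.
Variable F : fieldType.
Hypothesis charF : [pchar F] =i pred0.

Local Notation K := (lser F).
Local Notation Fx12 := (pser (pser F)).
Local Notation L3 := (lser (lser K)).
Local Notation x12 := (lX (lser K) - lconst (lX K)).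
Local Notation "x %:F" := (@FracField.tofrac _ x).
Implicit Types (p g : Fx12) (c : nat -> nat -> F).

(** For c the coefficients of p, this is the coefficient of t^m in p(t, t). *)
Definition dgn c (m : nat) : F := \sum_(i < m.+1) c i (m - i)%N.

Lemma dgn_deriv12 c m : dgn (deriv12 c) m = m.+1%:R * dgn c m.+1.
Proof.
rewrite /dgn mulr_sumr.
rewrite (eq_bigr (fun i : 'I_m.+2 =>
  i%:R * c i (m.+1 - i)%N + (m.+1 - i)%:R * c i (m.+1 - i)%N)); last first.
  by move=> i _; rewrite -mulrDl -natrD subnKC// -ltnS ltn_ord.
rewrite !big_split /= [X in _ = X + _]big_ord_recl [X in _ = _ + X]big_ord_recr /=.
rewrite subnn !mul0r add0r addr0; congr (_ + _); apply: eq_bigr => i _.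
by rewrite subSn // -ltnS ltn_ord.
Qed.

Lemma dgn_iter c k m : m`!%:R * dgn (iter k (@deriv12 F) c) m = (m + k)`!%:R * dgn c (m + k).
Proof.
elim: k m => [|k IH] m; first by rewrite addn0.
by rewrite iterS dgn_deriv12 mulrA -natrM mulnC -factS IH addSnnS.
Qed.

Lemma sigma_diag p (m : nat) : sigma p 0 0 m = dgn (cf p) m.
Proof.
rewrite -[0]/(Posz 0) sigma_nat.
have := dgn_iter (cf p) m 0; rewrite /= mul1r add0n /dgn big_ord1 /= => ->.
have mF : m`!%:R != 0 :> F.
  by have := natF_neq0 charF m`!.-1; rewrite prednK ?fact_gt0.
by rewrite mulKf.
Qed.

(** A quotient q by x1 - x2 must satisfy p_(i+1,j) = q_(i,j) - q_(i+1,j-1), which unfolds to this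
    sum along an antidiagonal. The equations left over, those for p_(0,j), amount to p(t, t) = 0. *)
Definition div_X12 p : Fx12 :=
  mk12 (fun i j => \sum_(l < j.+1) cf p (i.+1 + l) (j - l)).

Lemma mul_X12E g i j :
  cf (X12 F * g) i j = (if i is i'.+1 then cf g i' j else 0)
    - (if j is j'.+1 then cf g i j' else 0).
Proof.
rewrite -[LHS]/(zcf (X12 F * g) i j) -embE embM emb_X12.
rewrite sub_mulE !embE; congr (_ - _).
  case: i => [|i] //; rewrite (_ : i.+1%:Z - 1 = i%:Z); last by lia.
  by [].
case: j => [|j]; first by case: i.
by rewrite (_ : j.+1%:Z - 1 = j%:Z); last by lia.
Qed.

Lemma div_X12K p : sigma p 0 0 = 0 -> p = X12 F * div_X12 p.
Proof.
move=> p0; have d0 m : dgn (cf p) m = 0 by rewrite -sigma_diag p0.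
apply: cfP => i j; rewrite mul_X12E; case: i => [|i]; case: j => [|j].
- by have := d0 0%N; rewrite /dgn big_ord1 subr0.
- have := d0 j.+1; rewrite /dgn big_ord_recl /= subn0 cf_mk12 sub0r => /eqP.
  rewrite addr_eq0 => /eqP->; congr (- _); apply: eq_bigr => l _.
- by rewrite cf_mk12 big_ord1 addn0 subr0.
- rewrite !cf_mk12 big_ord_recl addn0 subn0.
  suff -> : \sum_(l < j.+1) cf p (i.+1 + lift ord0 l) (j.+1 - lift ord0 l) =
    \sum_(l < j.+1) cf p (i.+2 + l) (j - l) by rewrite addrK.
  apply: eq_bigr => l _; rewrite lift0 subSS.
  by congr (cf p _ _); rewrite !addSn addnS.
Qed.

(* Dividing p by x1 - x2 while p(t, t) = 0 leads to a factor whose expansion is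
   invertible in F((t))[[x1, x2]]. *)
Lemma pole_bound p : p != 0 ->
  exists k e, @pser2 F e /\ sigma p * e = x12 ^+ k.
Proof.
move=> pn0; have [i [j pij]] : exists i j, cf p i j != 0.
  apply: contrapT => np; move/eqP: pn0; apply; apply: cfP => i j.
  by apply: contrapT => /eqP pij; apply: np; exists i, j.
clear pn0; have [d] := ubnP (i + j); elim: d p i j pij => // d IH p i j pij ijd.
have hs := sigma_in_pser p.
have [s0|s0] := eqVneq (sigma p 0 0) 0; last first.
  have sT : subring (in_pser (fun _ : K => True)) := subring_pser (@subring_T K).
  have s0' : sigma p 0 != 0 by apply: contraNneq s0 => ->.
  have sn : sigma p != 0 by apply: contraNneq s0' => ->.
  exists 0%N, (sigma p)^-1; rewrite expr0 mulfV//; split=> //.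
  (* p(t, t) is nonzero in the field F((t)), hence a unit; inversion is applied once for x1 and once
     for x2. *)
  apply: in_pser_inv => //; apply: in_pser_inv => //.
  exact: hs.2.
have ep := div_X12K s0.
(* p_(i,j) is a difference of coefficients of the quotient of total degree i + j - 1, so one of them
   is nonzero and the degree drops. *)
have [i' [j' [qij dd]]] : exists i' j', cf (div_X12 p) i' j' != 0 /\ (i' + j' < d)%N.
  move: pij; rewrite {1}ep mul_X12E.
  case: i ijd => [|i] ijd; case: j ijd => [|j] ijd; rewrite ?subrr ?eqxx ?sub0r ?oppr_eq0 ?subr0//.
  - by move=> q; exists 0%N, j.
  - by move=> q; exists i, 0%N.
  - have [-> q|q _] := eqVneq (cf (div_X12 p) i j.+1) 0.
      by exists i.+1, j; rewrite -oppr_eq0 -sub0r; split=> //; lia.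
    by exists i, j.+1; split=> //; lia.
have [k [e [he eq]]] := IH _ _ _ qij dd.
exists k.+1, e; split=> //.
by rewrite ep (sigmaM charF) (sigma_X12 charF) -mulrA eq exprS.
Qed.

Lemma iotaM (x y : pser Fx12) : iota_pser (x * y) = iota_pser x * iota_pser y.
Proof.
rewrite !iota_emb valM.
by apply: lm_mul; [exact: embB|exact: embM].
Qed.

Lemma iota_neq0 (x : pser Fx12) : x != 0 -> iota_pser x != 0.
Proof.
apply: contraNneq => e; apply/eqP.
apply: pserP => i; apply: pserP => j; apply: pserP => k.
have : iota_pser x i%:Z j%:Z k%:Z = 0 by rewrite e.
by rewrite iota_emb (lmE _ i (@embB F)) (lmE _ j (@valB F)).
Qed.

(** [shift_t] and [iota_t21] each pick a representative, so [frac_morph] is applied once for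
    each. *)
Lemma iota_t21_shift (n d : Fx12) : d != 0 ->
  iota_t21 (shift_t (n%:F / d%:F)) = sigma n / sigma d.
Proof.
move=> d0; set f := n%:F / d%:F.
have fd0 : \d_(repr f) != 0 := denom_ratioP _.
have sE p : iota_pser (shift_t_pser p) = sigma p by rewrite unlock.
have Sd0 : shift_t_pser \d_(repr f) != 0.
  apply: contraNneq (sigma_neq0 fd0) => e; rewrite -sE e; apply/eqP.
  apply: lser3P => i j k.
  by rewrite iota_emb (lmE _ i (@embB F)) (lmE _ j (@valB F)).
rewrite /iota_t21 (frac_morph iotaM iota_neq0 Sd0 (erefl _)) !sE.
exact: (frac_morph (sigmaM charF) (sigma_neq0 (F := F)) d0 (erefl _)).
Qed.

End PoleOrder.

Lemma pole_fraction (L : fieldType) (s e x g : L) : s != 0 -> s * e = x ->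
  x * (g / s) = g * e.
Proof. by move=> s0 <-; rewrite mulrCA mulrAC mulfV ?mul1r. Qed.

Lemma pole_numerator (R : comNzRingType) (s e x g : R) : s * e = x ->
  s * (g * e) = g * x.
Proof. by move=> <-; rewrite mulrCA. Qed.

Lemma fraction_pole (L : fieldType) (s x h : L) : s != 0 -> x != 0 ->
  x * ((s * h) / (s * x)) = h.
Proof. by move=> s0 x0; field; rewrite s0 x0. Qed.

(** * From fractions to regular coefficients and back *)

Section FractionFamilies.
Variable F : fieldType.
Hypothesis charF : [pchar F] =i pred0.

Local Notation K := (lser F).
Local Notation Fx12 := (pser (pser F)).
Local Notation L3 := (lser (lser K)).
Local Notation x12 := (lX (lser K) - lconst (lX K)).
Implicit Types (p g : Fx12) (h : L3).

Lemma sigma_X12X k : sigma (X12 F ^+ k) = x12 ^+ k.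
Proof.
elim: k => [|k IH]; first by rewrite !expr0 (sigma1 charF).
by rewrite !exprS (sigmaM charF) IH (sigma_X12 charF).
Qed.

Lemma polynomial2_X12X k : polynomial2 (X12 F ^+ k).
Proof.
elim: k => [|k IH]; first exact: (polynomial2_int F 1).
by rewrite exprS; apply: polynomial2M => //; exact: polynomial2_X12.
Qed.

Lemma x12_neq0 : x12 != 0.
Proof. by rewrite -(sigma_X12 charF); exact/sigma_neq0/X12_neq0. Qed.

(** The power given by [pole_bound] clears the denominator, and further powers of x1 - x2 stay in
    the ring. *)
Lemma setA_pole f : Fstar12 f ->
  exists k0, forall k, (k0 <= k)%N -> setA (x12 ^+ k * iota_t21 (shift_t f)).
Proof.
move=> [g [p [pp p0 ->]]]; rewrite (iota_t21_shift charF g p0).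
have [k0 [e [he pe]]] := pole_bound charF p0; exists k0 => k /subnK <-.
have hA := setA_coefficient_ring charF.
rewrite exprD -mulrA; apply: (sAM hA); first exact: (sA_sub hA).
have s0 : sigma p != 0 := sigma_neq0 p0.
rewrite (pole_fraction (sigma g) s0 pe).
split; first by apply: in_pser_mul => //; [exact: (subring_pser (@subring_T K))|exact: sigma_in_pser].
exists p, (g * X12 F ^+ k0); split=> //.
by rewrite (sigmaM charF) sigma_X12X; exact: pole_numerator.
Qed.

(** Dividing the fraction behind h by (x1 - x2)^k stays within F_*, since x1 - x2 is a polynomial;
    this supplies the f_i of the Jacobi identity. *)
Lemma setA_frac k h : setA h ->
  exists2 f, Fstar12 f & x12 ^+ k * iota_t21 (shift_t f) = h.
Proof.
move=> [_ [p [g [pp p0 e]]]].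
have d0 : p * X12 F ^+ k != 0 by exact: (mulf_neq0 p0 (expf_neq0 k (X12_neq0 F))).
exists (FracField.tofrac g / FracField.tofrac (p * X12 F ^+ k)).
  exists g, (p * X12 F ^+ k); split=> //; apply: polynomial2M => //.
  exact: polynomial2_X12X.
rewrite (iota_t21_shift charF g d0) (sigmaM charF) sigma_X12X -e.
have s0 : sigma p != 0 := sigma_neq0 p0.
have xk0 : x12 ^+ k != 0 by rewrite expf_neq0// x12_neq0.
exact: fraction_pole.
Qed.

Variables (V : lmodType K) (psi : V -> V -> lser V).

Lemma Good_sum (A B : V -> Prop) (I : Type) (r : seq I) (h : I -> L3) (u v : I -> V) :
  (forall i, setA (h i)) -> (forall i, A (u i)) -> (forall i, B (v i)) ->
  (forall i, lin psi (u i)) -> (forall i, lin psi (v i)) ->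
  Good psi (@setA F) A B (fun w => \sum_(i <- r) h i *: lm (psi (v i)) (psi (u i) w)).
Proof.
move=> hh Au Bv lu lv; elim: r => [|i r IH].
  by apply: Good_ext (Good0 _ _ _ _) => w; rewrite big_nil.
by apply: Good_ext (GoodS (hh i) (Au i) (Bv i) (lu i) (lv i) IH) => w; rewrite big_cons.
Qed.

Lemma Good_family (A B : V -> Prop) G : Good psi (@setA F) A B G ->
  exists (n : nat) (h : 'I_n -> L3) (u v : 'I_n -> V), (forall i, setA (h i)) /\
    forall w, G w = \sum_(i < n) h i *: lm (psi (v i)) (psi (u i) w).
Proof.
elim=> [|h u v {}G hh _ _ _ _ _ [n [h' [u' [v' [hh' e]]]]]].
  by exists 0%N, (fun=> 0), (fun=> 0), (fun=> 0); split=> [[]//|w]; rewrite big_ord0.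
pose ext T (x : T) (y : 'I_n -> T) i := oapp y x (unlift ord0 i).
exists n.+1, (ext _ h h'), (ext _ u u'), (ext _ v v'); split=> [i|w].
  rewrite /ext; case: (unlift ord0 i) => [j|]; first exact: (hh' j).
  exact: hh.
rewrite big_ord_recl e /ext unlift_none.
suff -> : \sum_(i < n) h' i *: lm (psi (v' i)) (psi (u' i) w) = \sum_(i < n)
    oapp h' h (unlift ord0 (lift ord0 i)) *:
      lm (psi (oapp v' v (unlift ord0 (lift ord0 i))))
        (psi (oapp u' u (unlift ord0 (lift ord0 i))) w) by [].
by apply: eq_bigr => i _; rewrite liftK.
Qed.

(** The first family of [opposite_sum] acts in x2 and the second in x1, so [v'] lifts [a] and [u']
    lifts [b]. The extra power m clears the poles of all the fractions at once. *)
Lemma St_local_SL (U : V -> Prop) : (forall u, U u -> lin psi u) ->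
  St_local (psi @` U) -> forall u v, U u -> U v -> SL psi (@setA F) U U u v.
Proof.
move=> lU loc u v Uu Uv.
have [||n [a [b [f [k [Sa Sb hf e]]]]]] := loc (psi u) (psi v); [by exists u|by exists v|].
have /choice[u' hu'] : forall i, exists x, U x /\ psi x = b i.
  by move=> i; have [x Ux <-] := Sb i; exists x.
have /choice[v' hv'] : forall i, exists x, U x /\ psi x = a i.
  by move=> i; have [x Ux <-] := Sa i; exists x.
have /choice[k' hk'] := fun i => setA_pole (hf i).
pose m := (\max_(i < n) k' i)%N; exists (m + k)%N.
pose h i := x12 ^+ (m + k) * iota_t21 (shift_t (f i)).
exists (fun w => \sum_(i < n) h i *: lm (psi (v' i)) (psi (u' i) w)).
  apply: Good_sum => i; [|by have [] := hu' i|by have [] := hv' i| |].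
  - by apply: hk'; apply: leq_trans (leq_addr _ _); exact: leq_bigmax.
  - by apply: lU; have [] := hu' i.
  - by apply: lU; have [] := hv' i.
move=> w p q; rewrite iterD e -iterD iter_mul_sub_series /opposite_sum scaler_sumr.
suff -> : \sum_(i < n) h i *: lm (psi (v' i)) (psi (u' i) w) =
   \sum_(i < n) x12 ^+ (m + k) *: (iota_t21 (shift_t (f i)) *: lmap (a i) (b i w)) by [].
by apply: eq_bigr => i _; rewrite scalerA (hu' i).2 (hv' i).2.
Qed.

End FractionFamilies.

Lemma lser2_lowX (M : zmodType) (s : lser (lser M)) : lowX (fun m n => s m n).
Proof. by have [N hN] := lser_trunc s; exists N => p q /hN->. Qed.

Section Jacobi.
Variable F : fieldType.
Hypothesis charF : [pchar F] =i pred0.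
Local Notation K := (lser F).
Variables (V : lmodType K) (psi : V -> V -> lser V).
Variables (U : V -> Prop) (vac : V) (tau : K -> lser K).
Hypothesis hV : vertex_data psi (@setA F) U vac tau.

Lemma Sub_prod2 u v w :
  Sub (prod2 (psi u) (psi v) w) = fun i m => psi (psi u v i) w m.
Proof.
have [k hk] := compat_all hV u v; apply: funext2 => i m.
rewrite -(mode_opp (psi u) i v) (psi_nprod hV) (nprodE _ _ _ hk).
by have -> : - (- i - 1) - 1 = i by lia.
Qed.

(** The coefficients of the locality relation for (u, v) already contain (x1 - x2)^k; dividing it
    out by [setA_frac] gives the fractions, and [Sub_prod2] identifies the third term of
    [jacobi_core]. *)
Lemma jacobi u v : exists (n : nat) (u' v' : 'I_n -> V)
    (f : 'I_n -> {fraction pser (pser F)}),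
  (forall i, Fstar12 (f i)) /\
  forall (w : V) (n0 n1 n2 : int),
    mul3 delta_12_0
      (fun m0 m1 m2 => if m0 == 0 then prod2 (psi u) (psi v) w m1 m2 else 0)
      n0 n1 n2
    - mul3 delta_21_0
      (fun m0 m1 m2 =>
         if m0 == 0 then
           opposite_sum f (fun i => psi (v' i)) (fun i => psi (u' i)) w m1 m2
         else 0)
      n0 n1 n2
    = mul3 delta_10_2
      (fun m0 m1 m2 => if m1 == 0 then psi (psi u v m0) w m2 else 0)
      n0 n1 n2.
Proof.
have [k [G hG e]] := SL_all hV u v.
have [n [h [u' [v' [hh eG]]]]] := Good_family hG.
have /choice[f hf] : forall i, exists x, Fstar12 x /\
    (lX (lser K) - lconst (lX K)) ^+ k * iota_t21 (shift_t x) = h i.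
  by move=> i; have [x hx ex] := setA_frac charF k (hh i); exists x.
exists n, u', v', f; split=> [i|w n0 n1 n2]; first by have [] := hf i.
pose B := opposite_sum f (fun i => psi (v' i)) (fun i => psi (u' i)) w.
rewrite fsum_delta12 (fsum_delta21 (fun m n => B m n)).
rewrite (fsum_delta10 (fun m n => psi (psi u v m) w n)) -Sub_prod2.
rewrite (@jacobi_core _ k _ (fun m n => B m n) (lowY_prod2 hV u v w) (lser2_lowX B)).
  by rewrite /add2 addrAC subrr add0r.
apply: funext2 => p q; rewrite e eG iter_mul_sub_series.
rewrite /B /opposite_sum scaler_sumr.
suff -> : \sum_(i < n) h i *: lm (psi (v' i)) (psi (u' i) w) =
  \sum_(i < n) (lX (lser K) - lconst (lX K)) ^+ k *: (iota_t21 (shift_t (f i)) *: lmap (psi (v' i)) (psi (u' i) w)) by [].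
by apply: eq_bigr => i _; rewrite scalerA (hf i).2.
Qed.

End Jacobi.

(** * The expansion of f(t + x) *)

Section ShiftX.
Variable F : fieldType.
Hypothesis charF : [pchar F] =i pred0.
Implicit Types f : lser F.

Lemma shift_xE f (k : nat) : shift_x f k = lconst (k`!%:R^-1) * iter k (@lderiv F) f.
Proof. by rewrite /shift_x mkLE//; exists 0 => -[]. Qed.

Lemma shift_x_neg f n : n < 0 -> shift_x f n = 0.
Proof. by case: n => // n _; rewrite /shift_x mkLE//; exists 0 => -[]. Qed.

Lemma shift_x0 f : shift_x f 0 = f.
Proof. by rewrite -[0]/(Posz 0) shift_xE /= invr1 rmorph1 mul1r. Qed.

Lemma lderivE f n : lderiv f n = (n + 1)%:~R * f (n + 1).
Proof.
rewrite /lderiv mkLE//; have [a ha] := lser_trunc f; exists (a - 1) => m ma.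
by rewrite ha ?mulr0//; lia.
Qed.

Lemma lconst_mulE c f n : (lconst c * f) n = c * f n.
Proof. exact: (@lconst_scale F F^o c f n). Qed.

Lemma iter_lderiv_mul k c f :
  iter k (@lderiv F) (lconst c * f) = lconst c * iter k (@lderiv F) f.
Proof.
elim: k => //= k ->; apply: lserP => n.
by rewrite lderivE !lconst_mulE lderivE mulrCA.
Qed.

Lemma fact_neq0 n : n`!%:R != 0 :> F.
Proof. by have := natF_neq0 charF n`!.-1; rewrite prednK ?fact_gt0. Qed.

(** Both sides involve the derivative of order m + i, and 1/(m! i!) = binom(m + i, i)/(m + i)!. *)
Lemma shift_xx f i m : shift_x (shift_x f i) m = shift_x f (m + i) *~ bz (m + i) i.
Proof.
have s0 n : shift_x (0 : lser F) n = 0.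
  case: n => [n|n]; last by rewrite shift_x_neg.
  rewrite shift_xE; suff -> : iter n (@lderiv F) 0 = 0 by rewrite mulr0.
  by elim: n => //= n ->; apply: lserP => m'; rewrite lderivE lcoef0 mulr0.
case: i => [i|i]; last by rewrite (shift_x_neg f)// s0 bz_neg// mulr0z.
case: m => [m|m]; last first.
  rewrite shift_x_neg//; case e : (Negz m + i) => [l|l].
    by rewrite bz_small ?mulr0z//; lia.
  by rewrite shift_x_neg ?mul0rz.
rewrite -PoszD !shift_xE iter_lderiv_mul mulrA -rmorphM iterD -mulrzAl.
have eM (x : F) k : lconst x *~ k = lconst (x *~ k) by rewrite raddfMz.
rewrite eM.
have -> : m`!%:R^-1 * i`!%:R^-1 = (m + i)`!%:R^-1 *~ bz (m + i)%N i :> F; last by [].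
rewrite /bz /binz -pmulrn -[RHS]mulr_natl -invfM.
apply: (mulIf (fact_neq0 (m + i))); rewrite mulfVK ?fact_neq0//.
rewrite -(bin_fact (leq_addl m i)) addnK !natrM mulrC [_ * m`!%:R]mulrC -mulrA mulfV ?mulr1//.
by rewrite mulf_neq0 ?fact_neq0.
Qed.

End ShiftX.

Lemma lconst_compatible (K : comNzRingType) (V : lmodType K) (a : V -> lser V) :
  zmod_morphism a -> compatible_pair 0 a (@lconst V).
Proof.
move=> aB w; have [N hN] := lser_trunc (a w); exists (Num.min N 0) => m n mn.
rewrite /= /prod2 lconstE; case: eqP => [n0|_]; last by rewrite (zmod_morph0 aB).
by rewrite hN//; move: mn; rewrite n0; lia.
Qed.

(** There is no pole at x1 = x2 and no dependence on x2, so setting x0 = 0 returns a(x). *)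
Lemma nprod_lconst (K : comNzRingType) (V : lmodType K) (a : V -> lser V) :
  zmod_morphism a -> nprod a (-1) (@lconst V) = a.
Proof.
move=> aB; have hk := lconst_compatible aB.
apply/funext => w; apply: lserP => m.
rewrite (nprodE _ _ _ hk) (SubE _ _ (hk w)) /= sbE (@isum1 _ _ m).
  by rewrite bz0 mulr1z /prod2 lconstE ifT//; apply/eqP; lia.
move=> p pm; rewrite /prod2 lconstE; case: eqP => [e|_].
  by move/eqP: pm; case; lia.
by rewrite (zmod_morph0 aB) lcoef0 mul0rz.
Qed.

Lemma restr_lconst_scale (F : fieldType) (V : lmodType (lser F)) (c : F) (s : lser V) :
  (lconst c : lser F) *: (s : lser (restr V)) = lconst (lconst c) *: s.
Proof.
apply: lserP => n.
by rewrite (@lconst_scale F (restr V) c s n) (@lconst_scale (lser F) V (lconst c) s n).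
Qed.

Lemma lmod_torsion_free (F : fieldType) (V : lmodType (lser F)) :
  [pchar F] =i pred0 -> torsion_free V.
Proof.
move=> charF x n /(congr1 ( *:%R (n.+1%:R^-1 : lser F))).
by rewrite scaler0 -scaler_nat scalerA mulVf ?scale1r// natK_neq0.
Qed.

Theorem theorem5p7 (F : fieldType) (charF : [pchar F] =i pred0)
  (V : lmodType (lser F)) (vac : V)
  (U : set V)
  (U0 : U 0)
  (Ulin : forall (f : lser F) (u v : V), U u -> U v -> U (f *: u + v))
  (Y0 : V -> V -> lser V)
  (Y0_hom : forall u, U u -> calE (Y0 u))
  (Y0_linear : forall (c : F) (u v : V), U u -> U v ->
     Y0 (lconst c *: u + v) = lconst (lconst c) *: Y0 u + Y0 v)
  (Y0_creation : forall u, U u ->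
     (forall n : int, n < 0 -> Y0 u vac n = 0) /\ Y0 u vac 0 = u)
  (Y0_scale : forall (f : lser F) (u : V), U u ->
     Y0 (f *: u) = shift_x f *: Y0 u)
  (Y0_compatible : compatible (Y0 @` U))
  (V_spanned : forall v : V,
     lspan [set w | exists s : seq (V * int),
              (forall p, p \in s -> U p.1) /\
              w = foldr (fun p v' => mode (Y0 p.1) p.2 v') vac s] v)
  (psi : V -> V -> lser V)
  (psi_mem : forall v, lspan (generated (Y0 @` U)) (psi v))
  (psi_linear : forall (c : F) (u v : V),
     psi (lconst c *: u + v) = lconst (lconst c) *: psi u + psi v)
  (psi_scale : forall (f : lser F) (v : V), psi (f *: v) = shift_x f *: psi v)
  (psi_vac : psi vac = @lconst V)
  (psi_mode : forall (u : V) (n : int) (v : V), U u ->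
     psi (mode (Y0 u) n v) = nprod (Y0 u) n (psi v))
  (U_local : St_local (Y0 @` U)) :
  (forall u, U u -> psi u = Y0 u) /\ weak_quantum_vertex_Ft_algebra psi vac.
Proof.
have psiY u : U u -> psi u = Y0 u.
  move=> Uu; have [_ u0] := Y0_creation u Uu.
  (* Since u = u_(-1) 1, one gets psi(u) = u(x)_(-1) 1_V = u(x). *)
  rewrite -[u in LHS]u0 -[Y0 u vac 0]/(mode (Y0 u) (-1) vac) (psi_mode u (-1) vac Uu) psi_vac.
  exact: nprod_lconst (calEB (Y0_hom u Uu)).
split=> //.
have psiD u v : psi (u + v) = psi u + psi v.
  by have := psi_linear 1 u v; rewrite !rmorph1 !scale1r.
have eU : psi @` U = Y0 @` U.
  by apply/seteqP; split=> _ [u Uu <-]; exists u => //; rewrite psiY.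
have linU u : U u -> lin psi u by move=> Uu; rewrite /lin psiY//; exact: (Y0_hom u Uu).
have hV : vertex_data psi (@setA F) U vac (@shift_x F).
  split.
  - exact: setA_coefficient_ring.
  - exact: lmod_torsion_free.
  - exact: psiD.
  - exact: psi_scale.
  - exact: psi_vac.
  - by move=> u n v Uu; rewrite (psiY u Uu); exact: psi_mode.
  - exact: linU.
  - by apply: (St_local_SL charF linU); rewrite eU.
  (* Induction along the spanning words; the operators [Y0] in them are those of [psi], by
     [psiY]. *)
  - move=> Pr P0 Pvac Pcomb Pmode v.
    have [n [c [b [hb ->]]]] := V_spanned v.
    elim/big_rec: _ => // i x _; apply: (Pcomb).
    have [s [hs ->]] := hb i.
    elim: s hs => //= p s IH hs.
    rewrite -psiY; last by apply: hs; rewrite mem_head.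
    apply: (Pmode); first by apply: hs; rewrite mem_head.
    by apply: IH => q qs; apply: hs; rewrite inE qs orbT.
  - exact: shift_x_neg.
  - exact: shift_x0.
  - exact: shift_xx.
  - by move=> u Uu; rewrite (psiY u Uu); exact: Y0_creation.
  - by move=> h hh i j; exact: setA_nneg.
split; last exact: (jacobi charF hV).
split=> [|f g u v]; last first.
  by rewrite psi_scale -[LHS]/(shift_x f *: psi u (g *: v)) (calEZ _ _ (lin_all hV u)) scalerA.
split.
- move=> c u v; rewrite -[LHS]/(psi (lconst c *: (u : V) + v)) psi_linear.
  apply/funext => w.
  by rewrite -[LHS]/(lconst (lconst c) *: psi u w + psi v w) -restr_lconst_scale.
- move=> u c v w; rewrite [RHS](_ : _ = lconst (lconst c) *: psi u v + psi u w).
    exact: lin_all hV u (lconst c) v w.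
  by rewrite -restr_lconst_scale.
- by move=> v; rewrite psi_vac.
- exact: (psi_creation hV).
- exact: (psi_weak_assoc hV).
Qed.
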